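(* Suppose that $f_0\in\mathcal{F}(\alpha,K,\mu)$ for some $\mu>0$, $0<\alpha\le 1$ and $K\ge 0$. Let $\Pi$ be an OPT prior with split probabilities $p_{lk}=\Gamma^{-l}$, $l\ge 0$, $0\le k<2^l$, $\Gamma>0$, and parameter $a>0$. Then, for $\Gamma$ large enough, for any sequence $M_n\to\infty$, and with $\varepsilon_n=\varepsilon_n(\alpha)=(n^{-1}\log^2 n)^{\alpha/(1+2\alpha)}$, as $n\to\infty$, $$E_{f_0}\,\Pi\big[\,\|f-f_0\|_\infty>M_n\varepsilon_n\,\big|\,X\big]\to 0 .$$
   Context: Model: one observes $X=(X_1,\dots,X_n)$. In the Bayesian model $f\sim\Pi$ and, given $f$, $X_1,\dots,X_n$ are i.i.d. with density $f$ on $[0,1)$ (w.r.t. Lebesgue measure); $\Pi[\cdot\,|\,X]$ is the posterior distribution. It is studied under the assumption that $X_1,\dots,X_n$ are i.i.d. from the law $P_{f_0}$ with density $f_0$; $E_{f_0}$ is the expectation under $P_{f_0}^{\otimes n}$. Regularity class: $\Sigma(\alpha,K)=\{f:[0,1)\to\mathbb{R},\ \sup_{x\ne y}|f(x)-f(y)|/|x-y|^\alpha\le K\}$ and $\mathcal{F}(\alpha,K,\mu)=\{f\ge\mu,\ \int_0^1 f=1,\ f\in\Sigma(\alpha,K)\}$. Trees: a full binary tree is a set $\mathcal{T}$ of nodes $(l,k)$, $l\ge 0$, $0\le k\le 2^l-1$, such that if $(l,k)\in\mathcal{T}$ and $l>0$ then $(l-1,\lfloor k/2\rfloor)\in\mathcal{T}$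 (the parent) and $(l,k+(-1)^k)\in\mathcal{T}$ (the sibling). The root is $(0,0)$; $\mathcal{T}_{\rm ext}$ is the set of nodes without children (leaves) and $\mathcal{T}_{\rm int}=\mathcal{T}\setminus\mathcal{T}_{\rm ext}$. Let $L_{\max}=\lfloor\log_2(n/\log^2 n)\rfloor$. Dyadic notation: $I_{lk}=[k2^{-l},(k+1)2^{-l})$; the node $(l,k)$ is identified with the binary word $\epsilon=\epsilon_1\cdots\epsilon_l\in\{0,1\}^l$ with $k2^{-l}=\sum_{i=1}^l\epsilon_i2^{-i}$ (the empty word for the root), and $\epsilon^{[i]}=\epsilon_1\cdots\epsilon_i$. Prior: the OPT prior (Optional P\'olya tree with splits at midpoints) with split probabilities $(p_{lk})$ and parameter $a>0$ is the law of the random density $f$ generated as follows. (1) A random tree $\mathcal{T}$ is drawn from $\mathrm{GW}(p)$: starting from the root, each node $(l,k)$ present in the tree with $l<L_{\max}$ independently is given the two children $(l+1,2k),(l+1,2k+1)$ with probability $p_{lk}$ and is a leaf with probability $1-p_{lk}$; nodes at level $L_{\max}$ are never split (i.e. $p_{L_{\max}k}=0$). (2) Given $\mathcal{T}$, $f=\sum_{(l,k)\in\mathcal{T}_{\rm ext}}h_{lk}\mathbf 1_{I_{lk}}$ with $h_{lk}=2^l\prod_{i=1}^lY_{\epsilon^{[i]}}$, where $\epsilon$ is the word of $(l,k)$, the variables $Y_{\epsilon0}$, over all finite binary words $\epsilon$, are independent $\mathrm{Beta}(a,a)$, and $Y_{\epsilon1}=1-Y_{\epsilon0}$. *)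

(* Defs.v *)
From HB Require Import structures.
From mathcomp Require Import all_boot all_order all_algebra.
From mathcomp Require Import all_classical all_reals all_analysis.

Set Implicit Arguments.
Unset Strict Implicit.
Unset Printing Implicit Defensive.
Import Order.TTheory GRing.Theory Num.Theory.
Import numFieldNormedType.Exports.
Local Open Scope classical_set_scope.
Local Open Scope ring_scope.

(* Functions on [0, 1) are represented by functions R -> R, of which only the
   restriction to [0, 1) is ever used. *)
Section densities.
Context {R : realType}.
Implicit Types f g : R -> R.

Definition holder_quotients (alpha : R) f : set (\bar R) :=
  [set e | exists x y : R, [/\ x \in `[0, 1[, y \in `[0, 1[, x != y
           & e = (`|f x - f y| / `|x - y| `^ alpha)%:E]].

Definition holder_ball (alpha K : R) : set (R -> R) :=
  [set f | (ereal_sup (holder_quotients alpha f) <= K%:E)%E].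

Definition holder_density (alpha K mu : R) : set (R -> R) :=
  [set f | [/\ forall x : R, x \in `[0, 1[ -> mu <= f x,
               (\int[lebesgue_measure]_(x in `[0%R, 1%R[) (f x)%:E = 1)%E
             & holder_ball alpha K f]].

Definition sup_dist f g : \bar R :=
  ereal_sup [set (`|f x - g x|)%:E | x in `[0%R, 1%R[].

Definition has_density (P : probability R R) f :=
  forall A : set R, measurable A ->
    P A = (\int[lebesgue_measure]_(x in A `&` `[0%R, 1%R[) (f x)%:E)%E.

Definition rate (alpha : R) (n : nat) : R :=
  (ln n%:R ^+ 2 / n%:R) `^ (alpha / (1 + 2 * alpha)).

(* The library's beta_prob only has natural number parameters. *)
Definition beta_weight (a : R) (A : set R) : \bar R :=
  (\int[lebesgue_measure]_(y in A `&` `]0%R, 1%R[)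
     (y `^ (a - 1) * (1 - y) `^ (a - 1))%:E)%E.

Definition beta_law (a : R) (A : set R) : \bar R :=
  (beta_weight a A / beta_weight a setT)%E.

End densities.

(* The junk values at n = 0, 1 are irrelevant; for n >= 2 the argument of
   Num.truncn is nonnegative, so that Num.truncn is its floor. *)
Definition Lmax (R : realType) (n : nat) : nat :=
  Num.truncn (ln (n%:R / ln (n%:R : R) ^+ 2) / ln 2).

Section product_probability.
Context d (T : measurableType d) {R : realType} (P : probability T R).

Definition tuple_cons n (z : T * n.-tuple T) : n.+1.-tuple T :=
  [tuple of z.1 :: z.2].

Lemma measurable_tuple_cons n : measurable_fun setT (@tuple_cons n).
Proof. exact: (@measurable_cons _ _ _ _ fst n snd). Qed.

HB.instance Definition _ n :=
  isMeasurableFun.Build _ _ _ _ (@tuple_cons n) (@measurable_tuple_cons n).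

Fixpoint product_prob (n : nat) : probability (n.-tuple T) R :=
  match n with
  | 0 => @dirac _ (0.-tuple T) [tuple] R
  | m.+1 => distribution (P \x product_prob m)%E (@tuple_cons m)
  end.

End product_probability.

(* The node (l, k) is the word of length l whose binary value is k, the first
   letter being the most significant one: the children (l+1, 2k), (l+1, 2k+1)
   of w are [rcons w false] and [rcons w true], and eps^[i] is [take i w]. *)
Definition node := seq bool.

Definition node_index (w : node) : nat :=
  \sum_(i < size w) nth false w i * 2 ^ (size w - i.+1).

Definition dyadic_interval (R : realType) (w : node) : set R :=
  [set x | (node_index w)%:R / 2 ^+ size w <= x
           < (node_index w).+1%:R / 2 ^+ size w].

Definition external_nodes (T : set node) : set node :=
  [set w | T w /\ forall b, ~ T (rcons w b)].

Definition gw_tree (L : nat) (split : node -> bool) : set node :=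
  [set w | forall i, (i < size w)%N -> (i < L)%N && split (take i w)].

Section opt.
Context {R : realType}.

(* y is indexed by the nonempty words; its value at [::] is not used. *)
Definition leaf_height (y : node -> R) (w : node) : R :=
  2 ^+ size w * \prod_(1 <= i < (size w).+1) y (take i w).

(* The finitely supported sum is the intended one whenever T has finitely many
   external nodes, as gw_tree L split does: its nodes have level at most L. *)
Definition tree_density (T : set node) (y : node -> R) (x : R) : R :=
  \sum_(w \in external_nodes T) leaf_height y w * \1_(dyadic_interval w) x.

Context d (Omega : measurableType d) (P : probability Omega R).

Definition mutually_independent (I : eqType) (G : I -> set (set Omega)) :=
  forall (J : seq I) (E : I -> set Omega), uniq J ->
    (forall i, i \in J -> G i (E i)) ->
    P (\bigcap_(i in [set` J]) E i) = (\prod_(i <- J) P (E i))%E.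

(* S w tells whether w is split; only its values at levels < Lmax are used. *)
Record opt_variables (p : node -> R) (a : R)
    (S : node -> {RV P >-> bool}) (Y : node -> {RV P >-> R}) : Prop := {
  opt_split_law : forall w A, distribution P (S w) A = bernoulli_prob (p w) A;
  opt_beta_law : forall w A, measurable A ->
    distribution P (Y (rcons w false)) A = beta_law a A;
  opt_sibling : forall w om, Y (rcons w true) om = 1 - Y (rcons w false) om;
  opt_independent :
    mutually_independent (fun v : node + node =>
      match v with
      | inl w => g_sigma_algebra_preimage (S w)
      | inr w => g_sigma_algebra_preimage (Y (rcons w false))
      end) }.

(* The random density whose law is the OPT prior truncated at level L. *)
Definition opt_density (L : nat) (S : node -> {RV P >-> bool})
    (Y : node -> {RV P >-> R}) (om : Omega) : R -> R :=
  tree_density (gw_tree L (fun w => S w om)) (fun w => Y w om).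

Definition likelihood (f : R -> R) n (x : n.-tuple R) : R :=
  \prod_(i < n) f (tnth x i).

(* Bayes' formula for the posterior probability of B, the prior being the law
   of the random density f. *)
Definition posterior (f : Omega -> R -> R) n (x : n.-tuple R)
    (B : set (R -> R)) : \bar R :=
  ((\int[P]_(om in f @^-1` B) (likelihood (f om) x)%:E) /
   (\int[P]_om (likelihood (f om) x)%:E))%E.

End opt.

(* Main.v *)
Require Import Defs.
From HB Require Import structures.
From mathcomp Require Import all_boot all_order all_algebra.
From mathcomp Require Import all_classical all_reals all_analysis.
From mathcomp Require Import finmap measurable_realfun ring lra zify.
Set Implicit Arguments.
Unset Strict Implicit.
Unset Printing Implicit Defensive.
Import Order.TTheory GRing.Theory Num.Theory.
Import numFieldNormedType.Exports.
Local Open Scope classical_set_scope.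
Local Open Scope ring_scope.

(** The prior is conjugate.  If an observation lies in the leaf of a word, its
    density is the product of [2 * Y] along the word; grouping the observations
    by nodes, the likelihood of a tree is a product over its split nodes [w] of
    [(2 Y_w0) ^ N_w0 * (2 Y_w1) ^ N_w1], where [N_v] is the number of
    observations in the interval of [v] (likelihood_split_product).  The
    variables of disjoint subtrees are independent, so the prior expectation of
    the likelihood below a node satisfies a Galton-Watson recursion
    ([marginal]), in which a split at [w] has weight [p_w] times its evidence
    [E ((2 Y_w0) ^ N_w0 * (2 Y_w1) ^ N_w1)].  Moreover the posterior
    probability of an event that concerns the variables of one node, once this
    node is reached, is at most the expectation of the likelihood of the subtree
    on the event divided by its full expectation (posterior_node_events).

    It remains to control finitely many ratios when the counts are typical,
    [|N_v - n P_v| <= 6 sqrt (n P_v log n)] for all nodes considered, which holds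
    with probability tending to one by Chernoff's bound (atypical_prob).  With
    [q = N_w0 / N_w], the evidence of a split is at most the maximal likelihood
    [(2 q) ^ N_w0 * (2 (1 - q)) ^ N_w1], and at least a constant times [1 / n]
    times it, because the Beta density is bounded below near [q]; the maximal
    likelihood itself lies between the exponentials of
    [(N_w0 - N_w1) ^ 2 / (8 N_w)] and [(N_w0 - N_w1) ^ 2 / N_w].
    Three kinds of events are then exceptional.

    - Below a level [L2] with [2 ^ L2] of order [(n / log n) ^ (1 / (1 + 2 alpha))]
      the Hoelder condition bounds the imbalance of a split by the noise, its
      evidence is at most a fixed power of [n], and the prior weight
      [Gamma ^ - l] beats it when [Gamma] is large (deep_event).
    - A node is significant if its imbalance exceeds a large multiple of
      [log n ^ 2].  The evidence of such a node is at least
      [exp (A' * log n ^ 2)], which pays for the prior weights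
      [Gamma ^ - l] and the factors [1 / n] of all the [O (log n)] splits on the
      path to it; hence no leaf has a significant node below it, down to a level
      [L1] with [2 ^ L1] of order [(n / log n ^ 2) ^ (1 / (1 + 2 alpha))]
      (significant_event).
    - At a split node the proportion [Y] is within a multiple of
      [sqrt (log n / N_w)] of its true value, since the likelihood decays like
      [exp (- N_w (y - q) ^ 2 / 2)] away from [q] (far_event).

    Outside these events, at a point [z] whose leaf has level [j <= L2], the
    height of the histogram differs from the mean of [f0] over the leaf by a
    geometric sum dominated by [sqrt (2 ^ L2 * log n / n)]; and the mean of [f0]
    over the leaf differs from [f0 z] by the insignificant increments of the
    means between levels [j] and [L1], again a geometric sum, dominated by
    [log n * sqrt (2 ^ L1 / n)], plus the Hoelder bias [K * 2 ^ (- alpha L1)].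
    All of these are of the order of the rate (levels_exist). *)

(** * Integrals of nonnegative functions *)

Section lower_integral.
Local Open Scope ereal_scope.
Context d (T : measurableType d) {R : realType}.
Variable mu : {measure set T -> \bar R}.

(** The integral of a nonnegative function is a supremum over the simple
    functions below it, so that monotonicity needs no measurability. *)
Lemma le_integral_subset (D E : set T) (f g : T -> \bar R) :
  (forall x, D x -> 0 <= f x) -> (forall x, E x -> 0 <= g x) ->
  (forall x, D x -> E x /\ f x <= g x) ->
  \int[mu]_(x in D) f x <= \int[mu]_(x in E) g x.
Proof.
move=> f0 g0 fg; rewrite !ge0_integralE//; apply: le_ereal_sup => _ [h hf <-].
exists h => // x; apply: (le_trans (hf x)).
rewrite !patchE; case: ifPn => [/set_mem Dx|_].
  by have [Ex ?] := fg _ Dx; rewrite (mem_set Ex).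
by case: ifPn => // /set_mem; exact: g0.
Qed.

Lemma le_integral_ge0 (D : set T) (f g : T -> \bar R) :
  (forall x, D x -> 0 <= f x) -> (forall x, D x -> f x <= g x) ->
  \int[mu]_(x in D) f x <= \int[mu]_(x in D) g x.
Proof.
move=> f0 fg; apply: le_integral_subset => // x Dx; last by split=> //; exact: fg.
exact: le_trans (f0 _ Dx) (fg _ Dx).
Qed.

(** For the integral of a function that may take both signs, whether or not it
    is measurable. *)
Lemma le_integral_funepos (D : set T) (f : T -> \bar R) :
  \int[mu]_(x in D) f x <= \int[mu]_(x in D) f^\+ x.
Proof.
rewrite integralE; have := integral_ge0 mu (D := D) (f := f^\-).
move=> /(_ (fun x _ => funeneg_ge0 f x)).
case: (integral mu D f^\-) => [r| |]//; last by rewrite /= addeNy leNye.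
by rewrite lee_fin => r0; rewrite leeBlDr// leeDl// lee_fin.
Qed.

End lower_integral.

Section independence.
Context d (Omega : measurableType d) {R : realType} (P : probability Omega R).

Import HBNNSimple.

(** A product rule against the indicators of the events of [X] extends to all
    nonnegative functions of [X], by approximation by simple functions. *)
Lemma integral_mul_comp d' (T : measurableType d') (H : Omega -> R)
    (X : Omega -> T) (g : T -> R) :
  measurable_fun setT H -> (forall om, 0 <= H om) ->
  measurable_fun setT X -> measurable_fun setT g -> (forall r, 0 <= g r) ->
  (\int[P]_om (H om)%:E < +oo)%E ->
  (forall A, measurable A -> \int[P]_om (H om * \1_A (X om))%:E =
      \int[P]_om (H om)%:E * P (X @^-1` A))%E ->
  (\int[P]_om (H om * g (X om))%:E =
   \int[P]_om (H om)%:E * \int[P]_om (g (X om))%:E)%E.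
Proof.
move=> mH H0 mX mg g0 Hoo HA.
have H0' om : (0 <= (H om)%:E)%E by rewrite lee_fin.
have IH0 : (0 <= \int[P]_om (H om)%:E)%E by exact: integral_ge0.
have sf (h : {nnsfun T >-> R}) : (\int[P]_om (H om * h (X om))%:E =
   \int[P]_om (H om)%:E * \int[P]_om (h (X om))%:E)%E.
  pose s := fset_set (h @` setT).
  have s0 (i : 'I_(#|`s|)) : 0 <= s`_i.
    have : s`_i \in s by rewrite mem_nth.
    rewrite in_fset_set; last exact: fimfunP.
    by move=> /set_mem[y _ <-]; exact: fun_ge0.
  pose A (i : 'I_(#|`s|)) := h @^-1` [set s`_i].
  have mA i : measurable (A i).
    by rewrite /A -[X in measurable X]setTI; exact: measurable_funP.
  have m1 i : measurable_fun setT (fun om => \1_(A i) (X om) : R).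
    by apply: measurableT_comp => //; exact: measurable_indic.
  have mHA i : measurable_fun setT (fun om => H om * \1_(A i) (X om)).
    by apply: measurable_funM => //; exact: m1.
  under eq_integral.
    move=> om _.
    rewrite fimfunEord mulr_sumr -sumEFin.
    under eq_bigr do rewrite mulrCA EFinM.
    over.
  under [X in (_ = _ * X)%E]eq_integral.
    move=> om _.
    rewrite fimfunEord -sumEFin.
    under eq_bigr do rewrite EFinM.
    over.
  rewrite ge0_integral_sum//; last 2 first.
  - by move=> i; apply: measurable_funeM; apply/measurable_EFinP; exact: mHA.
  - by move=> i om _; rewrite -EFinM lee_fin !mulr_ge0.
  rewrite ge0_integral_sum//; last 2 first.
  - move=> i; apply: measurable_funeM; apply/measurable_EFinP; exact: m1.
  - by move=> i om _; rewrite -EFinM lee_fin !mulr_ge0.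
  rewrite ge0_sume_distrr; last first.
    by move=> i _; apply: integral_ge0 => om _; rewrite -EFinM lee_fin !mulr_ge0.
  apply: eq_bigr => i _.
  rewrite ge0_integralZl_EFin//; last 2 first.
  - by move=> om _; rewrite lee_fin !mulr_ge0.
  - by apply/measurable_EFinP; exact: mHA.
  rewrite ge0_integralZl_EFin//; last by apply/measurable_EFinP; exact: m1.
  rewrite HA// muleCA; congr (_ * (_ * _))%E.
  have -> : (fun om => (\1_(A i) (X om))%:E) = (fun om => (\1_(X @^-1` A i) om)%:E :> \bar R) by [].
  rewrite integral_indic ?setIT//.
  by rewrite -[X in measurable X]setTI; exact: mX.
have mg' : measurable_fun setT (EFin \o g) by exact/measurable_EFinP.
pose gn := nnsfun_approx measurableT mg'.
have cvgg om : (gn n (X om))%:E @[n --> \oo] --> (g (X om))%:E.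
  by apply: cvg_nnsfun_approx => //= x _; rewrite lee_fin.
have ndg om : {homo (fun n => gn n (X om)) : m n / (m <= n)%N >-> m <= n}.
  by move=> m n mn; exact/lefP/nd_nnsfun_approx.
have l1 : (\int[P]_om (gn n (X om))%:E)%E @[n --> \oo] --> (\int[P]_om (g (X om))%:E)%E.
  have -> : (\int[P]_om (g (X om))%:E = \int[P]_om limn (fun n => (gn n (X om))%:E))%E.
    apply: eq_integral => om _; apply/esym/cvg_lim => //.
  apply: cvg_monotone_convergence => //.
  - move=> n; apply/measurable_EFinP.
    by apply: measurableT_comp => //; exact: measurable_funP.
  - by move=> n om _; rewrite lee_fin.
  - by move=> om _ m n mn; rewrite lee_fin ndg.
have l2 : (\int[P]_om (H om * gn n (X om))%:E)%E @[n --> \oo] -->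
    (\int[P]_om (H om * g (X om))%:E)%E.
  have -> : (\int[P]_om (H om * g (X om))%:E =
      \int[P]_om limn (fun n => (H om * gn n (X om))%:E))%E.
    apply: eq_integral => om _; apply/esym/cvg_lim => //.
    under eq_fun do rewrite EFinM.
    by rewrite EFinM; apply: cvgeZl.
  apply: cvg_monotone_convergence => //.
  - move=> n; apply/measurable_EFinP; apply: measurable_funM => //.
    exact: measurableT_comp.
  - by move=> n om _; rewrite lee_fin mulr_ge0.
  - by move=> om _ m n mn; rewrite lee_fin ler_wpM2l// ndg.
apply/esym; apply: cvg_unique l2 => //.
rewrite (_ : (fun n => _) = fun n => (\int[P]_om (H om)%:E *
    \int[P]_om (gn n (X om))%:E)%E); last by apply/funext => n; exact: sf.
by apply: cvgeZl => //; rewrite ge0_fin_numE.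
Qed.


Context (I : eqType) (X : I -> Omega -> R).
Hypothesis mX : forall i, measurable_fun setT (X i).
Hypothesis indepX : forall (J : seq I) (A : I -> set R), uniq J ->
  (forall i, i \in J -> measurable (A i)) ->
  P (\bigcap_(i in [set` J]) (X i @^-1` A i)) =
  (\prod_(i <- J) P (X i @^-1` A i))%E.

Definition bounded_test (g : R -> R) : Prop :=
  [/\ measurable_fun setT g, forall r, 0 <= g r & exists B, forall r, g r <= B].

Definition monomial (J : seq I) (phi : I -> R -> R) (om : Omega) : R :=
  \prod_(v <- J) phi v (X v om).

(** Sums of products of functions of single variables of [V]: independence of
    disjoint blocks then reduces to the product rule for monomials, and the
    likelihood of a random tree is such a sum because it is affine in the
    indicator of each split. *)
Inductive block (V : set I) : (Omega -> R) -> Prop :=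
| block_monomial J phi : uniq J -> (forall v, v \in J -> V v) ->
    (forall v, bounded_test (phi v)) -> block V (monomial J phi)
| block_add F G : block V F -> block V G -> block V (fun om => F om + G om).

Lemma eq_block V F G : F =1 G -> block V F -> block V G.
Proof. by move=> /funext ->. Qed.

Lemma sub_block V W F : V `<=` W -> block V F -> block W F.
Proof.
move=> VW; elim=> [J phi uJ JV tphi|F1 G1 _ ? _ ?]; last exact: block_add.
by apply: block_monomial => // v /JV /VW.
Qed.

Lemma block1 V : block V (fun=> 1).
Proof.
apply: (@eq_block _ (monomial [::] (fun _ _ => 1))).
  by move=> om; rewrite /monomial big_nil.
by apply: block_monomial => // v; split=> //; exists 1.
Qed.

Lemma block_var V v g : V v -> bounded_test g -> block V (fun om => g (X v om)).
Proof.
move=> Vv tg; apply: (@eq_block _ (monomial [:: v] (fun=> g))).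
  by move=> om; rewrite /monomial big_seq1.
by apply: block_monomial => // w; rewrite inE => /eqP ->.
Qed.

Lemma monomial_ge0 J phi om : (forall v, bounded_test (phi v)) ->
  0 <= monomial J phi om.
Proof. by move=> t; apply: prodr_ge0 => v _; case: (t v). Qed.

Lemma measurable_monomial J phi : (forall v, bounded_test (phi v)) ->
  measurable_fun setT (monomial J phi).
Proof.
move=> t; apply: measurable_prod => v _.
by apply: measurableT_comp => //; case: (t v).
Qed.

Lemma monomial_bounded J phi : (forall v, bounded_test (phi v)) ->
  exists B, forall om, monomial J phi om <= B.
Proof.
move=> t; elim: J => [|v J [B hB]].
  by exists 1 => om; rewrite /monomial big_nil.
have [_ phi0 [C hC]] := t v.
exists (C * B) => om; rewrite /monomial big_cons -/(monomial J phi om).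
by apply: ler_pM => //; exact: monomial_ge0.
Qed.

Lemma block_ge0 V F om : block V F -> 0 <= F om.
Proof.
by elim=> [J phi _ _ t|F1 G1 _ ? _ ?]; [exact: monomial_ge0|exact: addr_ge0].
Qed.

Lemma measurable_block V F : block V F -> measurable_fun setT F.
Proof.
elim=> [J phi _ _ t|F1 G1 _ ? _ ?]; first exact: measurable_monomial.
exact: measurable_funD.
Qed.

Lemma bounded_integral_lty (F : Omega -> R) B : (forall om, 0 <= F om) ->
  (forall om, F om <= B) -> (\int[P]_om (F om)%:E < +oo)%E.
Proof.
move=> F0 FB; apply: (@le_lt_trans _ _ (\int[P]_om B%:E)%E).
  by apply: le_integral_ge0 => om _; rewrite lee_fin.
by rewrite integral_cst//= probability_setT mule1 ltry.
Qed.

Lemma prod_indic (J : seq I) (A : I -> set R) om :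
  monomial J (fun v => \1_(A v)) om =
  \1_(\bigcap_(i in [set` J]) (X i @^-1` A i)) om.
Proof.
rewrite /monomial; have [h|h] := pselect (forall v, v \in J -> A v (X v om)).
  rewrite indicE mem_set//= big_seq big1// => v /h ?.
  by rewrite indicE mem_set.
have /existsNP[v /not_implyP[vJ nA]] := h.
rewrite [RHS]indicE memNset; last by move=> /(_ v vJ).
rewrite (big_rem v)//= indicE memNset//; exact: mul0r.
Qed.

(** By induction on the factors that are not indicators: each of them can be
    tested against indicators, and these join the list [J1] of the events. *)
Lemma integral_monomial_indic (J1 J2 : seq I) phi (A : I -> set R) :
  uniq (J2 ++ J1) -> (forall v, bounded_test (phi v)) ->
  (forall v, measurable (A v)) ->
  (\int[P]_om (monomial J2 phi om * monomial J1 (fun v => \1_(A v)) om)%:E =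
   \prod_(v <- J2) \int[P]_om (phi v (X v om))%:E *
   \prod_(v <- J1) P (X v @^-1` A v))%E.
Proof.
move=> + tphi; have tA (B : set R) : measurable B -> bounded_test (\1_B : R -> R).
  move=> mB; split=> //.
  by exists 1 => r; rewrite indicE; case: (_ \in _).
have mXA v (B : set R) : measurable B -> measurable (X v @^-1` B).
  by move=> mB; rewrite -[X in measurable X]setTI; exact: mX.
elim: J2 J1 A => [|v J2 IH] J1 A /= uJ mA.
  rewrite big_nil mul1e -indepX//.
  under eq_integral.
    move=> om _.
    have -> : monomial [::] phi om = 1 by rewrite /monomial big_nil.
    rewrite mul1r prod_indic.
    over.
  rewrite integral_indic ?setIT//.
  by apply: fin_bigcap_measurable => // i _; exact: mXA.
case/andP: uJ => vJ uJ.
have tA' w : bounded_test (\1_(A w) : R -> R) by exact: tA.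
have [mv phi0 _] := tphi v.
have vJ1 : v \notin J1 by apply: contra vJ; rewrite mem_cat => ->; rewrite orbT.
have mono0 J psi om : (forall v, bounded_test (psi v)) -> 0 <= monomial J psi om.
  exact: monomial_ge0.
under eq_integral.
  move=> om _.
  have -> : monomial (v :: J2) phi om * monomial J1 (fun v => \1_(A v)) om =
    (monomial J2 phi om * monomial J1 (fun v => \1_(A v)) om) * phi v (X v om).
    by rewrite [monomial (v :: J2) phi om]big_cons -mulrA [RHS]mulrC.
  over.
rewrite (integral_mul_comp (H := fun om => monomial J2 phi om *
  monomial J1 (fun v => \1_(A v)) om))//.
- by rewrite IH// big_cons muleC muleA.
- by apply: measurable_funM; exact: measurable_monomial.
- by move=> om; rewrite mulr_ge0 ?mono0.
- have [B1 h1] := monomial_bounded J2 tphi.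
  have [B2 h2] := monomial_bounded J1 tA'.
  apply: (@bounded_integral_lty _ (B1 * B2)) => om.
    by rewrite mulr_ge0 ?mono0.
  by apply: ler_pM; rewrite ?mono0.
- move=> B mB; pose A' w := if w == v then B else A w.
  have mA' w : measurable (A' w) by rewrite /A'; case: ifP.
  have eA' w : w \in J1 -> A' w = A w.
    by rewrite /A'; case: eqP => // ->; rewrite (negbTE vJ1).
  have uJ2 : uniq (J2 ++ v :: J1) by rewrite -cat1s uniq_catCA /= vJ.
  have := IH (v :: J1) A' uJ2 mA'.
  rewrite big_cons {2}/A' eqxx.
  have -> : (\prod_(w <- J1) P (X w @^-1` A' w) =
             \prod_(w <- J1) P (X w @^-1` A w))%E.
    by rewrite big_seq [RHS]big_seq; apply: eq_bigr => w /eA' ->.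
  rewrite (IH J1 A uJ mA) muleAC -muleA => <-.
  apply: eq_integral => om _; congr (_ %:E).
  rewrite -mulrA; congr (_ * _).
  rewrite [RHS]big_cons {1}/A' eqxx mulrC; congr (_ * _).
  by rewrite /monomial big_seq [RHS]big_seq; apply: eq_bigr => w /eA' ->.
Qed.

Lemma integral_monomial (J : seq I) phi :
  uniq J -> (forall v, bounded_test (phi v)) ->
  (\int[P]_om (monomial J phi om)%:E =
   \prod_(v <- J) \int[P]_om (phi v (X v om))%:E)%E.
Proof.
move=> uJ tphi.
have := @integral_monomial_indic [::] J phi (fun=> setT).
rewrite cats0 => /(_ uJ tphi (fun=> measurableT)).
rewrite big_nil mule1 => <-; apply: eq_integral => om _.
by rewrite [X in _ * X]/monomial big_nil mulr1.
Qed.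

Lemma block_mul V W F G : V `&` W = set0 -> block V F -> block W G ->
  block (V `|` W) (fun om => F om * G om).
Proof.
move=> VW bF; elim: bF G => [J phi uJ JV tphi|F1 F2 _ IH1 _ IH2] G bG; last first.
  apply: (@eq_block _ (fun om => F1 om * G om + F2 om * G om)).
    by move=> om; rewrite mulrDl.
  by apply: block_add; [exact: IH1|exact: IH2].
elim: bG => [J' psi uJ' JW tpsi|G1 G2 _ IH1 _ IH2]; last first.
  apply: (@eq_block _ (fun om => monomial J phi om * G1 om + monomial J phi om * G2 om)).
    by move=> om; rewrite mulrDr.
  exact: block_add.
pose chi v := if v \in J then phi v else psi v.
have JJ' v : v \in J' -> v \notin J.
  move=> vJ'; apply/negP => vJ.
  by have : (V `&` W) v by [split; [exact: JV|exact: JW]]; rewrite VW.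
apply: (@eq_block _ (monomial (J ++ J') chi)).
  move=> om; rewrite /monomial big_cat/=; congr (_ * _).
    by rewrite big_seq [RHS]big_seq; apply: eq_bigr => v vJ; rewrite /chi vJ.
  rewrite big_seq [RHS]big_seq; apply: eq_bigr => v vJ.
  by rewrite /chi (negbTE (JJ' _ vJ)).
apply: block_monomial.
- rewrite cat_uniq uJ uJ' andbT /=; apply/hasPn => v; exact: JJ'.
- by move=> v; rewrite mem_cat => /orP[/JV|/JW]; [left|right].
- by move=> v; rewrite /chi; case: ifP.
Qed.

(** Blocks of disjoint sets of variables are uncorrelated. *)
Lemma integral_block_mul V W F G : V `&` W = set0 -> block V F -> block W G ->
  (\int[P]_om (F om * G om)%:E =
   \int[P]_om (F om)%:E * \int[P]_om (G om)%:E)%E.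
Proof.
move=> VW bF; elim: bF G => [J phi uJ JV tphi|F1 F2 b1 IH1 b2 IH2] G bG; last first.
  have mF1 := measurable_block b1; have mF2 := measurable_block b2.
  have mG := measurable_block bG.
  have F10 om := block_ge0 om b1; have F20 om := block_ge0 om b2.
  have G0 om := block_ge0 om bG.
  under eq_integral do rewrite mulrDl EFinD.
  rewrite ge0_integralD//=; last 4 first.
  - by move=> om _; rewrite lee_fin mulr_ge0.
  - by apply/measurable_EFinP; exact: measurable_funM.
  - by move=> om _; rewrite lee_fin mulr_ge0.
  - by apply/measurable_EFinP; exact: measurable_funM.
  rewrite IH1// IH2// -ge0_muleDl; last 2 first.
  - by apply: integral_ge0 => om _; rewrite lee_fin.
  - by apply: integral_ge0 => om _; rewrite lee_fin.
  congr (_ * _)%E; under [RHS]eq_integral do rewrite EFinD.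
  by rewrite ge0_integralD//=; first [move=> om _; rewrite lee_fin|
    exact/measurable_EFinP].
elim: bG => [J' psi uJ' JW tpsi|G1 G2 b1 IH1 b2 IH2]; last first.
  have mF1 := measurable_block b1; have mF2 := measurable_block b2.
  have mG := measurable_monomial J tphi.
  have F10 om := block_ge0 om b1; have F20 om := block_ge0 om b2.
  have G0 om := monomial_ge0 J om tphi.
  under eq_integral do rewrite mulrDr EFinD.
  rewrite ge0_integralD//=; last 4 first.
  - by move=> om _; rewrite lee_fin mulr_ge0.
  - by apply/measurable_EFinP; exact: measurable_funM.
  - by move=> om _; rewrite lee_fin mulr_ge0.
  - by apply/measurable_EFinP; exact: measurable_funM.
  rewrite IH1// IH2// -ge0_muleDr; last 2 first.
  - by apply: integral_ge0 => om _; rewrite lee_fin.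
  - by apply: integral_ge0 => om _; rewrite lee_fin.
  congr (_ * _)%E; under [RHS]eq_integral do rewrite EFinD.
  by rewrite ge0_integralD//=; first [move=> om _; rewrite lee_fin|
    exact/measurable_EFinP].
pose chi v := if v \in J then phi v else psi v.
have JJ' v : v \in J' -> v \notin J.
  move=> vJ'; apply/negP => vJ.
  by have : (V `&` W) v by [split; [exact: JV|exact: JW]]; rewrite VW.
have chi1 v : v \in J -> chi v = phi v by rewrite /chi => ->.
have chi2 v : v \in J' -> chi v = psi v by rewrite /chi => /JJ' /negbTE ->.
transitivity (\int[P]_om (monomial (J ++ J') chi om)%:E)%E.
  apply: eq_integral => om _; rewrite /monomial big_cat/=; congr ((_ * _)%:E).
    by rewrite big_seq [RHS]big_seq; apply: eq_bigr => v /chi1 ->.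
  by rewrite big_seq [RHS]big_seq; apply: eq_bigr => v /chi2 ->.
rewrite !integral_monomial ?big_cat//=.
- congr (_ * _)%E.
    by rewrite big_seq [RHS]big_seq; apply: eq_bigr => v /chi1 ->.
  by rewrite big_seq [RHS]big_seq; apply: eq_bigr => v /chi2 ->.
- rewrite cat_uniq uJ uJ' andbT /=; apply/hasPn => v; exact: JJ'.
- by move=> v; rewrite /chi; case: ifP.
Qed.

End independence.

(** * Dyadic intervals *)

Section dyadic.
Context {R : realType}.
Implicit Types (w : node) (x : R).

Lemma node_index_rcons w b :
  node_index (rcons w b) = (2 * node_index w + b)%N.
Proof.
rewrite /node_index size_rcons big_ord_recr /= nth_rcons ltnn eqxx.
rewrite subnn expn0 muln1 big_distrr /=; congr (_ + _)%N.
apply: eq_bigr => i _; rewrite nth_rcons ltn_ord mulnCA; congr (_ * _)%N.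
by rewrite -expnS subSS subnSK.
Qed.

Lemma dyadic_interval_nil : @dyadic_interval R [::] = [set` `[0, 1[].
Proof.
rewrite /dyadic_interval /node_index big_ord0 /= expr0 !divr1.
by apply/seteqP; split=> x /=; rewrite in_itv.
Qed.

Definition midpoint w : R := (2 * node_index w).+1%:R / 2 ^+ (size w).+1.

Lemma dyadic_interval_rcons w b x :
  @dyadic_interval R (rcons w b) x <->
  @dyadic_interval R w x /\ b = (midpoint w <= x).
Proof.
rewrite /dyadic_interval /midpoint /= size_rcons node_index_rcons.
have p0 : 0 < (2 : R) ^+ size w by rewrite exprn_gt0.
rewrite !exprS.
set k := node_index w; set q := 2 ^+ size w in p0 *.
have e1 : k%:R / q = (2 * k)%:R / (2 * q).
  by rewrite natrM -mulf_div divff ?mul1r ?pnatr_eq0.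
have e2 : k.+1%:R / q = (2 * k).+2%:R / (2 * q).
  rewrite -[(2 * k).+2]addn2 (_ : (2 * k + 2 = 2 * k.+1)%N); last by lia.
  by rewrite natrM -mulf_div divff ?mul1r ?pnatr_eq0.
rewrite e1 e2; have q2 : 0 < (2 * q)^-1 by rewrite invr_gt0 mulr_gt0.
set r := (2 * q)^-1 in q2 *.
have l1 : (2 * k)%:R * r < (2 * k).+1%:R * r by rewrite ltr_pM2r// ltr_nat.
have l2 : (2 * k).+1%:R * r < (2 * k).+2%:R * r by rewrite ltr_pM2r// ltr_nat.
case: b => /=; rewrite ?addn1 ?addn0.
  split=> [/andP[h1 h2]|[/andP[h1 h2] <-]]; last by rewrite h2.
  by rewrite h1 h2 (le_trans (ltW l1) h1).
split=> [/andP[h1 h2]|[/andP[h1 h2] /esym/negbT]].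
  by rewrite h1 (lt_trans h2 l2) leNgt h2.
by rewrite -ltNge h1 => ->.
Qed.

Lemma mem_dyadic_interval_rcons w b x :
  (x \in @dyadic_interval R (rcons w b)) =
  (x \in @dyadic_interval R w) && ((midpoint w <= x) == b).
Proof.
apply/idP/idP => [/set_mem/dyadic_interval_rcons[? ->]|].
  by rewrite mem_set//=.
by move=> /andP[/set_mem ? /eqP e]; apply/mem_set/dyadic_interval_rcons.
Qed.

Lemma sub_dyadic_interval_rcons w b :
  @dyadic_interval R (rcons w b) `<=` @dyadic_interval R w.
Proof. by move=> x /dyadic_interval_rcons[]. Qed.

Lemma sub_dyadic_interval w : @dyadic_interval R w `<=` [set` `[0, 1[].
Proof.
elim/last_ind: w => [|w b IH]; first by rewrite dyadic_interval_nil.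
exact: subset_trans (@sub_dyadic_interval_rcons w b) IH.
Qed.

Lemma dyadic_intervalE w : @dyadic_interval R w =
  [set` `[(node_index w)%:R / 2 ^+ size w, (node_index w).+1%:R / 2 ^+ size w[].
Proof. by apply/seteqP; split=> x /=; rewrite in_itv. Qed.

Lemma measurable_dyadic_interval w : measurable (@dyadic_interval R w).
Proof. by rewrite dyadic_intervalE. Qed.

Lemma lebesgue_measure_dyadic_interval w :
  lebesgue_measure (@dyadic_interval R w) = ((2 ^+ size w)^-1)%:E.
Proof.
have p0 : 0 < ((2 : R) ^+ size w)^-1 by rewrite invr_gt0 exprn_gt0.
rewrite dyadic_intervalE lebesgue_measure_itv/= lte_fin ltr_pM2r// ltr_nat ltnSn.
by rewrite -EFinB -mulrBl -[(node_index w).+1%:R]natr1 addrAC subrr add0r mul1r.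
Qed.

Lemma dyadic_interval_dist w x y :
  @dyadic_interval R w x -> @dyadic_interval R w y ->
  `|x - y| <= (2 ^+ size w)^-1.
Proof.
rewrite /dyadic_interval /= -[(node_index w).+1%:R]natr1 mulrDl mul1r.
set r := _ / _; set q := _^-1 => /andP[? ?] /andP[? ?].
by rewrite ler_norml; apply/andP; split; lra.
Qed.

(** The first [l] binary digits of [x]. *)
Fixpoint address x (l : nat) : node :=
  if l is l'.+1 then rcons (address x l') (midpoint (address x l') <= x)
  else [::].

Lemma size_address x l : size (address x l) = l.
Proof. by elim: l => //= l IH; rewrite size_rcons IH. Qed.

Lemma address_interval x l : x \in `[0, 1[ -> @dyadic_interval R (address x l) x.
Proof.
move=> x01; elim: l => [|l IH] /=; first by rewrite dyadic_interval_nil.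
by apply/dyadic_interval_rcons.
Qed.

Lemma interval_address w x : @dyadic_interval R w x -> w = address x (size w).
Proof.
elim/last_ind: w => [|w b IH] //; rewrite size_rcons.
by move=> /dyadic_interval_rcons[h ->] /=; rewrite -(IH h).
Qed.

Lemma take_address x i l : (i <= l)%N -> take i (address x l) = address x i.
Proof.
elim: l i => [|l IH] i; first by rewrite leqn0 => /eqP ->.
rewrite leq_eqVlt => /predU1P[->|il]; first by rewrite take_oversize ?size_address.
by rewrite /= -cats1 takel_cat ?size_address ?IH.
Qed.

End dyadic.

(** * The random histogram on a point *)

Section tree_density.
Context {R : realType}.
Variables (split : node -> bool) (y : node -> R) (L : nat).

(** The level at which the descent along the digits of [x] stops. *)
Definition leaf_level (x : R) (l : nat) : Prop :=
  [/\ (l <= L)%N, forall i, (i < l)%N -> split (address x i)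
    & (l == L) || ~~ split (address x l)].

Lemma leaf_level_exists x : exists l, leaf_level x l.
Proof.
have ex : exists l, (l == L) || ~~ split (address x l).
  by exists L; rewrite eqxx.
case: (ex_minnP ex) => l hl lmin; exists l; split=> //.
  by apply: lmin; rewrite eqxx.
move=> i il; apply: contraTT il => ni; rewrite -leqNgt; apply: lmin.
by rewrite ni orbT.
Qed.

Lemma external_gw_treeP w : external_nodes (gw_tree L split) w <->
  [/\ (size w <= L)%N, forall i, (i < size w)%N -> split (take i w)
    & (size w == L) || ~~ split w].
Proof.
split=> [[Tw noch]|[wL sw lw]].
  have wL : (size w <= L)%N.
    case: (posnP (size w)) => [->//|w0].
    have /Tw /andP[+ _] : ((size w).-1 < size w)%N by rewrite prednK.
    by rewrite prednK.
  split=> //; first by move=> i /Tw /andP[].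
  apply/negPn/negP; rewrite negb_or negbK => /andP[wnL sw].
  apply: (noch true) => i; rewrite size_rcons ltnS leq_eqVlt => /predU1P[->|iw].
    by rewrite -cats1 take_size_cat// sw ltn_neqAle wnL wL.
  by rewrite -cats1 takel_cat; [exact: Tw|exact: ltnW].
split=> [i iw|b Tb]; first by rewrite (leq_trans iw wL) sw.
have := Tb (size w); rewrite size_rcons ltnS leqnn => /(_ isT).
rewrite -cats1 take_size_cat// => /andP[wL' sw'].
by move: lw; rewrite sw' orbF => /eqP e; rewrite e ltnn in wL'.
Qed.

Lemma tree_densityE x l : x \in `[0, 1[ -> leaf_level x l ->
  tree_density (gw_tree L split) y x = \prod_(i < l) (2 * y (address x i.+1)).
Proof.
move=> x01 [lL sl ll].
have lh : leaf_height y (address x l) = \prod_(i < l) (2 * y (address x i.+1)).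
  rewrite /leaf_height size_address big_split /= prodr_const card_ord.
  congr (_ * _); rewrite big_add1 /= big_mkord; apply: eq_bigr => i _.
  by rewrite take_address.
rewrite -lh /tree_density -(@fsbig_widen _ _ _ _ [set address x l])/=.
- by rewrite fsbig_set1 indicE mem_set ?mulr1//; exact: address_interval.
- move=> _ ->; apply/external_gw_treeP; rewrite size_address; split=> //.
  by move=> i il; rewrite take_address ?sl// ltnW.
- move=> w [/external_gw_treeP[wL sw lw]] /= wx; rewrite indicE.
  case: (boolP (x \in _)) => [/set_mem/interval_address e|]; last by rewrite mulr0.
  exfalso; apply: wx; rewrite e; congr (address x _).
  have sw' i : (i < size w)%N -> split (address x i).
    by move=> iw; rewrite -(take_address x (ltnW iw)) -e; exact: sw.
  rewrite e in lw; rewrite size_address in lw.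
  apply/eqP; rewrite eqn_leq; apply/andP; split; rewrite leqNgt; apply/negP => h.
    case/orP: ll => [/eqP lE|]; first by rewrite lE ltnNge wL in h.
    by rewrite sw'.
  case/orP: lw => [/eqP lE|]; first by rewrite lE ltnNge lL in h.
  by rewrite sl.
Qed.

(** The value of the histogram at [x], relative to its value on the interval
    of [w], computed by descending at most [d] levels along the digits of [x]. *)
Fixpoint descent (d : nat) (w : node) (x : R) : R :=
  if d is d'.+1 then
    if split w then
      2 * y (rcons w (midpoint w <= x)) * descent d' (rcons w (midpoint w <= x)) x
    else 1
  else 1.

Lemma descentE d k l x : (k + d = L)%N -> leaf_level x l -> (k <= l)%N ->
  descent d (address x k) x = \prod_(k <= i < l) (2 * y (address x i.+1)).
Proof.
move=> + [lL sl ll]; elim: d k => [|d IH] k kd kl /=.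
  by move: kd; rewrite addn0 => kd; rewrite big_geq// kd.
move: kl; rewrite leq_eqVlt => /predU1P[e|kl].
  case: ifP => [sk|_]; last by rewrite e big_geq.
  move: ll; rewrite -e sk orbF => /eqP e'.
  by rewrite e' -[X in _ = X]addn0 in kd; move/addnI: kd.
rewrite sl// big_ltn// -[rcons _ _]/(address x k.+1) IH//.
by rewrite addSnnS.
Qed.

Lemma tree_density_descent x : x \in `[0, 1[ ->
  tree_density (gw_tree L split) y x = descent L [::] x.
Proof.
move=> x01; have [l lx] := leaf_level_exists x.
rewrite (tree_densityE x01 lx) -[[::]]/(address x 0) (descentE _ lx)//.
by rewrite big_mkord.
Qed.

End tree_density.

(** * The likelihood of a random histogram *)

Section likelihood.
Context {R : realType} (n : nat) (x : n.-tuple R).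

Definition node_count (w : node) : nat :=
  \sum_(i < n) (tnth x i \in @dyadic_interval R w).

Lemma node_count_rcons w :
  node_count w = (node_count (rcons w false) + node_count (rcons w true))%N.
Proof.
rewrite /node_count -big_split; apply: eq_bigr => i _ /=.
rewrite !mem_dyadic_interval_rcons.
by case: (_ \in _); case: (_ <= _).
Qed.

Context (split : node -> bool).

(** The product of the weights [g] over the split nodes below [v] (included),
    at most [d] levels down. *)
Fixpoint split_product (g : node -> R) (d : nat) (v : node) : R :=
  if d is d'.+1 then
    if split v then
      g v * (split_product g d' (rcons v false) * split_product g d' (rcons v true))
    else 1
  else 1.

(** At a split node the observations are distributed between the two children,
    so the factors of the observations regroup into one factor per split. *)
Lemma likelihood_split_product (y g : node -> R) L :
  (forall i, tnth x i \in `[0, 1[) ->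
  (forall v, (size v < L)%N -> g v =
     (2 * y (rcons v false)) ^+ node_count (rcons v false) *
     (2 * y (rcons v true)) ^+ node_count (rcons v true)) ->
  likelihood (tree_density (gw_tree L split) y) x = split_product g L [::].
Proof.
move=> x01 hg.
have main d w : (size w + d = L)%N ->
    \prod_(i < n | tnth x i \in @dyadic_interval R w)
      descent split y d w (tnth x i) = split_product g d w.
  elim: d w => [|d IH] w wd /=; first by rewrite big1.
  case: (split w); last by rewrite big1.
  have sd b : (size (rcons w b) + d = L)%N by rewrite size_rcons addSnnS.
  rewrite (bigID (fun i => midpoint w <= tnth x i)) /=.
  have half b (Q : pred 'I_n) : (forall i, Q i =
         (tnth x i \in @dyadic_interval R w) && ((midpoint w <= tnth x i) == b)) ->
       \prod_(i < n | Q i)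
       (2 * y (rcons w (midpoint w <= tnth x i)) *
        descent split y d (rcons w (midpoint w <= tnth x i)) (tnth x i)) =
      (2 * y (rcons w b)) ^+ node_count (rcons w b) * split_product g d (rcons w b).
    move=> hQ; rewrite (eq_bigl _ _ hQ) -(IH _ (sd b)).
    under [in RHS]eq_bigl do rewrite mem_dyadic_interval_rcons.
    rewrite (eq_bigr (fun i => 2 * y (rcons w b) *
      descent split y d (rcons w b) (tnth x i))); last by move=> i /andP[_ /eqP ->].
    rewrite big_split /= prodr_const; congr (_ ^+ _ * _).
    rewrite /node_count -sum1_card big_mkcond /=; apply: eq_bigr => i _.
    by rewrite mem_dyadic_interval_rcons unfold_in; case: ifP.
  rewrite (half true); last by move=> i; rewrite eqb_id.
  rewrite (half false); last by move=> i; rewrite eqbF_neg.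
  rewrite hg; last by rewrite -wd -addSnnS ltn_addr// leqnn.
  by ring.
rewrite -(main L [::])// /likelihood big_mkcond [RHS]big_mkcond.
apply: eq_bigr => i _; rewrite mem_set ?dyadic_interval_nil//; last exact: x01.
by rewrite tree_density_descent.
Qed.

End likelihood.

(** * Conjugacy: integrating the likelihood over the prior *)

Section context.
Context {R : realType}.
Variables (split : node -> bool) (g : node -> R).

(** The product over the split nodes below [v], in which the factor of the
    subtree at [v ++ u] is replaced by [h]; it vanishes unless all nodes from
    [v] to the parent of [v ++ u] are split. *)
Fixpoint split_context (d : nat) (v u : node) (h : R) : R :=
  if u is b :: u' then
    if d is d'.+1 then
      if split v then
        g v * (split_product split g d' (rcons v (~~ b)) *
               split_context d' (rcons v b) u' h)
      else 0
    else 0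
  else h.

Definition reached (v u : node) : Prop :=
  forall i, (i < size u)%N -> split (v ++ take i u).

Lemma split_contextE d v u : (size u <= d)%N -> reached v u ->
  split_context d v u (split_product split g (d - size u) (v ++ u)) =
  split_product split g d v.
Proof.
elim: u d v => [|b u IH] [|d] v //=; rewrite ?cats0 ?subn0// ltnS subSS => ud r.
have := r 0%N isT; rewrite /= cats0 => ->.
rewrite -cat_rcons IH//; last first.
  by move=> i iu; have := r i.+1 iu; rewrite /= cat_rcons.
by case: b {r} => /=; congr (_ * _); rewrite mulrC.
Qed.

Lemma split_product_ge0 d v : (forall w, 0 <= g w) ->
  0 <= split_product split g d v.
Proof.
by move=> g0; elim: d v => //= d IH v; case: ifP => // _; rewrite !mulr_ge0.
Qed.

End context.

Section galton_watson.
Context d (Omega : measurableType d) {R : realType} (P : probability Omega R).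
Variables (S : node -> Omega -> bool) (U : node -> Omega -> R).

Definition node_variable (v : node + node) (om : Omega) : R :=
  match v with inl w => (S w om)%:R | inr w => U w om end.

Local Notation X := node_variable.

Hypothesis mX : forall v, measurable_fun setT (X v).
Hypothesis indepX : forall (J : seq (node + node)) (A : node + node -> set R),
  uniq J -> (forall i, i \in J -> measurable (A i)) ->
  P (\bigcap_(i in [set` J]) (X i @^-1` A i)) =
  (\prod_(i <- J) P (X i @^-1` A i))%E.

Variables (p : node -> R) (gam : node -> R -> R) (m : node -> R).
Hypothesis split_prob : forall w, (\int[P]_om (S w om)%:R%:E = (p w)%:E)%E.
Hypothesis tgam : forall w, bounded_test (gam w).
Hypothesis mean_gam : forall w, (\int[P]_om (gam w (U w om))%:E = (m w)%:E)%E.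

Definition subtree (v : node) : set (node + node) :=
  [set i | match i with inl w => @seq.prefix bool v w | inr w => @seq.prefix bool v w end].

Definition at_node (v : node) : set (node + node) := [set inl v; inr v].

Lemma prefix_rconsP v b w : @seq.prefix bool (rcons v b) w ->
  exists u, w = v ++ b :: u.
Proof. by case/prefixP => u ->; exists u; rewrite cat_rcons. Qed.

Lemma subtree_rcons v b : subtree (rcons v b) `<=` subtree v.
Proof.
by move=> [w|w] /prefix_rconsP[u ->] /=; exact: prefix_prefix.
Qed.

Lemma at_node_subtree v : at_node v `<=` subtree v.
Proof. by move=> _ [->|->] /=; exact: prefix_refl. Qed.

Lemma subtree_sub v u : subtree (v ++ u) `<=` subtree v.
Proof.
by move=> [w|w] /prefixP[t ->] /=; rewrite -catA; exact: prefix_prefix.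
Qed.

Lemma subtree_disjoint v b u : 
  subtree (rcons v (~~ b)) `&` subtree (rcons v b ++ u) = set0.
Proof.
rewrite -subset0 => i [h /subtree_sub]; case: i h => w /prefix_rconsP[u1 ->] /prefix_rconsP[u2].
  by move/eqP; rewrite eqseq_cat// eqxx /= eqseq_cons; case: b.
by move/eqP; rewrite eqseq_cat// eqxx /= eqseq_cons; case: b.
Qed.

Lemma at_node_disjoint v b : at_node v `&` subtree (rcons v b) = set0.
Proof.
rewrite -subset0 => _ [[->|->]] /prefix_rconsP[u] /(congr1 size);
by rewrite size_cat /=; lia.
Qed.

Lemma test_indic (B : set R) : measurable B -> bounded_test (\1_B : R -> R).
Proof.
by move=> mB; split=> //; exists 1 => r; rewrite indicE; case: (_ \in _).
Qed.

Lemma test_mul (f g : R -> R) : bounded_test f -> bounded_test g ->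
  bounded_test (fun r => f r * g r).
Proof.
move=> [mf f0 [B hB]] [mg g0 [C hC]]; split.
- exact: measurable_funM.
- by move=> r; rewrite mulr_ge0.
- by exists (B * C) => r; apply: ler_pM.
Qed.

Local Notation blk := (block X).

Lemma block_nosplit w : blk (at_node w) (fun om => 1 - (S w om)%:R).
Proof.
apply: (@eq_block _ _ _ _ _ _ (fun om => \1_[set 0] (X (inl w) om))).
  move=> om /=; rewrite indicE; case: (S w om) => /=; last first.
    by rewrite mem_set// subr0.
  by rewrite memNset/= ?subrr// => /eqP; rewrite oner_eq0.
by apply: block_var; [left|exact: test_indic].
Qed.

Lemma block_split_test w g : bounded_test g ->
  blk (at_node w) (fun om => (S w om)%:R * g (U w om)).
Proof.
move=> tg.
apply: (@eq_block _ _ _ _ _ _ (fun om => \1_[set 1] (X (inl w) om) * g (X (inr w) om))).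
  move=> om /=; rewrite indicE; case: (S w om) => /=; first by rewrite mem_set.
  by rewrite memNset//= => /esym/eqP; rewrite oner_eq0.
have b1 : blk [set inl w] (fun om => \1_[set 1] (X (inl w) om)).
  by apply: block_var => //; exact: test_indic.
have b2 : blk [set inr w] (fun om => g (X (inr w) om)) by exact: block_var.
apply: (block_mul _ b1 b2).
by rewrite -subset0 => i [/= ->].
Qed.

Lemma integral_split_test w g r : bounded_test g ->
  (\int[P]_om (g (U w om))%:E = r%:E)%E ->
  (\int[P]_om ((S w om)%:R * g (U w om))%:E = (p w * r)%:E)%E.
Proof.
move=> tg gr; have b1 : blk [set inl w] (fun om => (S w om)%:R).
  apply: (@eq_block _ _ _ _ _ _ (fun om => \1_[set 1] (X (inl w) om))).
    move=> om /=; rewrite indicE; case: (S w om) => /=; first by rewrite mem_set.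
    by rewrite memNset//= => /esym/eqP; rewrite oner_eq0.
  by apply: block_var => //; exact: test_indic.
have b2 : blk [set inr w] (fun om => g (U w om)).
  exact: (@block_var _ _ _ _ X _ (inr w)).
rewrite (integral_block_mul mX indepX _ b1 b2); last first.
  by rewrite -subset0 => i [/= ->].
by rewrite split_prob gr.
Qed.

Lemma integral_nosplit w : (\int[P]_om (1 - (S w om)%:R)%:E = (1 - p w)%:E)%E.
Proof.
have ms : measurable_fun setT (fun om => (S w om)%:R : R) := mX (inl w).
have : (\int[P]_om ((1 - (S w om)%:R) + (S w om)%:R)%:E = 1%:E)%E.
  under eq_integral do rewrite subrK.
  by rewrite integral_cst//= mul1e probability_setT.
under eq_integral do rewrite EFinD.
rewrite ge0_integralD//=; last 3 first.
- by move=> om _; rewrite lee_fin; case: (S w om); rewrite /= ?subrr ?subr0.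
- by apply/measurable_EFinP; apply: measurable_funB.
- exact/measurable_EFinP.
rewrite split_prob; case: (integral P setT _) => [r| |]//.
by rewrite -EFinD => -[e]; rewrite -e addrK.
Qed.

Lemma gam_ge0 w r : 0 <= gam w r. Proof. by case: (tgam w). Qed.

Definition tree_likelihood (k : nat) (v : node) (om : Omega) : R :=
  split_product (S ^~ om) (fun w => gam w (U w om)) k v.

Lemma tree_likelihood_split_block k v g : bounded_test g ->
  (forall b, blk (subtree (rcons v b)) (tree_likelihood k (rcons v b))) ->
  blk (subtree v) (fun om => (S v om)%:R * g (U v om) *
   (tree_likelihood k (rcons v false) om * tree_likelihood k (rcons v true) om)).
Proof.
move=> tg IH; have b1 := block_split_test v tg.
have dis := subtree_disjoint v true [::]; rewrite cats0 in dis.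
have b2 := block_mul dis (IH false) (IH true).
have dis2 : at_node v `&` (subtree (rcons v false) `|` subtree (rcons v true)) = set0.
  by rewrite setIUr !at_node_disjoint setU0.
apply: sub_block (block_mul dis2 b1 b2) => i [/at_node_subtree//|[]];
exact: subtree_rcons.
Qed.

Lemma tree_likelihoodS k v om : tree_likelihood k.+1 v om =
  (1 - (S v om)%:R) + (S v om)%:R * gam v (U v om) *
   (tree_likelihood k (rcons v false) om * tree_likelihood k (rcons v true) om).
Proof.
rewrite /tree_likelihood /=; case: (S v om) => /=; first by rewrite subrr add0r mul1r.
by rewrite subr0 !mul0r addr0.
Qed.

Lemma tree_likelihood_block k v : blk (subtree v) (tree_likelihood k v).
Proof.
elim: k v => [|k IH] v; first exact: block1.
apply: (@eq_block _ _ _ _ _ _ _ _ (fun om => esym (tree_likelihoodS k v om))).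
apply: block_add; last exact: tree_likelihood_split_block.
exact: sub_block (@at_node_subtree v) (block_nosplit v).
Qed.

(** The prior expectation of the likelihood of the subtree at [v], restricted to
    [k] levels: either [v] is a leaf, or it is split and the evidence of the
    split multiplies the independent contributions of the two children. *)
Fixpoint marginal (k : nat) (v : node) : R :=
  if k is k'.+1 then
    1 - p v + p v * m v * (marginal k' (rcons v false) * marginal k' (rcons v true))
  else 1.

Lemma integral_split_node k v g r : bounded_test g ->
  (\int[P]_om (g (U v om))%:E = r%:E)%E ->
  (forall w, \int[P]_om (tree_likelihood k w om)%:E = (marginal k w)%:E)%E ->
  (\int[P]_om ((S v om)%:R * g (U v om) *
    (tree_likelihood k (rcons v false) om * tree_likelihood k (rcons v true) om))%:E
   = (p v * r * (marginal k (rcons v false) * marginal k (rcons v true)))%:E)%E.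
Proof.
move=> tg gr IH; have b1 := block_split_test v tg.
have dis := subtree_disjoint v true [::]; rewrite cats0 in dis.
have bf := tree_likelihood_block k (rcons v false).
have bt := tree_likelihood_block k (rcons v true).
have b2 := block_mul dis bf bt.
have dis2 : at_node v `&` (subtree (rcons v false) `|` subtree (rcons v true)) = set0.
  by rewrite setIUr !at_node_disjoint setU0.
rewrite (integral_block_mul mX indepX dis2 b1 b2) (integral_split_test tg gr).
by rewrite (integral_block_mul mX indepX dis bf bt) !IH -!EFinM.
Qed.

Lemma integral_tree_likelihood k v :
  (\int[P]_om (tree_likelihood k v om)%:E = (marginal k v)%:E)%E.
Proof.
elim: k v => [|k IH] v.
  by rewrite /tree_likelihood /= integral_cst//= mul1e probability_setT.
under eq_integral do rewrite tree_likelihoodS EFinD.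
have b := tree_likelihood_split_block (tgam v) (fun b => tree_likelihood_block k (rcons v b)).
rewrite ge0_integralD//=.
- by rewrite integral_nosplit (integral_split_node (tgam v) (mean_gam v) IH) -EFinD.
- by move=> om _; rewrite lee_fin; exact: block_ge0 (block_nosplit v).
- by apply/measurable_EFinP; exact: measurable_block mX _ _ (block_nosplit v).
- by move=> om _; rewrite lee_fin; exact: block_ge0 b.
- by apply/measurable_EFinP; exact: measurable_block mX _ _ b.
Qed.

Fixpoint context_marginal (k : nat) (v u : node) : R :=
  if u is b :: u' then
    if k is k'.+1 then
      p v * m v * (marginal k' (rcons v (~~ b)) * context_marginal k' (rcons v b) u')
    else 0
  else 1.

Definition tree_context k v u (H : Omega -> R) om : R :=
  split_context (S ^~ om) (fun w => gam w (U w om)) k v u (H om).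

Lemma tree_contextS k v b u H om : tree_context k.+1 v (b :: u) H om =
  (S v om)%:R * gam v (U v om) *
   (tree_likelihood k (rcons v (~~ b)) om * tree_context k (rcons v b) u H om).
Proof.
rewrite /tree_context /=; case: (S v om) => /=; first by rewrite mul1r.
by rewrite !mul0r.
Qed.

(** The part of the likelihood outside the subtree of a node, on the event that
    this node is reached, is independent of everything inside the subtree. *)
Lemma tree_context_block k v u H : (size u <= k)%N -> blk (subtree (v ++ u)) H ->
  blk (subtree v) (tree_context k v u H) /\
  (\int[P]_om (tree_context k v u H om)%:E =
   (context_marginal k v u)%:E * \int[P]_om (H om)%:E)%E.
Proof.
elim: u k v => [|b u IH] [|k] v //=; rewrite ?cats0 => uk bH.
- by rewrite mul1e.
- by rewrite mul1e.
have b1 := block_split_test v (tgam v).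
have b2 := tree_likelihood_block k (rcons v (~~ b)).
rewrite -cat_rcons in bH.
have [b3 e3] := IH k (rcons v b) uk bH.
have dis := subtree_disjoint v b [::]; rewrite cats0 in dis.
have b4 := block_mul dis b2 b3.
have dis2 : at_node v `&` (subtree (rcons v (~~ b)) `|` subtree (rcons v b)) = set0.
  by rewrite setIUr !at_node_disjoint setU0.
split.
  apply: (@eq_block _ _ _ _ _ _ _ _ (fun om => esym (tree_contextS k v b u H om))).
  apply: sub_block (block_mul dis2 b1 b4) => i [/at_node_subtree//|[]];
  exact: subtree_rcons.
under eq_integral do rewrite tree_contextS.
rewrite (integral_block_mul mX indepX dis2 b1 b4).
rewrite (integral_block_mul mX indepX dis b2 b3) e3.
rewrite (integral_split_test (tgam v) (mean_gam v)) integral_tree_likelihood.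
by rewrite !EFinM !muleA.
Qed.

Hypothesis p01 : forall w, 0 <= p w <= 1.

Lemma mean_gam_ge0 w : 0 <= m w.
Proof.
rewrite -lee_fin -mean_gam; apply: integral_ge0 => om _.
by rewrite lee_fin gam_ge0.
Qed.

Lemma marginal_ge0 k v : 0 <= marginal k v.
Proof.
rewrite -lee_fin -integral_tree_likelihood; apply: integral_ge0 => om _.
by rewrite lee_fin; exact: block_ge0 (tree_likelihood_block k v).
Qed.

Lemma context_marginal_ge0 k v u : 0 <= context_marginal k v u.
Proof.
elim: u k v => [|b u IH] [|k] v //=.
by have /andP[? ?] := p01 v; rewrite !mulr_ge0// ?mean_gam_ge0 ?marginal_ge0.
Qed.

(** Reaching [v ++ u] is one of the ways in which the tree may grow. *)
Lemma context_marginal_le k v u : (size u <= k)%N ->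
  context_marginal k v u * marginal (k - size u) (v ++ u) <= marginal k v.
Proof.
elim: u k v => [|b u IH] [|k] v //=; rewrite ?cats0 ?mul1r ?subn0//.
rewrite ltnS subSS => uk; have /andP[pv0 pv1] := p01 v.
rewrite -cat_rcons -2!mulrA -[leLHS]add0r lerD ?subr_ge0// -!mulrA.
rewrite ler_wpM2l// ler_wpM2l ?mean_gam_ge0//.
apply: (@le_trans _ _ (marginal k (rcons v (~~ b)) * marginal k (rcons v b))).
  by rewrite ler_wpM2l ?marginal_ge0// IH.
by case: b => //=; rewrite mulrC.
Qed.

End galton_watson.

(** * Integrals up to null sets *)

(** The proportions lie in the unit interval only almost surely, and elsewhere
    the likelihood may be negative; neither the likelihood nor the event whose
    posterior probability is computed is known to be measurable. *)
Section off_null.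
Local Open Scope ereal_scope.
Context d (T : measurableType d) {R : realType}.
Variables (mu : {measure set T -> \bar R}) (N : set T).
Hypotheses (mN : measurable N) (N0 : mu N = 0).

Lemma pinfty_off_ge0 x : 0 <= ((cst +oo) \_ N) x :> \bar R.
Proof. by rewrite patchE; case: ifP => //= _; exact: leey. Qed.

Lemma integral_null_pinfty : \int[mu]_x ((cst +oo) \_ N) x = 0.
Proof. by rewrite -integral_mkcond integral_cst// N0 mule0. Qed.

Lemma integral_ge0_off_null (D : set T) (f : T -> \bar R) :
  (forall x, ~ N x -> 0 <= f x) -> \int[mu]_(x in D) f x = \int[mu]_(x in D) f^\+ x.
Proof.
move=> f0; rewrite integralE.
suff -> : \int[mu]_(x in D) f^\- x = 0 by rewrite sube0.
apply/eqP; rewrite eq_le integral_ge0 ?andbT// -integral_null_pinfty.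
apply: le_integral_subset => // x _; first exact: pinfty_off_ge0.
split=> //; rewrite patchE; case: ifPn => [_|xN]; first exact: leey.
have /f0 fx : ~ N x by move=> /mem_set; rewrite (negbTE xN).
by rewrite funenegE ge_max lexx andbT leeNl oppe0 fx.
Qed.

Lemma le_integral_off_null (D : set T) (f g : T -> \bar R) :
  measurable_fun setT g -> (forall x, 0 <= g x) ->
  (forall x, ~ N x -> D x -> f x <= g x) ->
  \int[mu]_(x in D) f x <= \int[mu]_x g x.
Proof.
move=> mg g0 fg; apply: (le_trans (le_integral_funepos mu D f)).
have -> : \int[mu]_x g x = \int[mu]_x (g x + ((cst +oo) \_ N) x).
  rewrite ge0_integralD ?integral_null_pinfty ?adde0//.
  - by move=> x _; exact: pinfty_off_ge0.
  - by apply/(measurable_restrictT _ _).1 => //; exact: measurable_cst.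
apply: le_integral_subset => // x.
  by move=> _; rewrite adde_ge0// pinfty_off_ge0.
move=> Dx; split=> //; rewrite patchE; case: ifPn => [_|xN].
  by rewrite addey ?leey// gt_eqF// (lt_le_trans _ (g0 x))// ltNyr.
by rewrite adde0 funeposE ge_max g0 andbT fg// => /mem_set; rewrite (negbTE xN).
Qed.

Lemma ge_integral_off_null (f g : T -> \bar R) :
  measurable_fun setT g -> (forall x, 0 <= g x) ->
  (forall x, ~ N x -> g x <= f x) ->
  \int[mu]_x g x <= \int[mu]_x f x.
Proof.
move=> mg g0 gf.
rewrite [leRHS]integral_ge0_off_null; last first.
  by move=> x xN; exact: le_trans (g0 _) (gf _ xN).
rewrite (ge0_negligible_integral mN)//.
apply: le_integral_subset => // x [_ xN]; split=> //.
by rewrite (le_trans (gf _ xN))// funeposE le_max lexx.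
Qed.

End off_null.

(** * The posterior probability of an event at a node *)

Section posterior.
Context {R : realType} d (Omega : measurableType d) (P : probability Omega R).
Variables (p : node -> R) (a : R).
Variables (S : node -> {RV P >-> bool}) (Y : node -> {RV P >-> R}).
Hypothesis optSY : opt_variables p a S Y.
Hypothesis p01 : forall w, 0 <= p w <= 1.

Local Notation s := (fun w om => S w om).
Local Notation U := (fun w om => Y (rcons w false) om).

Lemma beta_weight_setTE : beta_weight a setT =
  (\int[lebesgue_measure]_(y in `]0%R, 1%R[)
     (y `^ (a - 1) * (1 - y) `^ (a - 1))%:E)%E.
Proof. by rewrite /beta_weight setTI. Qed.

(** Since the variables exist, the Beta law is a probability, so its
    normalizing constant is neither zero nor infinite. *)
Lemma beta_weight_setT_fin :
  exists2 c : R, 0 < c & beta_weight a (setT : set R) = c%:E.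
Proof.
have := opt_beta_law optSY [::] measurableT.
rewrite probability_setT /beta_law.
have : (0 <= beta_weight a (setT : set R))%E.
  by apply: integral_ge0 => y _; rewrite lee_fin mulr_ge0// powR_ge0.
case: (beta_weight a setT) => [c| |]//; last first.
  by move=> _; rewrite invey mule0 => /eqP; rewrite eqe oner_eq0.
rewrite lee_fin le_eqVlt => /predU1P[<-|c0 _]; last by exists c.
by rewrite mul0e => /eqP; rewrite eqe oner_eq0.
Qed.

Lemma opt_beta_lawE w (A : set R) : measurable A ->
  P (U w @^-1` A) = (beta_weight a A / beta_weight a setT)%E.
Proof. by move=> mA; have := opt_beta_law optSY w mA. Qed.

Lemma opt_unit_interval : exists N : set Omega, [/\ measurable N, P N = 0%E &
  forall om, ~ N om -> forall w, 0 <= U w om <= 1].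
Proof.
pose Nw w := ~` (U w @^-1` [set` `]0, 1[]).
have mU w : measurable (U w @^-1` [set` `]0%R, 1%R[]).
  by rewrite -[X in measurable X]setTI; exact: measurable_funP.
have PNw w : P (Nw w) = 0%E.
  rewrite probability_setC// opt_beta_lawE//.
  rewrite {1}/beta_weight setIid -beta_weight_setTE.
  have [c c0 ->] := beta_weight_setT_fin.
  by rewrite inver gt_eqF// -EFinM divff ?gt_eqF// subee.
pose Nk k := if (@choice.unpickle (seq bool) k) is Some w then Nw w else set0.
have mNk k : measurable (Nk k).
  by rewrite /Nk; case: (@choice.unpickle (seq bool) k) => // w; exact: measurableC.
exists (\bigcup_k Nk k); split.
- exact: bigcup_measurable.
- apply: measure_negligible; first exact: bigcup_measurable.
  apply: negligible_bigcup => k; apply/negligibleP => //.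
  by rewrite /Nk; case: choice.unpickle => // w; exact: PNw.
- move=> om nN w; apply: contrapT => nw; apply: nN; exists (@choice.pickle (seq bool) w) => //.
  rewrite /Nk choice.pickleK /Nw /= in_itv /= => /andP[? ?]; apply: nw.
  by rewrite !ltW.
Qed.

Lemma measurable_node_variable v : measurable_fun setT (node_variable s U v).
Proof.
case: v => w /=; last exact: measurable_funP.
by apply: (@measurableT_comp _ _ _ _ _ _ (fun b : bool => b%:R : R)).
Qed.

Lemma node_variable_independent (J : seq (node + node)) (A : node + node -> set R) :
  uniq J -> (forall i, i \in J -> measurable (A i)) ->
  P (\bigcap_(i in [set` J]) (node_variable s U i @^-1` A i)) =
  (\prod_(i <- J) P (node_variable s U i @^-1` A i))%E.
Proof.
move=> uJ mA; apply: (opt_independent optSY) => // -[w|w] wJ.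
  exists [set b : bool | A (inl w) b%:R] => //.
  by rewrite setTI.
exists (A (inr w)); first exact: mA.
by rewrite setTI.
Qed.

Lemma split_probE w : (\int[P]_om (S w om)%:R%:E = (p w)%:E)%E.
Proof.
have mS : measurable (S w @^-1` [set true]).
  by rewrite -[X in measurable X]setTI; exact: measurable_funP.
transitivity (\int[P]_om (\1_(S w @^-1` [set true]) om)%:E)%E.
  apply: eq_integral => om _; congr (_ %:E); rewrite indicE.
  case h : (S w om); first by rewrite mem_set.
  by rewrite memNset//= h.
rewrite integral_indic// setIT.
have := opt_split_law optSY w [set true].
rewrite /distribution /pushforward /= => ->.
by rewrite bernoulli_probE// !diracE mem_set// memNset// mule1 mule0 adde0.
Qed.

Context (L n : nat) (x : n.-tuple R).
Hypothesis x01 : forall i, tnth x i \in `[0, 1[.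

(** Replacing the proportion by its projection on the unit interval changes it
    on a null set only, and makes the likelihood of a split a bounded function. *)
Definition clip (r : R) : R := Num.max 0 (Num.min 1 r).

Lemma clip01 r : 0 <= clip r <= 1.
Proof. by rewrite /clip le_max lexx /= ge_max ler01 ge_min lexx. Qed.

Lemma clip_id r : 0 <= r <= 1 -> clip r = r.
Proof. by move=> /andP[r0 r1]; rewrite /clip min_r// max_r. Qed.

Lemma measurable_clip : measurable_fun setT clip.
Proof.
by apply: measurable_maxr => //; apply: measurable_minr.
Qed.

Definition split_likelihood (w : node) (r : R) : R :=
  (2 * clip r) ^+ node_count x (rcons w false) *
  (2 * (1 - clip r)) ^+ node_count x (rcons w true).

Lemma test_split_likelihood w : bounded_test (split_likelihood w).
Proof.
have c0 r : 0 <= clip r by case/andP: (clip01 r).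
have c1 r : 0 <= 1 - clip r by rewrite subr_ge0; case/andP: (clip01 r).
apply: test_mul; split.
- apply: (@measurableT_comp _ _ _ _ _ _ (fun r : R => r ^+ _)) => //.
  by apply: measurable_funM => //; exact: measurable_clip.
- by move=> r; rewrite exprn_ge0// mulr_ge0.
- exists (2 ^+ node_count x (rcons w false)) => r.
  by rewrite lerXn2r ?nnegrE ?mulr_ge0// ler_piMr//; case/andP: (clip01 r).
- apply: (@measurableT_comp _ _ _ _ _ _ (fun r : R => r ^+ _)) => //.
  apply: measurable_funM => //; apply: measurable_funB => //.
  exact: measurable_clip.
- by move=> r; rewrite exprn_ge0// mulr_ge0.
- exists (2 ^+ node_count x (rcons w true)) => r.
  by rewrite lerXn2r ?nnegrE ?mulr_ge0// ler_piMr// gerBl.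
Qed.

(** The integrated likelihood of a split at [w] whose proportion lies in [E]. *)
Definition split_evidence (w : node) (E : set R) : R :=
  fine (\int[P]_om (\1_E (U w om) * split_likelihood w (U w om))%:E)%E.

Lemma test_split_likelihood_in w E : measurable E ->
  bounded_test (fun r => \1_E r * split_likelihood w r).
Proof.
by move=> mE; apply: test_mul; [exact: test_indic|exact: test_split_likelihood].
Qed.

Lemma split_evidenceE w E : measurable E ->
  (\int[P]_om (\1_E (U w om) * split_likelihood w (U w om))%:E =
   (split_evidence w E)%:E)%E.
Proof.
move=> /(test_split_likelihood_in w) [_ g0 [B hB]].
rewrite /split_evidence fineK// ge0_fin_numE.
  by apply: (bounded_integral_lty _ (B := B)).
by apply: integral_ge0 => om _; rewrite lee_fin.
Qed.

Lemma split_evidence_setT w :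
  (\int[P]_om (split_likelihood w (U w om))%:E =
   (split_evidence w setT)%:E)%E.
Proof.
rewrite -split_evidenceE//; apply: eq_integral => om _.
by rewrite indicT mul1r.
Qed.

Local Notation m := (split_evidence ^~ setT).
Local Notation Z := (marginal p m).
Local Notation lik := (fun om => likelihood (opt_density L S Y om) x).
Local Notation T := (tree_likelihood s U split_likelihood).

Lemma likelihood_tree_likelihood om : (forall w, 0 <= U w om <= 1) ->
  lik om = T L [::] om.
Proof.
move=> U01; apply: likelihood_split_product => // v _.
by rewrite (opt_sibling optSY) /split_likelihood !clip_id.
Qed.

Lemma measurable_tree_likelihood k v : measurable_fun setT (T k v).
Proof.
apply: measurable_block measurable_node_variable _ _ _.
exact/tree_likelihood_block/test_split_likelihood.
Qed.

Lemma tree_likelihood_ge0 k v om : 0 <= T k v om.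
Proof.
by apply: split_product_ge0 => w; case: (test_split_likelihood w).
Qed.

Lemma evidenceE : (\int[P]_om (lik om)%:E = (Z L [::])%:E)%E.
Proof.
have [N [mN N0 hN]] := opt_unit_interval.
rewrite -(integral_tree_likelihood measurable_node_variable
  node_variable_independent split_probE test_split_likelihood split_evidence_setT).
have mT : measurable_fun setT (fun om => (T L [::] om)%:E).
  by apply/measurable_EFinP; exact: measurable_tree_likelihood.
apply/eqP; rewrite eq_le; apply/andP; split.
  apply: (le_integral_off_null mN N0) => // [om|om /hN U01 _].
    by rewrite lee_fin tree_likelihood_ge0.
  by rewrite lee_fin likelihood_tree_likelihood.
apply: (ge_integral_off_null mN N0) => // [om|om /hN U01].
  by rewrite lee_fin tree_likelihood_ge0.
by rewrite lee_fin likelihood_tree_likelihood.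
Qed.

(** An event at a node: it is reached, it is split or not, and if it is split
    the proportion of its left child lies in a given set. *)
Definition node_event : Type := (node * bool * set R)%type.

Definition event_weight (e : node_event) (k : nat) (om : Omega) : R :=
  let: (u, c, E) := e in
  if c then (S u om)%:R * (\1_E (U u om) * split_likelihood u (U u om)) *
      (T k (rcons u false) om * T k (rcons u true) om)
  else 1 - (S u om)%:R.

Definition event_holds (e : node_event) (om : Omega) : Prop :=
  let: (u, c, E) := e in
  [/\ reached (S ^~ om) [::] u, S u om = c & c -> E (U u om)].

Definition event_evidence (e : node_event) : R :=
  let: (u, c, E) := e in
  if c then p u * split_evidence u E *
    (Z (L - (size u).+1) (rcons u false) * Z (L - (size u).+1) (rcons u true))
  else 1 - p u.

(** On an event at [u] the likelihood is the product of a part outside the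
    subtree at [u] and of a part inside, and these are independent; the first
    factor cancels in the comparison with the likelihood of reaching [u]. *)
Lemma posterior_node_events (B : set (R -> R)) (es : seq node_event) (delta : R) :
  0 <= delta ->
  (forall e, e \in es -> [/\ (size e.1.1 < L)%N, measurable e.2 &
     event_evidence e <= delta * Z (L - size e.1.1) e.1.1]) ->
  (forall om, (forall w, 0 <= U w om <= 1) -> B (opt_density L S Y om) ->
     exists2 e, e \in es & event_holds e om) ->
  (posterior P (opt_density L S Y) x B <= ((size es)%:R * delta)%:E)%E.
Proof.
move=> delta0 hes cover; rewrite /posterior evidenceE.
have [N [mN N0 hN]] := opt_unit_interval.
pose W (e : node_event) om := if e \in es then
  tree_context s U split_likelihood L [::] e.1.1
    (event_weight e (L - (size e.1.1).+1)) om else 0.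
have HW e : e \in es -> block (node_variable s U) (subtree e.1.1)
    (event_weight e (L - (size e.1.1).+1)) /\
  (\int[P]_om (event_weight e (L - (size e.1.1).+1) om)%:E =
    (event_evidence e)%:E)%E.
  case: e => [[u [|]] E] ees /=; have [/= uL mE _] := hes _ ees.
    have tE := test_split_likelihood_in u mE; split.
      apply: (tree_likelihood_split_block tE) => b.
      exact/tree_likelihood_block/test_split_likelihood.
    rewrite (integral_split_node measurable_node_variable
      node_variable_independent (m := split_evidence ^~ setT) split_probE
      test_split_likelihood tE (split_evidenceE u mE))// => w.
    exact: (integral_tree_likelihood measurable_node_variable
      node_variable_independent split_probE test_split_likelihood
      split_evidence_setT).
  split; last exact: (integral_nosplit measurable_node_variable split_probE).
  exact: sub_block (@at_node_subtree u) (block_nosplit _ _ u).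
have HC e : e \in es -> block (node_variable s U) (subtree [::]) (W e) /\
  (\int[P]_om (W e om)%:E <= (delta * Z L [::])%:E)%E.
  move=> ees; have [bW eW] := HW e ees; have [uL mE le] := hes _ ees.
  have [bC eC] := tree_context_block measurable_node_variable
    node_variable_independent split_probE test_split_likelihood
    split_evidence_setT (v := [::]) (ltnW uL) bW.
  rewrite /W ees; split=> //; rewrite eC eW -EFinM lee_fin.
  have c0 : 0 <= context_marginal p m L [::] e.1.1.
    apply: (context_marginal_ge0 measurable_node_variable
      node_variable_independent split_probE test_split_likelihood
      split_evidence_setT) => //.
  apply: (@le_trans _ _ (context_marginal p m L [::] e.1.1 *
      (delta * Z (L - size e.1.1) e.1.1))); first by rewrite ler_wpM2l.
  rewrite mulrCA ler_wpM2l//.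
  apply: (context_marginal_le measurable_node_variable
      node_variable_independent split_probE test_split_likelihood
      split_evidence_setT p01 [::] (ltnW uL)).
have Z0 : 0 <= Z L [::].
  exact: (marginal_ge0 measurable_node_variable
      node_variable_independent split_probE test_split_likelihood
      split_evidence_setT).
have mW e : measurable_fun setT (W e).
  have [ees|nes] := boolP (e \in es).
    by have [bC _] := HC _ ees; exact: measurable_block measurable_node_variable _ _ bC.
  by rewrite /W (negbTE nes).
have W0 e om : 0 <= W e om.
  have [ees|nes] := boolP (e \in es).
    by have [bC _] := HC _ ees; exact: block_ge0 bC.
  by rewrite /W (negbTE nes).
have num : (\int[P]_(om in opt_density L S Y @^-1` B) (lik om)%:E <=
   ((size es)%:R * delta * Z L [::])%:E)%E.
  apply: (@le_trans _ _ (\int[P]_om (\sum_(e <- es) (W e om)%:E))%E).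
    apply: (le_integral_off_null mN N0).
    - by apply: emeasurable_sum => e; exact/measurable_EFinP.
    - by move=> om; apply: sume_ge0 => e _; rewrite lee_fin.
    - move=> om /hN U01 /= /(cover _ U01)[e ees he].
      rewrite sumEFin lee_fin likelihood_tree_likelihood// (big_rem e)//=.
      rewrite -[leLHS]addr0 lerD//; last exact: sumr_ge0.
      have [+ _ _] := hes _ ees; rewrite /W ees /tree_context.
      case: e he {ees} => [[u c] E] /= [ru Su Eu] uL.
      rewrite /tree_likelihood -(split_contextE _ (ltnW uL) ru).
      rewrite le_eqVlt; apply/orP; left; apply/eqP; congr split_context.
      rewrite -(subnSK uL) /= Su; case: c Su Eu => Su Eu /=.
        by rewrite indicE mem_set ?mul1r//; exact: Eu.
      by rewrite subr0.
  rewrite ge0_integral_sum//; last 2 first.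
  - by move=> e; exact/measurable_EFinP.
  - by move=> e om _; rewrite lee_fin.
  apply: (@le_trans _ _ (\sum_(e <- es) (delta * Z L [::])%:E)%E).
    by rewrite big_seq [leRHS]big_seq; apply: lee_sum => e /HC[].
  by rewrite sumEFin lee_fin big_const_seq count_predT iter_addr_0 -mulrA mulr_natl.
have [Zn0|Zn0] := eqVneq (Z L [::]) 0.
  rewrite inver Zn0 eqxx; rewrite Zn0 mulr0 in num.
  apply: (@le_trans _ _ 0%E); last by rewrite lee_fin mulr_ge0.
  by apply: mule_le0_ge0 => //; exact: le0y.
rewrite inver (negbTE Zn0).
rewrite -[leRHS](_ : (((size es)%:R * delta * Z L [::])%:E *
  (Z L [::])^-1%:E)%E = _); last by rewrite -EFinM mulfK.
by apply: lee_wpmul2r => //; rewrite lee_fin invr_ge0.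
Qed.

End posterior.

(** * The posterior as a subprobability *)

Section posterior_bounds.
Context {R : realType} d (Omega : measurableType d) (P : probability Omega R).
Variables (p : node -> R) (a : R).
Variables (S : node -> {RV P >-> bool}) (Y : node -> {RV P >-> R}).
Hypothesis optSY : opt_variables p a S Y.
Variables (L n : nat) (x : n.-tuple R).

Lemma tree_density_ge0 (T : set node) (y : node -> R) r :
  (forall w b, 0 <= y (rcons w b)) -> 0 <= tree_density T y r.
Proof.
move=> y0; apply: fsumr_ge0 => w _; apply: mulr_ge0 => //.
apply: mulr_ge0; first exact: exprn_ge0.
rewrite big_seq; apply: prodr_ge0 => i; rewrite mem_index_iota ltnS => /andP[i0 iw].
case/lastP e : (take i w) => [|u b]; last exact: y0.
by move/(congr1 size): e; rewrite size_takel// => e; rewrite e in i0.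
Qed.

Lemma likelihood_opt_ge0 om : (forall w, 0 <= Y (rcons w false) om <= 1) ->
  0 <= likelihood (opt_density L S Y om) x.
Proof.
move=> U01; apply: prodr_ge0 => i _; apply: tree_density_ge0 => w b.
have /andP[h0 h1] := U01 w; case: b => //.
by rewrite (opt_sibling optSY) subr_ge0.
Qed.

Lemma posterior_ge0_le1 (B : set (R -> R)) :
  (0 <= posterior P (opt_density L S Y) x B <= 1)%E.
Proof.
have [N [mN N0 hN]] := opt_unit_interval optSY.
rewrite /posterior.
have l0 om : ~ N om -> (0 <= (likelihood (opt_density L S Y om) x)%:E)%E.
  by move=> /hN h; rewrite lee_fin likelihood_opt_ge0.
rewrite !(integral_ge0_off_null mN N0 _ l0).
set I := integral _ _ _; set J := integral _ _ _.
have I0 : (0 <= I)%E by exact: integral_ge0.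
have IJ : (I <= J)%E by apply: le_integral_subset.
have J0 : (0 <= J)%E by exact: le_trans IJ.
apply/andP; split; first by rewrite mule_ge0// inve_ge0.
move: J J0 IJ => [r| |]// r0 IJ; last by rewrite invey mule0.
have [e|r00] := eqVneq r 0.
  have -> : I = 0%E by apply/eqP; rewrite eq_le I0 andbT; move: IJ; rewrite e.
  by rewrite mul0e.
rewrite inver (negbTE r00).
have rp : 0 < r by rewrite lt_neqAle eq_sym r00 -lee_fin.
by rewrite lee_pdivrMr// mul1e.
Qed.

End posterior_bounds.

(** * Concentration of the node counts *)

Section product_prob.
Context d (T : measurableType d) {R : realType} (P : probability T R).

Lemma integral_product_prob (g : T -> R) (c : R) n :
  measurable_fun setT g -> (forall t, 0 <= g t) ->
  (\int[P]_t (g t)%:E = c%:E)%E ->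
  (\int[product_prob P n]_x (\prod_(i < n) g (tnth x i))%:E = (c ^+ n)%:E)%E.
Proof.
move=> mg g0 gc.
have mG k : measurable_fun setT (fun x : k.-tuple T => \prod_(i < k) g (tnth x i)).
  apply: measurable_prod => i _.
  by apply: (measurableT_comp mg); exact: measurable_tnth.
have G0 k (x : k.-tuple T) : 0 <= \prod_(i < k) g (tnth x i) by exact: prodr_ge0.
elim: n => [|n IH].
  rewrite /= integral_dirac//; last by apply/measurable_EFinP; exact: mG.
  by rewrite diracT mul1e big_ord0 expr0.
rewrite /= ge0_integral_distribution; last 2 first.
- by apply/measurable_EFinP; exact: mG.
- by move=> x; rewrite lee_fin; exact: G0.
rewrite (eq_integral (fun z : T * n.-tuple T =>
   (g z.1 * \prod_(i < n) g (tnth z.2 i))%:E)); last first.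
  move=> z _ /=; rewrite big_ord_recl; congr (_ * _)%:E.
  by apply: eq_bigr => i _; rewrite tnthS.
rewrite fubini_tonelli1/=; last 2 first.
- apply/measurable_EFinP; apply: measurable_funM; first exact: measurableT_comp.
  exact: (measurableT_comp (mG n) measurable_snd).
- by move=> z; rewrite lee_fin; exact: mulr_ge0 (g0 _) (G0 _ _).
rewrite /fubini_F /=.
under eq_integral.
  move=> t _; under eq_integral do rewrite EFinM.
  rewrite ge0_integralZl_EFin//; last 2 first.
  - by move=> y _; rewrite lee_fin; exact: G0.
  - by apply/measurable_EFinP; exact: mG.
  rewrite IH.
  over.
rewrite ge0_integralZr//.
- by rewrite gc -EFinM exprS.
- exact/measurable_EFinP.
- by move=> t _; rewrite lee_fin.
by rewrite lee_fin exprn_ge0// -lee_fin -gc; apply: integral_ge0 => t _; rewrite lee_fin.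
Qed.

Variables (A : set T) (mA : measurable A) (q : R) (PA : P A = q%:E).

Definition hits n (x : n.-tuple T) : nat := \sum_(i < n) (tnth x i \in A).

Lemma hits_indic n (x : n.-tuple T) :
  (hits x)%:R = \sum_(i < n) \1_A (tnth x i) :> R.
Proof. by rewrite /hits natr_sum. Qed.

Lemma measurable_hits n : measurable_fun setT (fun x : n.-tuple T => (hits x)%:R : R).
Proof.
rewrite (_ : (fun _ => _) = fun x : n.-tuple T => \sum_(i < n) (\1_A (tnth x i) : R)).
  apply: measurable_sum => i.
  by apply: (measurableT_comp (measurable_indic _)) => //; exact: measurable_tnth.
by apply/funext => x; exact: hits_indic.
Qed.

Lemma hit_prob01 : 0 <= q <= 1.
Proof. by rewrite -!lee_fin -PA measure_ge0 probability_le1. Qed.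

Lemma integral_expR_hits n (l : R) :
  (\int[product_prob P n]_x (expR (l * (hits x)%:R))%:E =
   ((1 + q * (expR l - 1)) ^+ n)%:E)%E.
Proof.
have mg : measurable_fun setT (fun t => expR (l * \1_A t)).
  apply: measurableT_comp => //; apply: measurable_funM => //.
rewrite -(@integral_product_prob (fun t => expR (l * \1_A t)))//.
- apply: eq_integral => x _; congr (_ %:E).
  by rewrite hits_indic mulr_sumr expR_sum.
- have PC : P (~` A) = (1%:E - q%:E)%E by rewrite probability_setC// PA.
  rewrite (eq_integral (fun t => (expR l)%:E * (\1_A t)%:E + (\1_(~` A) t)%:E)%E).
    have m1 : measurable_fun setT (fun t => (\1_A t)%:E : \bar R).
      by apply/measurable_EFinP; exact: measurable_indic.
    have m2 : measurable_fun setT (fun t => (\1_(~` A) t)%:E : \bar R).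
      by apply/measurable_EFinP; apply: measurable_indic; exact: measurableC.
    rewrite ge0_integralD//=.
    + rewrite ge0_integralZl_EFin ?expR_ge0//.
      rewrite !integral_indic// ?setIT ?setIT; last exact: measurableC.
      apply: (@eq_trans _ _ ((expR l)%:E * q%:E + (1%:E - q%:E))%E).
        by congr (_ * _ + _)%E.
      by rewrite -EFinM -EFinB -EFinD; congr (_%:E); ring.
    + by apply: measurable_funeM.
  move=> t _; rewrite !indicE in_setC; case: (t \in A) => /=.
    by rewrite mulr1 mule1 adde0.
  by rewrite mulr0 expR0 mule0 add0e.
Qed.

Lemma expR_le_quadratic (l : R) : `|l| <= 2^-1 -> expR l <= 1 + l + 2 * l ^+ 2.
Proof.
rewrite ler_norml => /andP[h1 h2].
have l1 : 0 < 1 - l by lra.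
have e : expR l <= (1 - l)^-1.
  rewrite -[expR l]invrK lef_pV2 ?posrE ?invr_gt0 ?expR_gt0// -expRN.
  exact: expR_ge1Dx.
apply: (le_trans e); rewrite -[leLHS]mul1r ler_pdivrMr//.
nra.
Qed.

(** Markov's inequality for [expR (l * (hits x - n q))]. *)
Lemma hits_chernoff n (l t : R) : `|l| <= 2^-1 ->
  (product_prob P n [set x | (t <= l * ((hits x)%:R - n%:R * q))%R] <=
   (expR (2 * l ^+ 2 * (n%:R * q) - t))%:E)%E.
Proof.
move=> hl; set E := [set x | _].
have mE : measurable E.
  rewrite (_ : E = (fun x : n.-tuple T => l * ((hits x)%:R - n%:R * q)) @^-1` `[t, +oo[%classic).
    rewrite -[X in measurable X]setTI.
    have mh : measurable_fun setT (fun x : n.-tuple T => l * ((hits x)%:R - n%:R * q)).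
      apply: measurable_funM => //; apply: measurable_funB => //.
      exact: measurable_hits.
    exact: mh.
  by apply/seteqP; split=> x /=; rewrite in_itv/= andbT.
have -> : product_prob P n E = (\int[product_prob P n]_x (\1_E x)%:E)%E.
  by rewrite integral_indic// setIT.
apply: (@le_trans _ _ (\int[product_prob P n]_x
   ((expR (- (l * (n%:R * q)) - t))%:E * (expR (l * (hits x)%:R))%:E))%E).
  apply: le_integral_ge0 => x _; first by rewrite lee_fin.
  rewrite -EFinM lee_fin -expRD indicE; case: (boolP (x \in E)) => [/set_mem Ex|_].
    apply: (@le_trans _ _ (expR 0)); first by rewrite expR0.
    rewrite ler_expR; move: Ex; rewrite /E /= mulrBr => Ex; lra.
  exact: expR_ge0.
rewrite ge0_integralZl_EFin ?expR_ge0//.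
rewrite integral_expR_hits -EFinM lee_fin.
have /andP[q0 q1] := hit_prob01.
have h : (1 + q * (expR l - 1)) ^+ n <= expR (n%:R * (q * (expR l - 1))).
  rewrite expRM_natl lerXn2r ?nnegrE ?expR_ge0//; last exact: expR_ge1Dx.
  have := expR_ge0 l; nra.
apply: (le_trans (ler_wpM2l (expR_ge0 _) h)).
rewrite -expRD ler_expR.
have := expR_le_quadratic hl => e.
have : n%:R * (q * (expR l - 1)) <= n%:R * (q * (l + 2 * l ^+ 2)).
  by rewrite ler_wpM2l// ler_wpM2l//; lra.
lra.
apply/measurable_EFinP; apply: measurableT_comp => //.
by apply: measurable_funM => //; exact: measurable_hits.
Qed.

(** Chernoff's bound with [k = sqrt (l / (n q))]: the deviation contributes
    [- 6 l] and the variance [2 l] to the exponent, for each of the two tails.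
    The hypothesis is [k <= 1 / 2]. *)
Lemma hits_concentration n (l : R) : 0 < l -> 4 * l <= n%:R * q ->
  (product_prob P n
     [set x | (6 * Num.sqrt (n%:R * q * l) < `|(hits x)%:R - n%:R * q|)%R] <=
   (2 * expR (- (4 * l)))%:E)%E.
Proof.
set Q := n%:R * q => l0 lQ; have Q0 : 0 < Q by lra.
pose k := Num.sqrt (l / Q).
have k0 : 0 <= k by exact: sqrtr_ge0.
have k2 : k ^+ 2 = l / Q by rewrite sqr_sqrtr// divr_ge0// ltW.
have kh : k <= 2^-1.
  rewrite -(@ler_pXn2r _ 2)// ?nnegrE ?invr_ge0// k2 ler_pdivrMr//; lra.
have kQ : k * Num.sqrt (Q * l) = l.
  rewrite -sqrtrM ?divr_ge0 ?ltW//.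
  have -> : l / Q * (Q * l) = l ^+ 2 by field; rewrite gt_eqF.
  by rewrite sqrtr_sqr ger0_norm// ltW.
have e : 2 * k ^+ 2 * Q - 6 * l = - (4 * l).
  by rewrite k2; field; rewrite gt_eqF.
have mE (c : R) : measurable [set x : n.-tuple T | 6 * l <= c * ((hits x)%:R - Q)].
  rewrite (_ : [set _ | _] = (fun x : n.-tuple T => c * ((hits x)%:R - Q)) @^-1`
     `[6 * l, +oo[%classic); last first.
    by apply/seteqP; split=> x /=; rewrite in_itv/= andbT.
  rewrite -[X in measurable X]setTI.
  have mh : measurable_fun setT (fun x : n.-tuple T => c * ((hits x)%:R - Q)).
    apply: measurable_funM => //; apply: measurable_funB => //.
    exact: measurable_hits.
  exact: mh.
have mdev : measurable [set x : n.-tuple T |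
    6 * Num.sqrt (Q * l) < `|(hits x)%:R - Q|].
  rewrite (_ : [set _ | _] = (fun x : n.-tuple T => `|(hits x)%:R - Q|) @^-1`
     `]6 * Num.sqrt (Q * l), +oo[%classic); last first.
    by apply/seteqP; split=> x /=; rewrite in_itv/= andbT.
  rewrite -[X in measurable X]setTI.
  have mh : measurable_fun setT (fun x : n.-tuple T => `|(hits x)%:R - Q|).
    apply: measurableT_comp => //; apply: measurable_funB => //.
    exact: measurable_hits.
  exact: mh.
have c1 : `|k| <= 2^-1 by rewrite ger0_norm.
have c2 : `|- k| <= 2^-1 by rewrite normrN ger0_norm.
have h1 := hits_chernoff n (6 * l) c1.
have h2 := hits_chernoff n (6 * l) c2.
rewrite -/Q e in h1; rewrite -/Q sqrrN e in h2.
apply: (@le_trans _ _ (product_prob P n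
  ([set x | (6 * l <= k * ((hits x)%:R - Q))%R] `|`
   [set x | (6 * l <= - k * ((hits x)%:R - Q))%R]))).
  apply: le_measure.
  - by apply: mem_set; exact: mdev.
  - by apply: mem_set; exact: measurableU.
  - move=> x /=; set z := (hits x)%:R - Q.
    move=> /ltW hz; have [z0|z0] := leP 0 z; [left|right].
      by rewrite -kQ mulrCA ler_wpM2l// -[z]ger0_norm.
    by rewrite -kQ mulrCA mulNr -mulrN ler_wpM2l// -ltr0_norm.
apply: (le_trans (measureU2 _ (mE _) (mE _))).
have -> : ((2 * expR (- (4 * l)))%:E =
    (expR (- (4 * l)))%:E + (expR (- (4 * l)))%:E)%E.
  by rewrite -EFinD -mulr2n -[X in _ = X%:E]mulr_natl.
exact: leeD h1 h2.
Qed.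

End product_prob.

(** * Typical samples *)

Section words.

Definition words (l : nat) : seq node := [seq tval t | t : l.-tuple bool].

Lemma mem_words l (w : node) : (w \in words l) = (size w == l).
Proof.
apply/mapP/eqP => [[t _ ->]|<-]; first exact: size_tuple.
by exists (in_tuple w) => //; rewrite mem_enum.
Qed.

Lemma size_words l : size (words l) = (2 ^ l)%N.
Proof. by rewrite size_map -cardE card_tuple card_bool. Qed.

Fixpoint words_below (L : nat) : seq node :=
  if L is l.+1 then words_below l ++ words l else [::].

Lemma mem_words_below L (w : node) : (w \in words_below L) = (size w < L)%N.
Proof.
elim: L => [|l IH] //=; rewrite mem_cat IH mem_words ltnS.
by rewrite [in RHS]leq_eqVlt orbC.
Qed.

Lemma size_words_below L : (size (words_below L) <= 2 ^ L)%N.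
Proof.
elim: L => [|l IH] //=; rewrite size_cat size_words expnS mul2n -addnn.
by rewrite leq_add2r.
Qed.

End words.

Lemma measure_bigsetU_le d (T : measurableType d) {R : realType}
    (mu : {measure set T -> \bar R}) (I : Type) (r : seq I) (F : I -> set T) :
  (forall i, measurable (F i)) ->
  (mu (\big[setU/set0]_(i <- r) F i) <= \sum_(i <- r) mu (F i))%E.
Proof.
move=> mF; elim: r => [|i r IH]; first by rewrite !big_nil measure0.
rewrite !big_cons; apply: (le_trans (measureU2 _ (mF i) _)).
  exact: bigsetU_measurable.
exact: leeD.
Qed.

Section good_data.
Context {R : realType} (P : probability R R).

Definition node_mass (w : node) : R := fine (P (@dyadic_interval R w)).

Lemma node_massE w : P (@dyadic_interval R w) = (node_mass w)%:E.
Proof.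
rewrite /node_mass fineK// fin_num_measure//; exact: measurable_dyadic_interval.
Qed.

(** For [l] the logarithm of the sample size, the exceptional probability of
    each of the deviations below is at most [2 n ^ (- 4)]. *)
Definition typical (L n : nat) (l : R) : set (n.-tuple R) :=
  [set x | (forall i, tnth x i \in `[0, 1[) /\
     forall w : node, (size w <= L)%N ->
       `|(node_count x w)%:R - n%:R * node_mass w| <=
       6 * Num.sqrt (n%:R * node_mass w * l)].

Lemma measurable_deviation n w (t : R) : measurable
  [set x : n.-tuple R | (t < `|(node_count x w)%:R - n%:R * node_mass w|)%R].
Proof.
rewrite (_ : [set _ | _] = (fun x : n.-tuple R =>
   `|(hits (@dyadic_interval R w) x)%:R - n%:R * node_mass w|) @^-1`
   `]t, +oo[%classic); last first.
  by apply/seteqP; split=> x /=; rewrite in_itv/= andbT.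
rewrite -[X in measurable X]setTI.
have mh : measurable_fun setT (fun x : n.-tuple R =>
   `|(hits (@dyadic_interval R w) x)%:R - n%:R * node_mass w|).
  apply: measurableT_comp => //; apply: measurable_funB => //.
  by apply: measurable_hits; exact: measurable_dyadic_interval.
exact: mh.
Qed.

(** A union bound over the nodes; it is stated through a measurable event [A]
    that contains all atypical samples. *)
Lemma atypical_prob (L n : nat) (l : R) : 0 < l -> P [set` `[0, 1[] = 1%E ->
  (forall w, (size w <= L)%N -> 4 * l <= n%:R * node_mass w) ->
  exists A : set (n.-tuple R), [/\ measurable A,
    forall x, ~ A x -> typical L l x &
    (product_prob P n A <= ((2 ^ L.+1)%:R * (2 * expR (- (4 * l))))%:E)%E].
Proof.
move=> l0 P1 hL.
pose I01 := [set` `[0, 1[] : set R.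
have mI : measurable I01 by exact: measurable_itv.
pose A0 := [set x : n.-tuple R | ~ forall i, I01 (tnth x i)].
pose D w := [set x : n.-tuple R |
  (6 * Num.sqrt (n%:R * node_mass w * l) < `|(node_count x w)%:R - n%:R * node_mass w|)%R].
have mD w : measurable (D w) by exact: measurable_deviation.
have A0C : ~` A0 = \bigcap_(i in [set: 'I_n]) ((fun x : n.-tuple R => tnth x i) @^-1` I01).
  apply/seteqP; split=> x /=.
    by move=> /contrapT h i _; exact: h.
  by move=> h; apply; move=> i; exact: h.
have mA0C : measurable (~` A0).
  rewrite A0C; apply: fin_bigcap_measurable => // i _.
  by rewrite -[X in measurable X]setTI; exact: measurable_tnth.
have mA0 : measurable A0 by rewrite -[A0]setCK; exact: measurableC.
have PA0 : product_prob P n A0 = 0%E.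
  rewrite -[A0]setCK probability_setC//.
  suff -> : product_prob P n (~` A0) = 1%E by rewrite subee.
  have -> : product_prob P n (~` A0) = (\int[product_prob P n]_x
      (\prod_(i < n) (\1_I01 (tnth x i) : R))%:E)%E.
    have -> : product_prob P n (~` A0) =
        (\int[product_prob P n]_x (\1_(~` A0) x)%:E)%E.
      by rewrite integral_indic// setIT.
    apply: eq_integral => x _; congr (_ %:E); rewrite indicE.
    case: (boolP (x \in ~` A0)) => [/set_mem/contrapT h|].
      by rewrite big1// => i _; rewrite indicE mem_set//; exact: h.
    rewrite in_setC negbK => /set_mem/existsNP[i hi].
    by rewrite (bigD1 i)//= indicE memNset// mul0r.
  rewrite (@integral_product_prob _ _ _ P (\1_I01) 1)//; first by rewrite expr1n.
  by rewrite integral_indic// setIT.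
exists (A0 `|` \big[setU/set0]_(w <- words_below L.+1) D w); split.
- apply: measurableU => //; exact: bigsetU_measurable.
- move=> x; rewrite -bigcup_seq => /not_orP[/contrapT h1 h2]; split=> // w wL.
  rewrite leNgt; apply/negP => h; apply: h2; exists w => //.
  by have : w \in words_below L.+1 by rewrite mem_words_below ltnS.
- apply: (le_trans (measureU2 _ mA0 _)); first exact: bigsetU_measurable.
  rewrite -[leRHS]add0e; apply: leeD.
    by rewrite le_eqVlt; apply/orP; left; apply/eqP; exact: PA0.
  apply: (le_trans (measure_bigsetU_le _ _ mD)).
  apply: (@le_trans _ _ (\sum_(w <- words_below L.+1) (2 * expR (- (4 * l)))%:E)%E).
    rewrite big_seq [leRHS]big_seq; apply: lee_sum => w.
    rewrite mem_words_below ltnS => wL; apply: hits_concentration => //.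
    - exact: measurable_dyadic_interval.
    - exact: node_massE.
    - exact: hL.
  rewrite sumEFin lee_fin big_const_seq count_predT iter_addr_0 -[leLHS]mulr_natl.
  rewrite ler_wpM2r ?mulr_ge0 ?expR_ge0// ler_nat.
  exact: size_words_below.
Qed.

End good_data.

(** * The Bernoulli likelihood near its maximum *)

Section bernoulli_likelihood.
Context {R : realType}.
Variables (N0 N1 : nat).
Hypotheses (N0_gt0 : (0 < N0)%N) (N1_gt0 : (0 < N1)%N).

Local Notation N := ((N0 + N1)%:R : R).
Definition frequency : R := N0%:R / (N0 + N1)%:R.
Local Notation q := frequency.

Let Ngt0 : 0 < N. Proof. by rewrite ltr0n addn_gt0 N0_gt0. Qed.

Lemma frequency_gt0 : 0 < q.
Proof. by rewrite divr_gt0// ltr0n. Qed.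

Lemma frequencyC : 1 - q = N1%:R / N.
Proof. by rewrite /frequency natrD; field; rewrite -natrD gt_eqF. Qed.

Lemma frequency_lt1 : 0 < 1 - q.
Proof. by rewrite frequencyC divr_gt0// ltr0n. Qed.

Definition max_likelihood : R := (2 * q) ^+ N0 * (2 * (1 - q)) ^+ N1.

Lemma max_likelihood_gt0 : 0 < max_likelihood.
Proof.
by rewrite mulr_gt0// exprn_gt0// mulr_gt0// ?frequency_gt0 ?frequency_lt1.
Qed.

Let NqE : N0%:R = N * q.
Proof. by rewrite mulrC divfK// gt_eqF. Qed.

Let NqCE : N1%:R = N * (1 - q).
Proof. by rewrite frequencyC mulrC divfK// gt_eqF. Qed.

Let exprn_le_expR (z : R) (k : nat) : 0 <= z -> z ^+ k <= expR (k%:R * (z - 1)).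
Proof.
move=> z0; rewrite expRM_natl lerXn2r ?nnegrE ?expR_ge0//.
by have := expR_ge1Dx (z - 1); rewrite addrC subrK.
Qed.

(** The Kullback-Leibler divergence dominates the squared Hellinger distance,
    and therefore the squared difference of the parameters. *)
Lemma likelihood_le_max (y : R) : 0 <= y <= 1 ->
  (2 * y) ^+ N0 * (2 * (1 - y)) ^+ N1 <=
  max_likelihood * expR (- (N * (y - q) ^+ 2 / 2)).
Proof.
move=> /andP[y0 y1]; have q0 := frequency_gt0; have q1 := frequency_lt1.
have y1' : 0 <= 1 - y by rewrite subr_ge0.
pose u := Num.sqrt y; pose v := Num.sqrt (1 - y).
pose s := Num.sqrt q; pose t := Num.sqrt (1 - q).
have u2 : u ^+ 2 = y by rewrite sqr_sqrtr.
have v2 : v ^+ 2 = 1 - y by rewrite sqr_sqrtr.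
have s2 : s ^+ 2 = q by rewrite sqr_sqrtr// ltW.
have t2 : t ^+ 2 = 1 - q by rewrite sqr_sqrtr// ltW.
have s0 : 0 < s by rewrite sqrtr_gt0.
have t0 : 0 < t by rewrite sqrtr_gt0.
have u0 : 0 <= u by exact: sqrtr_ge0.
have v0 : 0 <= v by exact: sqrtr_ge0.
have e1 : (2 * y) ^+ N0 = (2 * q) ^+ N0 * ((u / s) ^+ N0) ^+ 2.
  rewrite -exprM mulnC exprM -exprMn; congr (_ ^+ _).
  by rewrite expr_div_n u2 s2; field; rewrite gt_eqF.
have e2 : (2 * (1 - y)) ^+ N1 = (2 * (1 - q)) ^+ N1 * ((v / t) ^+ N1) ^+ 2.
  rewrite -exprM mulnC exprM -exprMn; congr (_ ^+ _).
  by rewrite expr_div_n v2 t2; field; rewrite gt_eqF.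
rewrite e1 e2 mulrACA -/max_likelihood ler_wpM2l ?(ltW max_likelihood_gt0)//.
have l1 : (u / s) ^+ N0 <= expR (N0%:R * (u / s - 1)).
  by apply: exprn_le_expR; rewrite divr_ge0// ltW.
have l2 : (v / t) ^+ N1 <= expR (N1%:R * (v / t - 1)).
  by apply: exprn_le_expR; rewrite divr_ge0// ltW.
have l3 : ((u / s) ^+ N0 * (v / t) ^+ N1) ^+ 2 <=
    (expR (N0%:R * (u / s - 1)) * expR (N1%:R * (v / t - 1))) ^+ 2.
  have us0 : 0 <= (u / s) ^+ N0 by rewrite exprn_ge0// divr_ge0// ltW.
  have vt0 : 0 <= (v / t) ^+ N1 by rewrite exprn_ge0// divr_ge0// ltW.
  rewrite lerXn2r// ?nnegrE; [exact: mulr_ge0| |exact: ler_pM].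
  by rewrite mulr_ge0 ?expR_ge0.
rewrite -exprMn; apply: (le_trans l3).
rewrite -expRD -expRM_natl ler_expR NqE NqCE.
have -> : 2 * (N * q * (u / s - 1) + N * (1 - q) * (v / t - 1)) =
  2 * (N * (s * u + t * v - (s ^+ 2 + t ^+ 2))).
  by rewrite -t2 -s2; field; rewrite !gt_eqF.
have -> : 2 * (N * (s * u + t * v - (s ^+ 2 + t ^+ 2))) = - (N * ((u - s) ^+ 2 + (v - t) ^+ 2)).
  have -> : (u - s) ^+ 2 + (v - t) ^+ 2 =
    (u ^+ 2 + v ^+ 2) + (s ^+ 2 + t ^+ 2) - 2 * (s * u + t * v) by ring.
  by rewrite u2 v2 s2 t2; ring.
rewrite lerN2 -mulrA ler_wpM2l ?(ltW Ngt0)//.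
have le1 (z : R) : 0 <= z -> z ^+ 2 <= 1 -> z <= 1.
  by move=> z0; rewrite expr_le1.
have quarter (z1 z2 : R) : 0 <= z1 -> 0 <= z2 -> z1 ^+ 2 <= 1 -> z2 ^+ 2 <= 1 ->
    (z1 ^+ 2 - z2 ^+ 2) ^+ 2 / 4 <= (z1 - z2) ^+ 2.
  move=> z10 z20 /(le1 _ z10) z11 /(le1 _ z20) z21.
  rewrite subr_sqr exprMn -mulrA ler_piMr ?exprn_even_ge0//.
  rewrite ler_pdivrMr// mul1r.
  have -> : 4 = 2 ^+ 2 :> R by ring.
  rewrite lerXn2r ?nnegrE ?addr_ge0//; lra.
have k1 := quarter u s u0 (ltW s0); rewrite u2 s2 in k1.
have k2 := quarter v t v0 (ltW t0); rewrite v2 t2 in k2.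
have := k1 y1 ltac:(lra); have := k2 ltac:(lra) ltac:(lra).
have -> : 1 - y - (1 - q) = - (y - q) by ring.
rewrite sqrrN; lra.
Qed.

(** From [t <= expR (t - 1)] applied to [t = 2 q] and [t = 2 (1 - q)]. *)
Lemma max_likelihood_le : max_likelihood <= expR ((N0%:R - N1%:R) ^+ 2 / N).
Proof.
have q0 := frequency_gt0; have q1 := frequency_lt1.
have l1 : (2 * q) ^+ N0 <= expR (N0%:R * (2 * q - 1)).
  by apply: exprn_le_expR; rewrite mulr_ge0// ltW.
have l2 : (2 * (1 - q)) ^+ N1 <= expR (N1%:R * (2 * (1 - q) - 1)).
  by apply: exprn_le_expR; rewrite mulr_ge0// ltW.
apply: (@le_trans _ _ (expR (N0%:R * (2 * q - 1)) * expR (N1%:R * (2 * (1 - q) - 1)))).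
  by apply: ler_pM => //; rewrite exprn_ge0// mulr_ge0// ltW.
rewrite -expRD ler_expR le_eqVlt; apply/orP; left; apply/eqP.
by rewrite frequencyC /frequency natrD; field; rewrite -natrD gt_eqF.
Qed.

(** The likelihood at the parameter [1 / 2] is one, and is to be compared with
    the maximum. *)
Lemma max_likelihood_ge : expR ((N0%:R - N1%:R) ^+ 2 / (8 * N)) <= max_likelihood.
Proof.
have := @likelihood_le_max 2^-1; rewrite (_ : 1 - 2^-1 = 2^-1 :> R); last by field.
rewrite divff// !expr1n mul1r invr_ge0 ler0n invf_le1//= ler1n => /(_ isT).
rewrite expRN ler_pdivlMr ?expR_gt0// mul1r.
apply: le_trans; rewrite ler_expR le_eqVlt; apply/orP; left; apply/eqP.
by rewrite /frequency natrD; field; rewrite -natrD gt_eqF.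
Qed.

(** Within a distance of order [1 / N] of its maximizer, the likelihood only
    loses a constant factor. *)
Lemma likelihood_ge_max (c y : R) (n : nat) : 0 < c -> c <= q -> c <= 1 - q ->
  (N0 + N1 <= n)%N -> `|y - q| <= c / (2 * n%:R) ->
  max_likelihood * expR (-1) <= (2 * y) ^+ N0 * (2 * (1 - y)) ^+ N1.
Proof.
move=> c0 cq cq' Nn yq; have q0 := frequency_gt0; have q1 := frequency_lt1.
have Nn' : N <= n%:R by rewrite ler_nat.
have n1 : 1 <= n%:R :> R by rewrite ler1n (leq_trans _ Nn)// addn_gt0 N0_gt0.
have n0 : 0 < n%:R :> R by rewrite (lt_le_trans _ n1).
have cn : c / (2 * n%:R) <= c / 2.
  rewrite ler_pM2l// lef_pV2 ?posrE ?mulr_gt0//; lra.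
have [y1 y2] : q - c / 2 <= y /\ y <= q + c / 2.
  have := le_trans yq cn; rewrite ler_norml => /andP[? ?]; split; lra.
have yc : c / 2 <= y by lra.
have yc' : c / 2 <= 1 - y by lra.
have y0 : 0 < y by lra.
have y0' : 0 < 1 - y by lra.
have e1 : (2 * q) ^+ N0 = (2 * y) ^+ N0 * (q / y) ^+ N0.
  by rewrite -exprMn; congr (_ ^+ _); field; rewrite gt_eqF.
have e2 : (2 * (1 - q)) ^+ N1 = (2 * (1 - y)) ^+ N1 * ((1 - q) / (1 - y)) ^+ N1.
  by rewrite -exprMn; congr (_ ^+ _); field; rewrite gt_eqF.
rewrite /max_likelihood e1 e2 mulrACA.
have : 0 <= (2 * y) ^+ N0 * (2 * (1 - y)) ^+ N1.
  by rewrite mulr_ge0// exprn_ge0// mulr_ge0// ltW.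
move: (_ * _ ^+ N1) => G G0; rewrite -mulrA -[leRHS]mulr1 ler_wpM2l//.
rewrite expRN ler_pdivrMr ?expR_gt0// mul1r.
have l1 : (q / y) ^+ N0 <= expR (N0%:R * (q / y - 1)).
  by apply: exprn_le_expR; rewrite divr_ge0// ltW.
have l2 : ((1 - q) / (1 - y)) ^+ N1 <= expR (N1%:R * ((1 - q) / (1 - y) - 1)).
  by apply: exprn_le_expR; rewrite divr_ge0// ltW.
apply: (@le_trans _ _ (expR (N0%:R * (q / y - 1)) * expR (N1%:R * ((1 - q) / (1 - y) - 1)))).
  by apply: ler_pM => //; rewrite exprn_ge0// divr_ge0// ltW.
rewrite -expRD ler_expR NqE NqCE.
have -> : N * q * (q / y - 1) + N * (1 - q) * ((1 - q) / (1 - y) - 1) =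
  N * (y - q) ^+ 2 / (y * (1 - y)).
  by field; rewrite !gt_eqF.
rewrite ler_pdivrMr ?mulr_gt0// mul1r.
have h1 : (y - q) ^+ 2 <= (c / (2 * n%:R)) ^+ 2.
  have r0 : 0 <= c / (2 * n%:R) by rewrite divr_ge0 ?mulr_ge0// ltW.
  rewrite -[(y - q) ^+ 2]real_normK ?num_real//.
  by apply: lerXn2r; rewrite ?nnegrE.
have h2 : (c / 2) * (c / 2) <= y * (1 - y) by apply: ler_pM => //; lra.
apply: (le_trans _ h2); apply: (@le_trans _ _ (n%:R * (c / (2 * n%:R)) ^+ 2)).
  by apply: ler_pM => //; exact: exprn_even_ge0.
have -> : n%:R * (c / (2 * n%:R)) ^+ 2 = c / 2 * (c / 2) / n%:R.
  by field; rewrite gt_eqF.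
by rewrite ler_pdivrMr// ler_peMr// mulr_ge0// divr_ge0// ltW.
Qed.

End bernoulli_likelihood.

(** * The evidence of a split *)

Section evidence.
Context {R : realType} d (Omega : measurableType d) (P : probability Omega R).
Variables (p : node -> R) (a : R).
Variables (S : node -> {RV P >-> bool}) (Y : node -> {RV P >-> R}).
Hypothesis optSY : opt_variables p a S Y.
Local Notation U := (fun w om => Y (rcons w false) om).

Lemma powR_ge_min (c y : R) : 0 < c -> c <= y -> y <= 1 ->
  Num.min 1 (c `^ (a - 1)) <= y `^ (a - 1).
Proof.
move=> c0 cy y1; rewrite ge_min; have [a1|a1] := leP 0 (a - 1).
  by rewrite orbC ge0_ler_powR// ?nnegrE ltW// (lt_le_trans c0).
apply/orP; left.
have y0 : 0 < y by exact: lt_le_trans cy.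
rewrite -[a - 1]opprK powRN -[leLHS]invr1 lef_pV2 ?posrE ?powR_gt0//.
have e1 : 1 `^ (- (a - 1)) = 1 :> R by rewrite powR1.
rewrite -[leRHS]e1 ge0_ler_powR// ?nnegrE ?ltW//.
by rewrite oppr_gt0.
Qed.

(** The Beta density is bounded below away from the end points. *)
Lemma opt_beta_ge (c : R) : 0 < c -> exists2 k : R, 0 < k &
  forall w (u v : R), c <= u -> u <= v -> v <= 1 - c ->
    ((k * (v - u))%:E <= P (U w @^-1` `[u, v]))%E.
Proof.
move=> c0; have [W W0 WE] := beta_weight_setT_fin optSY.
pose b := Num.min 1 (c `^ (a - 1)).
have b0 : 0 < b by rewrite lt_min ltr01 powR_gt0.
exists (b * b / W); first by rewrite !(mulr_gt0, invr_gt0).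
move=> w u v cu uv vc; rewrite (opt_beta_lawE optSY)// WE inver gt_eqF//.
rewrite mulrAC EFinM; apply: lee_wpmul2r; first by rewrite lee_fin invr_ge0 ltW.
apply: (@le_trans _ _ (\int[lebesgue_measure]_(y in `[u, v]) (b * b)%:E)%E).
  rewrite integral_cst//= lebesgue_measure_itv/= lte_fin.
  move: uv; rewrite le_eqVlt => /predU1P[->|uv]; first by rewrite ltxx subrr mulr0 mule0.
  by rewrite uv -EFinB -EFinM.
apply: le_integral_subset => y /=.
- by rewrite lee_fin mulr_ge0// ltW.
- by move=> _; rewrite lee_fin mulr_ge0// powR_ge0.
- rewrite in_itv/= => /andP[uy yv]; split.
    by split; rewrite /= ?in_itv/=; apply/andP; split; lra.
  rewrite lee_fin ler_pM ?(ltW b0)//; apply: powR_ge_min => //; lra.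
Qed.

Context (n : nat) (x : n.-tuple R).
Local Notation c0 w := (node_count x (rcons w false)).
Local Notation c1 w := (node_count x (rcons w true)).

Lemma split_evidence_le w : (0 < c0 w)%N -> (0 < c1 w)%N ->
  split_evidence Y x w setT <=
    expR (((c0 w)%:R - (c1 w)%:R) ^+ 2 / (c0 w + c1 w)%:R).
Proof.
move=> h0 h1; rewrite -lee_fin -split_evidence_setT.
set B := expR _; apply: (@le_trans _ _ (\int[P]_om B%:E)%E); last first.
  by rewrite integral_cst//= probability_setT mule1.
apply: le_integral_ge0 => om _; rewrite lee_fin.
  by case: (test_split_likelihood x w).
apply: (le_trans _ (max_likelihood_le h0 h1)).
apply: (le_trans (likelihood_le_max h0 h1 (clip01 _))).
rewrite ler_piMr ?(ltW (max_likelihood_gt0 h0 h1))//.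
by rewrite -expR0 ler_expR oppr_le0 divr_ge0// mulr_ge0// exprn_even_ge0.
Qed.

Lemma split_evidence_far w (E : set R) (dd : R) :
  (0 < c0 w)%N -> (0 < c1 w)%N -> measurable E ->
  (forall r, E r -> 0 <= r <= 1 /\ dd <= (r - frequency (c0 w) (c1 w)) ^+ 2) ->
  split_evidence Y x w E <=
    max_likelihood (c0 w) (c1 w) * expR (- ((c0 w + c1 w)%:R * dd / 2)).
Proof.
move=> h0 h1 mE hE; rewrite -lee_fin -split_evidenceE//.
set B := _ * expR _; have B0 : 0 <= B.
  by rewrite mulr_ge0 ?expR_ge0// ltW// max_likelihood_gt0.
apply: (@le_trans _ _ (\int[P]_om B%:E)%E); last first.
  by rewrite integral_cst//= probability_setT mule1.
apply: le_integral_ge0 => om _; rewrite lee_fin.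
  by rewrite mulr_ge0//; case: (test_split_likelihood x w).
rewrite indicE; case: (boolP (_ \in _)) => [/set_mem/hE[r01 rd]|_]; last by rewrite mul0r.
rewrite mul1r /split_likelihood clip_id//.
apply: (le_trans (likelihood_le_max h0 h1 r01)).
rewrite ler_wpM2l ?(ltW (max_likelihood_gt0 h0 h1))// ler_expR lerN2.
by rewrite ler_wpM2r// ler_wpM2l.
Qed.

End evidence.

Section evidence_lower.
Context {R : realType} d (Omega : measurableType d) (P : probability Omega R).
Variables (p : node -> R) (a : R).
Variables (S : node -> {RV P >-> bool}) (Y : node -> {RV P >-> R}).
Hypothesis optSY : opt_variables p a S Y.
Local Notation U := (fun w om => Y (rcons w false) om).

(** Only the proportions within [c / (2 n)] of the empirical frequency are kept:
    they have prior mass of order [1 / n]. *)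
Lemma split_evidence_ge (c : R) : 0 < c -> exists2 k : R, 0 < k &
  forall n (x : n.-tuple R) w,
  let N0 := node_count x (rcons w false) in
  let N1 := node_count x (rcons w true) in
  (0 < N0)%N -> (0 < N1)%N -> (N0 + N1 <= n)%N ->
  c <= frequency N0 N1 -> c <= 1 - frequency N0 N1 ->
  k / n%:R * max_likelihood N0 N1 <= split_evidence Y x w setT.
Proof.
move=> c0; have c2 : 0 < c / 2 by rewrite divr_gt0.
have [k k0 hk] := opt_beta_ge optSY c2.
exists (k * c * expR (-1)); first by rewrite !mulr_gt0 ?expR_gt0.
move=> n x w N0 N1 h0 h1 hn cq cq'.
have n1 : 1 <= n%:R :> R by rewrite ler1n (leq_trans _ hn)// addn_gt0 h0.
have n0 : 0 < n%:R :> R by rewrite (lt_le_trans _ n1).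
pose q := frequency N0 N1 : R; pose r := c / (2 * n%:R).
have cq1 : c <= q by []; have cq2 : c <= 1 - q by [].
have r0 : 0 < r by rewrite divr_gt0// mulr_gt0.
have rc : r <= c / 2.
  rewrite ler_pM2l// lef_pV2 ?posrE ?mulr_gt0//; lra.
pose J := U w @^-1` `[q - r, q + r].
have mJ : measurable J.
  by rewrite -[X in measurable X]setTI; exact: measurable_funP.
have PJ : ((k * (2 * r))%:E <= P J)%E.
  have -> : 2 * r = (q + r) - (q - r) by ring.
  by apply: hk; lra.
set M := max_likelihood N0 N1; have M0 : 0 < M by exact: max_likelihood_gt0.
rewrite -lee_fin -split_evidence_setT.
apply: (@le_trans _ _ (\int[P]_(om in J) (M * expR (-1))%:E)%E).
  rewrite integral_cst//.
  apply: (@le_trans _ _ ((M * expR (-1))%:E * (k * (2 * r))%:E)%E); last first.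
    by rewrite lee_wpmul2l// lee_fin mulr_ge0 ?expR_ge0// ltW.
  rewrite -EFinM lee_fin le_eqVlt; apply/orP; left; apply/eqP.
  by rewrite /r; field; rewrite gt_eqF.
apply: le_integral_subset => om.
- by rewrite lee_fin mulr_ge0 ?expR_ge0// ltW.
- by move=> _; rewrite lee_fin; case: (test_split_likelihood x w).
- rewrite /J /= in_itv/= => /andP[J1 J2]; split=> //; rewrite lee_fin.
  have cU : clip (U w om) = U w om.
    apply: clip_id; apply/andP; split; lra.
  rewrite /split_likelihood cU; apply: (likelihood_ge_max h0 h1 c0 cq cq' hn).
  by rewrite -/q -/r ler_norml; apply/andP; split; lra.
Qed.

End evidence_lower.

(** * Bounds on the marginal likelihoods *)

Section marginal_bounds.
Context {R : realType} (p m : node -> R).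
Hypotheses (p01 : forall w, 0 <= p w <= 1) (m0 : forall w, 0 <= m w).
Local Notation Z := (marginal p m).

Let p0 w : 0 <= p w. Proof. by case/andP: (p01 w). Qed.

Lemma marginal_pos k v : 0 <= Z k v.
Proof.
elim: k v => //= k IH v; have /andP[? ?] := p01 v.
by rewrite addr_ge0 ?subr_ge0// !mulr_ge0.
Qed.

Lemma marginal_ge_nosplit k v : 1 - p v <= Z k.+1 v.
Proof. by rewrite /= lerDl !mulr_ge0// marginal_pos. Qed.

Lemma marginal_ge_split k v :
  p v * m v * (Z k (rcons v false) * Z k (rcons v true)) <= Z k.+1 v.
Proof. by rewrite /= lerDr subr_ge0; case/andP: (p01 v). Qed.

Lemma marginal_ge_half k v : p v <= 2^-1 -> 2^-1 <= Z k v.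
Proof.
move=> h; case: k => [|k] /=; first by rewrite invf_le1// ler1n.
by apply: le_trans (marginal_ge_nosplit k v); lra.
Qed.

(** By induction, a node below level [l] contributes at most
    [1 + 1 / 8 * (2 * 2)]. *)
Lemma marginal_le2 (L l k : nat) v :
  (forall w : node, (l <= size w < L)%N -> p w * m w <= 8^-1) ->
  (l <= size v)%N -> (size v + k = L)%N -> Z k v <= 2.
Proof.
move=> small; elim: k v => [|k IH] v lv vk /=; first by rewrite ler1n.
have kb b : Z k (rcons v b) <= 2.
  by apply: IH; rewrite size_rcons ?addSnnS// (leq_trans lv).
have sm : p v * m v <= 8^-1 by apply: small; rewrite lv -vk -addSnnS leq_addr.
have zz : Z k (rcons v false) * Z k (rcons v true) <= 2 * 2.
  by apply: ler_pM => //; exact: marginal_pos.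
have : p v * m v * (Z k (rcons v false) * Z k (rcons v true)) <= 8^-1 * (2 * 2).
  by apply: ler_pM => //; rewrite mulr_ge0 ?marginal_pos.
have := p0 v; lra.
Qed.

(** The siblings of the nodes on the path have marginal at least [1 / 2], since
    they may remain leaves. *)
Lemma marginal_path (r : R) k v u : 0 <= r -> (size u <= k)%N ->
  (forall w : node, (0 < size w)%N -> p w <= 2^-1) ->
  (forall i, (i < size u)%N -> r <= p (v ++ take i u) * m (v ++ take i u) / 2) ->
  r ^+ size u * Z (k - size u) (v ++ u) <= Z k v.
Proof.
move=> r0 + hp; elim: u k v => [|b u IH] [|k] v //=; rewrite ?cats0 ?mul1r ?subn0//.
rewrite ltnS subSS => uk hr.
have rv := hr 0%N isT; rewrite /= cats0 in rv.
apply: le_trans (marginal_ge_split k v).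
have {IH} := IH k (rcons v b) uk.
have hr' i : (i < size u)%N ->
    r <= p (rcons v b ++ take i u) * m (rcons v b ++ take i u) / 2.
  by move=> iu; have := hr i.+1 iu; rewrite /= cat_rcons.
move=> /(_ hr'); rewrite cat_rcons => IH.
have half b' : 2^-1 <= Z k (rcons v b').
  by apply: marginal_ge_half; apply: hp; rewrite size_rcons.
rewrite exprS -mulrA.
apply: (@le_trans _ _ (p v * m v / 2 * Z k (rcons v b))).
  apply: ler_pM => //; rewrite mulr_ge0 ?exprn_ge0// ?marginal_pos//.
rewrite -mulrA ler_wpM2l ?mulr_ge0//.
case: b {hr hr' IH} => /=; last by rewrite mulrC ler_wpM2l ?marginal_pos.
by rewrite ler_wpM2r ?marginal_pos.
Qed.

End marginal_bounds.

(** * Typical counts *)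

(** With [t0] and [t1] the expected counts of the two children of a node, the
    hypothesis [tl] says that the deviation [D] is at most [c / 4 * t], so that
    the counts are comparable to their expectations. *)
Section typical_node.
Context {R : realType}.
Variables (l c t0 t1 t : R) (N0 N1 : nat).
Hypothesis tE : t = t0 + t1.
Local Notation D := (6 * Num.sqrt (t * l)).
Hypotheses (l0 : 0 < l) (c0 : 0 < c) (c1 : c <= 2^-1).
Hypotheses (ht0 : c * t <= t0) (ht1 : c * t <= t1).
Hypothesis tl : 576 * l <= c ^+ 2 * t.
Hypotheses (h0 : `|N0%:R - t0| <= 6 * Num.sqrt (t0 * l))
           (h1 : `|N1%:R - t1| <= 6 * Num.sqrt (t1 * l))
           (h : `|(N0 + N1)%:R - t| <= D).

Let t_gt0 : 0 < t.
Proof.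
have : 0 < c ^+ 2 * t by apply: lt_le_trans tl; have := l0; lra.
by rewrite pmulr_rgt0// exprn_gt0.
Qed.

Let D_ge0 : 0 <= D. Proof. by rewrite mulr_ge0// sqrtr_ge0. Qed.

Let D2 : D ^+ 2 = 36 * (t * l).
Proof. by rewrite exprMn sqr_sqrtr ?mulr_ge0 ?ltW//; ring. Qed.

Let Dt : D <= c / 4 * t.
Proof.
have ct0 : 0 <= c / 4 * t by rewrite mulr_ge0 ?divr_ge0// ltW.
rewrite -(@ler_pXn2r _ 2)// D2 exprMn expr_div_n.
have := ler_wpM2l (ltW t_gt0) tl.
have -> : t * (576 * l) = 576 * (t * l) by ring.
have -> : c ^+ 2 / 4 ^+ 2 * t ^+ 2 = t * (c ^+ 2 * t) / 16 by field.
lra.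
Qed.

Let Dt8 : D <= t / 8.
Proof.
apply: (le_trans Dt); have : c * t <= 2^-1 * t by rewrite ler_wpM2r// ltW.
lra.
Qed.

Let t0_gt0 : 0 < t0. Proof. by apply: lt_le_trans ht0; rewrite mulr_gt0. Qed.
Let t1_gt0 : 0 < t1. Proof. by apply: lt_le_trans ht1; rewrite mulr_gt0. Qed.

Let sqrt_mono (s : R) : 0 <= s -> s <= t -> 6 * Num.sqrt (s * l) <= D.
Proof.
move=> s0 st; rewrite ler_pM2l// ler_wsqrtr// ler_wpM2r// ltW//.
Qed.

Let d0 : `|N0%:R - t0| <= D.
Proof. apply: (le_trans h0); by apply: sqrt_mono; rewrite ?tE ?lerDl ?lerDr ltW. Qed.

Let d1 : `|N1%:R - t1| <= D.
Proof. apply: (le_trans h1); by apply: sqrt_mono; rewrite ?tE ?lerDl ?lerDr ltW. Qed.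

Let n0 : 3 / 4 * c * t <= N0%:R.
Proof. have := Dt; have := ht0; move: d0; rewrite ler_norml => /andP[? ?]; lra. Qed.

Let n1 : 3 / 4 * c * t <= N1%:R.
Proof. have := Dt; have := ht1; move: d1; rewrite ler_norml => /andP[? ?]; lra. Qed.

Let nn : 7 / 8 * t <= (N0 + N1)%:R /\ (N0 + N1)%:R <= 9 / 8 * t.
Proof. have := Dt8; move: h; rewrite ler_norml => /andP[? ?]; split; lra. Qed.

Lemma typical_count0 : (0 < N0)%N.
Proof. by rewrite -(ltr_nat R); apply: lt_le_trans n0; rewrite !mulr_gt0. Qed.

Lemma typical_count1 : (0 < N1)%N.
Proof. by rewrite -(ltr_nat R); apply: lt_le_trans n1; rewrite !mulr_gt0. Qed.

Let N_gt0 : 0 < (N0 + N1)%:R :> R.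
Proof. by case: nn => + _; apply: lt_le_trans; rewrite mulr_gt0. Qed.

Lemma typical_frequency_ge : c / 2 <= frequency N0 N1.
Proof.
rewrite /frequency ler_pdivlMr//; have [_ ?] := nn.
have : c / 2 * (N0 + N1)%:R <= c / 2 * (9 / 8 * t) by rewrite ler_wpM2l// divr_ge0// ltW.
have : 0 < c * t by rewrite mulr_gt0.
have := n0; lra.
Qed.

Lemma typical_frequency_le : c / 2 <= 1 - frequency N0 N1.
Proof.
rewrite frequencyC ?typical_count0// ler_pdivlMr//; have [_ ?] := nn.
have : c / 2 * (N0 + N1)%:R <= c / 2 * (9 / 8 * t) by rewrite ler_wpM2l// divr_ge0// ltW.
have : 0 < c * t by rewrite mulr_gt0.
have := n1; lra.
Qed.

(** From [N0 / N - t0 / t = ((N0 - t0) t - t0 (N - t)) / (N t)]. *)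
Lemma typical_frequency : `|frequency N0 N1 - t0 / t| <= 3 * (D / t).
Proof.
have -> : frequency N0 N1 - t0 / t =
   ((N0%:R - t0) * t - t0 * ((N0 + N1)%:R - t)) / ((N0 + N1)%:R * t).
  by rewrite /frequency; field; rewrite -natrD !gt_eqF.
rewrite normrM normfV [ `|_ * t|]gtr0_norm ?mulr_gt0// ler_pdivrMr ?mulr_gt0//.
have a1 : `|(N0%:R - t0) * t| <= D * t.
  by rewrite normrM [ `|t|]gtr0_norm// ler_wpM2r// ltW.
have a2 : `|t0 * ((N0 + N1)%:R - t)| <= t * D.
  rewrite normrM gtr0_norm//; apply: ler_pM => //; first exact: ltW.
  by rewrite tE lerDl ltW.
apply: (le_trans (ler_normB _ _)).
have -> : 3 * (D / t) * ((N0 + N1)%:R * t) = 3 * D * (N0 + N1)%:R.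
  by field; rewrite gt_eqF//.
have : 3 * D * (7 / 8 * t) <= 3 * D * (N0 + N1)%:R.
  by rewrite ler_wpM2l ?mulr_ge0//; case: nn.
have : 0 <= D * t by rewrite mulr_ge0// ltW.
have : 3 * D * (7 / 8 * t) = 21 / 8 * (D * t) by field.
rewrite (mulrC t D) in a2; lra.
Qed.

Lemma typical_imbalance_le :
  (N0%:R - N1%:R) ^+ 2 / (N0 + N1)%:R <= 3 * ((t0 - t1) ^+ 2 / t) + 330 * l.
Proof.
have a : (N0%:R - N1%:R) ^+ 2 <= 2 * (t0 - t1) ^+ 2 + 8 * D ^+ 2.
  move: d0 d1; rewrite !ler_norml => /andP[? ?] /andP[? ?].
  set e := (N0%:R - N1%:R) - (t0 - t1).
  have e2 : e ^+ 2 <= (2 * D) ^+ 2.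
    rewrite -[e ^+ 2]real_normK ?num_real//.
    apply: lerXn2r; rewrite ?nnegrE// ?mulr_ge0// ler_norml; apply/andP; split; rewrite /e; lra.
  have -> : N0%:R - N1%:R = e + (t0 - t1) by rewrite /e; ring.
  have := sqr_ge0 (e - (t0 - t1)); rewrite exprMn in e2; lra.
rewrite ler_pdivrMr//.
have : (3 * ((t0 - t1) ^+ 2 / t) + 330 * l) * (7 / 8 * t) <=
   (3 * ((t0 - t1) ^+ 2 / t) + 330 * l) * (N0 + N1)%:R.
  rewrite ler_wpM2l; [by []| |by case: nn].
  have : 0 <= (t0 - t1) ^+ 2 / t.
    by rewrite divr_ge0 ?exprn_even_ge0// ltW.
  have := l0; lra.
apply: le_trans; apply: (le_trans a); rewrite D2.
have -> : (3 * ((t0 - t1) ^+ 2 / t) + 330 * l) * (7 / 8 * t) =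
  21 / 8 * (t0 - t1) ^+ 2 + 2310 / 8 * (t * l) by field; rewrite gt_eqF.
have := sqr_ge0 (t0 - t1); have : 0 <= t * l by rewrite mulr_ge0// ltW.
lra.
Qed.

(** The hypothesis means that the expected imbalance is at least [4 * D], while
    the counts perturb it by at most [2 * D]. *)
Lemma typical_imbalance_ge : 576 * (t * l) <= (t0 - t1) ^+ 2 ->
  (t0 - t1) ^+ 2 / t / 36 <= (N0%:R - N1%:R) ^+ 2 / (8 * (N0 + N1)%:R).
Proof.
move=> hs; have a : 4 * D <= `|t0 - t1|.
  rewrite -(@ler_pXn2r _ 2)// ?nnegrE ?mulr_ge0//.
  by rewrite real_normK ?num_real// exprMn D2; lra.
have b : `|t0 - t1| / 2 <= `|N0%:R - N1%:R|.
  have e : `|(t0 - t1) - (N0%:R - N1%:R)| <= 2 * D.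
    move: d0 d1; rewrite !ler_norml => /andP[? ?] /andP[? ?].
    by apply/andP; split; lra.
  have : `|t0 - t1| <= `|N0%:R - N1%:R| + `|(t0 - t1) - (N0%:R - N1%:R)|.
    by rewrite -{1}[t0 - t1](subrK (N0%:R - N1%:R)) addrC ler_normD.
  lra.
have b2 : (t0 - t1) ^+ 2 / 4 <= (N0%:R - N1%:R) ^+ 2.
  rewrite -[(t0 - t1) ^+ 2]real_normK ?num_real//.
  rewrite -[(N0%:R - N1%:R) ^+ 2]real_normK ?num_real//.
  have -> : `|t0 - t1| ^+ 2 / 4 = (`|t0 - t1| / 2) ^+ 2 by field.
  by apply: lerXn2r; rewrite ?nnegrE ?divr_ge0.
rewrite ler_pdivlMr ?mulr_gt0//.
have [_ nle] := nn.
have s0 : 0 <= (t0 - t1) ^+ 2 / t / 36 by rewrite !divr_ge0 ?exprn_even_ge0// ltW.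
have : (t0 - t1) ^+ 2 / t / 36 * (8 * (N0 + N1)%:R) <=
   (t0 - t1) ^+ 2 / t / 36 * (8 * (9 / 8 * t)).
  by rewrite ler_wpM2l// ler_pM2l.
move/le_trans; apply; apply: le_trans b2.
by rewrite le_eqVlt; apply/orP; left; apply/eqP; field; rewrite gt_eqF.
Qed.

(** A proportion that is [6 * (D / t)] away from the true one is still
    [3 * (D / t)] away from the empirical one. *)
Lemma typical_far (r : R) : 6 * (D / t) < `|r - t0 / t| ->
  8 * l <= (N0 + N1)%:R * (324 * (l / t)) /\
  324 * (l / t) <= (r - frequency N0 N1) ^+ 2.
Proof.
move=> hr; split.
  have : 7 / 8 * t * (324 * (l / t)) <= (N0 + N1)%:R * (324 * (l / t)).
    have lt0 : 0 <= l / t by rewrite divr_ge0// ltW.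
    by rewrite ler_wpM2r; [by []|lra|case: nn].
  have -> : 7 / 8 * t * (324 * (l / t)) = 567 / 2 * l by field; rewrite gt_eqF.
  have := l0; lra.
have a : 3 * (D / t) <= `|r - frequency N0 N1|.
  have : `|r - t0 / t| <= `|r - frequency N0 N1| + `|frequency N0 N1 - t0 / t|.
    have -> : r - t0 / t = (r - frequency N0 N1) + (frequency N0 N1 - t0 / t) by ring.
    exact: ler_normD.
  have := typical_frequency; lra.
have -> : 324 * (l / t) = (3 * (D / t)) ^+ 2.
  rewrite exprMn expr_div_n D2; field; rewrite gt_eqF//.
rewrite -[(r - _) ^+ 2]real_normK ?num_real//.
by apply: lerXn2r; rewrite ?nnegrE// mulr_ge0// divr_ge0// ltW.
Qed.

End typical_node.

(** * Masses of the dyadic intervals *)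

Section node_mass.
Context {R : realType} (alpha K mu : R) (f0 : R -> R) (P0 : probability R R).
Hypotheses (alpha0 : 0 < alpha) (K0 : 0 <= K) (mu0 : 0 < mu).
Hypotheses (hf0 : holder_density alpha K mu f0) (hP0 : has_density P0 f0).

Local Notation pi := (node_mass P0).

Lemma holder_le (x y : R) : x \in `[0, 1[ -> y \in `[0, 1[ ->
  `|f0 x - f0 y| <= K * `|x - y| `^ alpha.
Proof.
move=> x01 y01; have [->|xy] := eqVneq x y.
  by rewrite !subrr normr0 mulr_ge0// powR_ge0.
rewrite -ler_pdivrMr ?powR_gt0 ?normr_gt0 ?subr_eq0// -lee_fin.
have [_ _] := hf0; apply: le_trans; apply: ereal_sup_ubound.
by exists x, y.
Qed.

Lemma f0_ge (x : R) : x \in `[0, 1[ -> mu <= f0 x.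
Proof. by case: hf0 => h _ _; exact: h. Qed.

Lemma f0_ge0 (x : R) : x \in `[0, 1[ -> 0 <= f0 x.
Proof. by move=> /f0_ge; apply: le_trans; exact: ltW. Qed.

Lemma node_mass_integral w :
  ((pi w)%:E = \int[lebesgue_measure]_(x in @dyadic_interval R w) (f0 x)%:E)%E.
Proof.
rewrite -node_massE hP0; last exact: measurable_dyadic_interval.
congr integral; apply: setIidl => x /sub_dyadic_interval.
by [].
Qed.

Lemma dyadic_interval01 w (x : R) : dyadic_interval w x -> x \in `[0, 1[.
Proof. by move/sub_dyadic_interval. Qed.

Lemma node_mass_ge w (b : R) : 0 <= b ->
  (forall y, dyadic_interval w y -> b <= f0 y) -> b <= 2 ^+ size w * pi w.
Proof.
move=> b0 hb; have p0 : 0 < (2 : R) ^+ size w by rewrite exprn_gt0.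
rewrite -ler_pdivrMl// -lee_fin node_mass_integral.
apply: (@le_trans _ _ (\int[lebesgue_measure]_(x in @dyadic_interval R w) b%:E)%E).
  rewrite integral_cst//=; last exact: measurable_dyadic_interval.
  by rewrite lebesgue_measure_dyadic_interval -EFinM mulrC.
by apply: le_integral_ge0 => x xw; rewrite lee_fin// hb.
Qed.

Lemma node_mass_le w (b : R) :
  (forall y, dyadic_interval w y -> f0 y <= b) -> 2 ^+ size w * pi w <= b.
Proof.
move=> hb; have p0 : 0 < (2 : R) ^+ size w by rewrite exprn_gt0.
rewrite -ler_pdivlMl// -lee_fin node_mass_integral.
apply: (@le_trans _ _ (\int[lebesgue_measure]_(x in @dyadic_interval R w) b%:E)%E).
  apply: le_integral_ge0 => x xw; rewrite lee_fin ?hb//.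
  by apply: f0_ge0; exact: dyadic_interval01 xw.
rewrite integral_cst//=; last exact: measurable_dyadic_interval.
by rewrite lebesgue_measure_dyadic_interval -EFinM mulrC.
Qed.

(** The mean of [f0] over an interval lies between the extrema of [f0] there. *)
Lemma node_mass_dev w (x : R) : dyadic_interval w x ->
  `|2 ^+ size w * pi w - f0 x| <= K * ((2 ^+ size w)^-1) `^ alpha.
Proof.
move=> xw; set e := K * _.
have hd y : dyadic_interval w y -> `|f0 x - f0 y| <= e.
  move=> yw; apply: (le_trans (holder_le _ _)).
  - exact: dyadic_interval01 xw.
  - exact: dyadic_interval01 yw.
  - rewrite ler_wpM2l//; apply: ge0_ler_powR;
      rewrite ?nnegrE ?(ltW alpha0) ?invr_ge0 ?exprn_ge0//.
    exact: dyadic_interval_dist xw yw.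
have p0 : 0 <= 2 ^+ size w * pi w.
  by apply: node_mass_ge => // y /dyadic_interval01; exact: f0_ge0.
rewrite ler_distl; apply/andP; split.
  have [h|h] := leP 0 (f0 x - e); last by rewrite (le_trans (ltW h)).
  apply: node_mass_ge => // y /hd; rewrite ler_norml => /andP[? ?]; lra.
by apply: node_mass_le => y /hd; rewrite ler_norml => /andP[? ?]; lra.
Qed.

Lemma node_mass_nil : pi [::] = 1.
Proof.
apply/eqP; rewrite -eqe node_mass_integral dyadic_interval_nil.
by case: hf0 => _ -> _.
Qed.

Lemma prob_unit_interval : P0 [set` `[0, 1[] = 1%E.
Proof. by rewrite -dyadic_interval_nil node_massE node_mass_nil. Qed.

(** The mean of [f0] over the unit interval is one. *)
Lemma f0_le (x : R) : x \in `[0, 1[ -> f0 x <= 1 + K.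
Proof.
move=> x01; have := @node_mass_dev [::] x.
rewrite dyadic_interval_nil node_mass_nil /= expr0 invr1 powR1 !mulr1.
by move=> /(_ x01); rewrite ler_norml => /andP[? ?]; lra.
Qed.

Lemma node_mass_bounds w : mu <= 2 ^+ size w * pi w <= 1 + K.
Proof.
apply/andP; split.
  by apply: node_mass_ge => [|y /dyadic_interval01]; [exact: ltW|exact: f0_ge].
by apply: node_mass_le => y /dyadic_interval01; exact: f0_le.
Qed.

Lemma node_mass_rcons w : pi w = pi (rcons w false) + pi (rcons w true).
Proof.
have m_ b := measurable_dyadic_interval (R := R) (rcons w b).
apply/eqP; rewrite -eqe EFinD -!node_massE -measureU//.
  apply/eqP; congr (P0 _); apply/seteqP; split=> x.
    move=> xw; case e : (midpoint w <= x); [right|left];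
    by apply/dyadic_interval_rcons; rewrite e.
  by move=> [|] /dyadic_interval_rcons[].
rewrite -subset0 => x [/dyadic_interval_rcons[_ e1] /dyadic_interval_rcons[_ e2]].
by rewrite -e1 in e2.
Qed.

Lemma dyadic_interval_nonempty w : exists x : R, dyadic_interval w x.
Proof.
exists ((node_index w)%:R / 2 ^+ size w); rewrite /dyadic_interval /= lexx /=.
by rewrite ltr_pM2r ?invr_gt0 ?exprn_gt0// ltr_nat.
Qed.

(** Both means are compared with the value of [f0] at a common point. *)
Lemma node_mass_imbalance w :
  2 ^+ size w * `|pi (rcons w false) - pi (rcons w true)| <=
  2 * K * ((2 ^+ size w)^-1) `^ alpha.
Proof.
have [x xw] := dyadic_interval_nonempty (rcons w false).
have h1 := node_mass_dev xw; have h2 := node_mass_dev (sub_dyadic_interval_rcons xw).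
rewrite size_rcons in h1.
have p0 : 0 < (2 : R) ^+ size w by rewrite exprn_gt0.
rewrite -[2 ^+ size w in leLHS]gtr0_norm// -normrM.
have -> : 2 ^+ size w * (pi (rcons w false) - pi (rcons w true)) =
  (2 ^+ (size w).+1 * pi (rcons w false) - f0 x) - (2 ^+ size w * pi w - f0 x).
  by rewrite (node_mass_rcons w) exprS; ring.
apply: (le_trans (ler_normB _ _)).
have h3 : ((2 ^+ (size w).+1)^-1 : R) `^ alpha <= ((2 ^+ size w)^-1) `^ alpha.
  apply: ge0_ler_powR; rewrite ?nnegrE ?(ltW alpha0) ?invr_ge0 ?exprn_ge0//.
  by rewrite lef_pV2 ?posrE ?exprn_gt0// exprS ler_peMl// ?ler1n// ltW// exprn_gt0.
have := ler_wpM2l K0 h3; lra.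
Qed.

End node_mass.

(** * Elementary estimates *)

Section estimates.
Context {R : realType}.

Lemma sqrt2X (i : nat) : Num.sqrt (2 ^+ i) = Num.sqrt 2 ^+ i :> R.
Proof.
elim: i => [|i IH]; first by rewrite !expr0 sqrtr1.
by rewrite !exprS sqrtrM// IH.
Qed.

Lemma sqrt2_ge1 : 1 <= Num.sqrt 2 :> R.
Proof. by rewrite -[leLHS]sqrtr1 ler_wsqrtr// ler1n. Qed.

(** The ratio of the geometric sum is [sqrt 2], and [4 <= 3 * sqrt 2]. *)
Lemma sum_sqrt2 (j : nat) :
  \sum_(i < j) Num.sqrt 2 ^+ i <= 3 * Num.sqrt 2 ^+ j :> R.
Proof.
have h : 4 <= 3 * Num.sqrt 2 :> R.
  have : Num.sqrt 2 ^+ 2 = 2 :> R by rewrite sqr_sqrtr.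
  have := sqrt2_ge1; rewrite expr2; nra.
elim: j => [|j IH]; first by rewrite big_ord0 mulr_ge0// exprn_ge0// sqrtr_ge0.
rewrite big_ord_recr /= exprS mulrA.
have p0 : 0 <= Num.sqrt 2 ^+ j :> R by rewrite exprn_ge0// sqrtr_ge0.
have := ler_wpM2r p0 h; lra.
Qed.

(** Relative errors of the factors add up in the exponent. *)
Lemma prod_perturbation (j : nat) (u v e : 'I_j -> R) :
  (forall i, 0 <= u i) -> (forall i, 0 <= v i) -> (forall i, 0 <= e i) ->
  (forall i, `|u i - v i| <= e i * v i) ->
  `|\prod_(i < j) u i - \prod_(i < j) v i| <=
    \prod_(i < j) v i * (expR (\sum_(i < j) e i) - 1).
Proof.
elim: j u v e => [|j IH] u v e u0 v0 e0 h.
  by rewrite !big_ord0 subrr normr0 expR0 subrr mulr0.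
rewrite !big_ord_recr /=.
have {IH} := IH (fun i => u (widen_ord (leqnSn j) i))
  (fun i => v (widen_ord (leqnSn j) i)) (fun i => e (widen_ord (leqnSn j) i)) _ _ _ _.
move=> /(_ (fun=> u0 _) (fun=> v0 _) (fun=> e0 _) (fun=> h _)).
have V0 : 0 <= \prod_(i < j) v (widen_ord (leqnSn j) i) by exact: prodr_ge0.
move: (u ord_max) (v ord_max) (e ord_max) (u0 ord_max) (v0 ord_max) (e0 ord_max) (h ord_max).
move: V0; move: (\prod_(i < j) u _) (\prod_(i < j) v _) (\sum_(i < j) e _).
move=> A B s B0 a b t a0 b0 t0 hab IH.
have -> : A * a - B * b = (A - B) * a + B * (a - b) by ring.
apply: (le_trans (ler_normD _ _)); rewrite !normrM (ger0_norm a0) (ger0_norm B0).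
have ab : a <= (1 + t) * b.
  by move: hab; rewrite ler_norml => /andP[_ ?]; lra.
have E0 : 0 <= B * (expR s - 1) by exact: le_trans IH.
have h1 : `|A - B| * a <= B * (expR s - 1) * ((1 + t) * b) by apply: ler_pM.
have h2 : B * `|a - b| <= B * (t * b) by rewrite ler_wpM2l.
have h3 : expR s * (1 + t) <= expR s * expR t.
  by rewrite ler_wpM2l ?expR_ge0// expR_ge1Dx.
have h4 := ler_wpM2l (mulr_ge0 B0 b0) h3.
rewrite expRD.
have e1 : B * (expR s - 1) * ((1 + t) * b) + B * (t * b) =
  B * b * (expR s * (1 + t)) - B * b by ring.
have e2 : B * b * (expR s * expR t - 1) = B * b * (expR s * expR t) - B * b by ring.
rewrite e2; lra.
Qed.

End estimates.

(** * The evidence of splits on typical data *)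

Section posterior_on_typical_data.
Context {R : realType} (alpha K mu : R) (f0 : R -> R) (P0 : probability R R).
Hypotheses (alpha0 : 0 < alpha) (K0 : 0 <= K) (mu0 : 0 < mu).
Hypotheses (hf0 : holder_density alpha K mu f0) (hP0 : has_density P0 f0).
Local Notation pi := (node_mass P0).

(** A lower bound for the share of each child in the mass of its parent. *)
Definition balance : R := mu / (2 * (1 + K)).
Local Notation c := balance.

Lemma lower_bound_le : mu <= 1 + K.
Proof.
have /andP[h1 h2] := node_mass_bounds alpha0 K0 mu0 hf0 hP0 [::].
exact: le_trans h2.
Qed.

Lemma balance_gt0 : 0 < c.
Proof. by rewrite divr_gt0// mulr_gt0// ltr_pwDl. Qed.

Lemma balance_le : c <= 2^-1.
Proof.
have K1 : 0 < 1 + K by rewrite ltr_pwDl.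
by rewrite ler_pdivrMr ?mulr_gt0// mulrA mulVf// mul1r lower_bound_le.
Qed.

Lemma node_mass_child w b : c * pi w <= pi (rcons w b).
Proof.
have K1 : 0 < 1 + K by rewrite ltr_pwDl.
have /andP[_ h1] := node_mass_bounds alpha0 K0 mu0 hf0 hP0 w.
have /andP[h2 _] := node_mass_bounds alpha0 K0 mu0 hf0 hP0 (rcons w b).
rewrite size_rcons exprS -mulrA in h2.
have p0 : 0 < (2 : R) ^+ size w by rewrite exprn_gt0.
rewrite -(ler_pM2l p0) -(@ler_pM2l _ 2)//.
have -> : 2 * (2 ^+ size w * (c * pi w)) = mu * ((2 ^+ size w * pi w) / (1 + K)).
  by rewrite /c; field; rewrite gt_eqF.
apply: le_trans h2; rewrite -[leRHS]mulr1 ler_wpM2l ?(ltW mu0)//.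
by rewrite ler_pdivrMr// mul1r.
Qed.

Lemma node_mass_gt0 w : 0 < pi w.
Proof.
have /andP[h _] := node_mass_bounds alpha0 K0 mu0 hf0 hP0 w.
by have := lt_le_trans mu0 h; rewrite pmulr_rgt0// exprn_gt0.
Qed.

Variables (n : nat) (l : R) (L : nat) (x : n.-tuple R).
Hypotheses (l1 : 1 <= l) (hn : n%:R = expR l :> R).
Hypothesis mass_large : forall w : node, (size w <= L)%N ->
  576 * l <= c ^+ 2 * (n%:R * pi w).
Hypothesis hx : typical P0 L l x.

Local Notation N0 w := (node_count x (rcons w false)).
Local Notation N1 w := (node_count x (rcons w true)).
Local Notation t0 w := (n%:R * pi (rcons w false)).
Local Notation t1 w := (n%:R * pi (rcons w true)).
Local Notation t w := (n%:R * pi w).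

Let l0 : 0 < l. Proof. exact: lt_le_trans l1. Qed.
Let n0 : 0 < n%:R :> R. Proof. by rewrite hn expR_gt0. Qed.

Let massE (w : node) : t w = t0 w + t1 w.
Proof. by rewrite -mulrDr -node_mass_rcons. Qed.

Let mass_child (w : node) b : c * t w <= n%:R * pi (rcons w b).
Proof. by rewrite mulrCA ler_pM2l// node_mass_child. Qed.

Let count_near (w : node) : (size w < L)%N ->
  [/\ `|(N0 w)%:R - t0 w| <= 6 * Num.sqrt (t0 w * l),
      `|(N1 w)%:R - t1 w| <= 6 * Num.sqrt (t1 w * l) &
      `|(N0 w + N1 w)%:R - t w| <= 6 * Num.sqrt (t w * l)].
Proof.
move=> wL; have [_ h] := hx; split.
- by apply: h; rewrite size_rcons.
- by apply: h; rewrite size_rcons.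
- by rewrite -node_count_rcons; apply: h; exact: ltnW.
Qed.

Lemma typical_counts w : (size w < L)%N ->
  [/\ (0 < N0 w)%N, (0 < N1 w)%N,
      c / 2 <= frequency (N0 w) (N1 w) :> R &
      c / 2 <= 1 - frequency (N0 w) (N1 w) :> R].
Proof.
move=> wL; have [h0 h1 h] := count_near wL.
have tl := mass_large (ltnW wL).
have c0 := balance_gt0; have c2 := balance_le.
have tE := massE w; have ht0 := mass_child w false; have ht1 := mass_child w true.
split.
- exact: (typical_count0 (t := t w) (t0 := t0 w) (t1 := t1 w) (l := l) (c := c)).
- exact: (typical_count1 (t := t w) (t0 := t0 w) (t1 := t1 w) (l := l) (c := c)).
- exact: (typical_frequency_ge (t := t w) (t0 := t0 w) (t1 := t1 w) (l := l) (c := c)).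
- exact: (typical_frequency_le (t := t w) (t0 := t0 w) (t1 := t1 w) (l := l) (c := c)).
Qed.

Variables (a Gamma : R) (d : measure_display) (Omega : measurableType d)
  (P : probability Omega R)
  (S : node -> {RV P >-> bool}) (Y : node -> {RV P >-> R}).
Local Notation p := (fun w : node => Gamma ^- size w).
Hypothesis optSY : opt_variables p a S Y.
Hypothesis Gamma2 : 2 <= Gamma.
Local Notation m := (split_evidence Y x ^~ setT).
Local Notation Z := (marginal p m).

Let Gamma0 : 0 < Gamma. Proof. exact: lt_le_trans Gamma2. Qed.

Lemma split_prob01 (w : node) : 0 <= p w <= 1.
Proof.
rewrite invr_ge0 exprn_ge0 ?(ltW Gamma0)//= invf_le1 ?exprn_gt0//.
by rewrite exprn_ege1//; have := Gamma2; lra.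
Qed.

Lemma split_prob_half (w : node) : (0 < size w)%N -> p w <= 2^-1.
Proof.
move=> w0; rewrite lef_pV2 ?posrE ?exprn_gt0//; apply: (le_trans Gamma2).
by rewrite -{1}[Gamma]expr1 ler_weXn2l//; have := Gamma2; lra.
Qed.

Lemma split_evidence_ge0 w E : measurable E -> 0 <= split_evidence Y x w E.
Proof.
move=> mE; rewrite -lee_fin -split_evidenceE//; apply: integral_ge0 => om _.
by rewrite lee_fin mulr_ge0//; case: (test_split_likelihood x w).
Qed.

(* In this section [k / n] is the prior mass near the empirical frequency. *)
Variable (k : R).
Hypothesis k0 : 0 < k.
Hypothesis hk : forall (x : n.-tuple R) w,
  let N0 := node_count x (rcons w false) in
  let N1 := node_count x (rcons w true) in
  (0 < N0)%N -> (0 < N1)%N -> (N0 + N1 <= n)%N ->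
  c / 2 <= frequency N0 N1 -> c / 2 <= 1 - frequency N0 N1 ->
  k / n%:R * max_likelihood N0 N1 <= split_evidence Y x w setT.
Hypothesis k_large : 4 <= k * expR l.

Lemma node_count_le w : (node_count x w <= n)%N.
Proof.
rewrite /node_count -[X in (_ <= X)%N]card_ord -sum1_card.
by apply: leq_sum => i _; case: (_ \in _).
Qed.

Lemma typical_evidence_max w : (size w < L)%N ->
  k * expR (- l) * max_likelihood (N0 w) (N1 w) <= m w.
Proof.
move=> wL; have [h0 h1 h2 h3] := typical_counts wL.
rewrite expRN -hn; apply: hk => //.
by rewrite -node_count_rcons node_count_le.
Qed.

Lemma typical_evidence_ge w : (size w < L)%N -> k * expR (- l) <= m w.
Proof.
move=> wL; have [h0 h1 h2 h3] := typical_counts wL.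
apply: le_trans (typical_evidence_max wL).
rewrite ler_peMr ?mulr_ge0 ?expR_ge0 ?(ltW k0)//.
apply: le_trans (max_likelihood_ge h0 h1).
by rewrite -[leLHS]expR0 ler_expR divr_ge0 ?exprn_even_ge0// mulr_ge0.
Qed.

(** The expected value of [(N0 - N1) ^ 2 / N], up to the noise: the gain in
    log-likelihood of a split is of this order. *)
Definition imbalance (w : node) : R := (t0 w - t1 w) ^+ 2 / t w.

Lemma typical_evidence_le w : (size w < L)%N ->
  m w <= expR (3 * imbalance w + 330 * l).
Proof.
move=> wL; have [h0 h1 h2 h3] := typical_counts wL.
apply: (le_trans (split_evidence_le Y h0 h1)); rewrite ler_expR.
have [hh0 hh1 hh] := count_near wL.
have tl := mass_large (ltnW wL).
have c0 := balance_gt0; have c2 := balance_le.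
have tE := massE w; have ht0 := mass_child w false; have ht1 := mass_child w true.
exact: (typical_imbalance_le (c := c)).
Qed.

Lemma typical_evidence_significant w : (size w < L)%N ->
  576 * l <= imbalance w -> k * expR (- l) * expR (imbalance w / 36) <= m w.
Proof.
move=> wL hs; have [h0 h1 h2 h3] := typical_counts wL.
apply: le_trans (typical_evidence_max wL).
rewrite ler_wpM2l ?mulr_ge0 ?expR_ge0 ?(ltW k0)//.
apply: le_trans (max_likelihood_ge h0 h1); rewrite ler_expR.
have [hh0 hh1 hh] := count_near wL.
have tl := mass_large (ltnW wL).
have c0 := balance_gt0; have c2 := balance_le.
have tE := massE w; have ht0 := mass_child w false; have ht1 := mass_child w true.
apply: (typical_imbalance_ge tE l0 c0 c2 ht0 ht1 tl hh0 hh1 hh).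
have t00 : 0 < t w by rewrite mulr_gt0// node_mass_gt0.
move: hs; rewrite /imbalance (ler_pdivlMr _ _ t00) => hs.
by rewrite (mulrC (t w) l) mulrA; exact: hs.
Qed.

Definition left_share (w : node) : R := pi (rcons w false) / pi w.
(** [6 * (D / t)] for [D = 6 * sqrt (t * l)], cf. the typical counts. *)
Definition deviation (w : node) : R := 36 * Num.sqrt (l / t w).

Definition far (w : node) : set R :=
  [set r | 0 <= r <= 1 /\ deviation w < `|r - left_share w|].

Let sqrt_ratio (s : R) : 0 < s -> Num.sqrt (s * l) / s = Num.sqrt (l / s).
Proof.
move=> s0; have -> : s * l = s ^+ 2 * (l / s) by field; rewrite gt_eqF.
rewrite sqrtrM ?exprn_even_ge0// sqrtr_sqr gtr0_norm//.
by rewrite mulrC mulKf// gt_eqF.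
Qed.

Lemma measurable_far w : measurable (far w).
Proof.
rewrite (_ : far w = `[0, 1] `&`
  ((fun r => `|r - left_share w|) @^-1` `]deviation w, +oo[%classic)).
  apply: measurableI; first exact: measurable_itv.
  rewrite -[X in measurable X]setTI.
  have mh : measurable_fun setT (fun r : R => `|r - left_share w|).
    by apply: measurableT_comp => //; exact: measurable_funB.
  exact: mh.
by apply/seteqP; split=> r /=; rewrite /far /= !in_itv/= andbT.
Qed.

(** The likelihood loses a factor [n ^ (- 4)], of which [n] is spent on the prior
    mass near the empirical frequency and another [n] on the constant [k]. *)
Lemma typical_evidence_far w : (size w < L)%N ->
  split_evidence Y x w (far w) <= expR (- (2 * l)) * m w.
Proof.
move=> wL; have [h0 h1 h2 h3] := typical_counts wL.
have [hh0 hh1 hh] := count_near wL.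
have tl := mass_large (ltnW wL).
have c0 := balance_gt0; have c2 := balance_le.
have tE := massE w; have ht0 := mass_child w false; have ht1 := mass_child w true.
have t00 : 0 < t w by rewrite mulr_gt0// node_mass_gt0.
have far_sep r : far w r -> 8 * l <= (N0 w + N1 w)%:R * (324 * (l / t w)) /\
    324 * (l / t w) <= (r - frequency (N0 w) (N1 w)) ^+ 2.
  move=> [_ hr]; apply: (typical_far (c := c) (t0 := t0 w) (t1 := t1 w)) => //.
  rewrite (_ : t0 w / t w = left_share w); last first.
    by rewrite /left_share -mulf_div divff ?mul1r// gt_eqF.
  apply: le_lt_trans hr; rewrite /deviation.
  rewrite -[6 * Num.sqrt _ / _]mulrA sqrt_ratio//; lra.
have Ml : split_evidence Y x w (far w) <=
    max_likelihood (N0 w) (N1 w) * expR (- (4 * l)).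
  have [[r hr]|nofar] := pselect (exists r, far w r).
    apply: (le_trans (split_evidence_far Y (dd := 324 * (l / t w)) h0 h1 (measurable_far w) _)).
      by move=> s hs; split; [case: hs|case: (far_sep _ hs)].
    rewrite ler_wpM2l ?(ltW (max_likelihood_gt0 h0 h1))// ler_expR lerN2.
    by have [? _] := far_sep _ hr; lra.
  rewrite (_ : far w = set0); last first.
    by rewrite -subset0 => r hr; apply: nofar; exists r.
  rewrite /split_evidence integral0_eq; last by move=> om _; rewrite indic0 mul0r.
  by rewrite mulr_ge0 ?expR_ge0// ltW// max_likelihood_gt0.
apply: (le_trans Ml).
apply: (@le_trans _ _ (expR (- (2 * l)) *
   (k * expR (- l) * max_likelihood (N0 w) (N1 w)))); last first.
  by rewrite ler_wpM2l ?expR_ge0// typical_evidence_max.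
have := ltW (max_likelihood_gt0 (R := R) h0 h1).
move: (max_likelihood _ _) => M M0.
rewrite [leLHS]mulrC !mulrA ler_wpM2r//.
have -> : - (4 * l) = - (2 * l) + - l + - l by ring.
rewrite !expRD; rewrite -!mulrA ler_wpM2l ?expR_ge0//.
rewrite [leRHS]mulrC ler_wpM2l ?expR_ge0// expRN -[_^-1]mul1r ler_pdivrMr ?expR_gt0//.
by apply: le_trans k_large; rewrite ler1n.
Qed.

(** * The evidence of the exceptional events *)

Variables (L1 L2 : nat) (C1 A G : R).
Hypotheses (L1L : (L1 <= L)%N) (L1l : L1%:R <= 2 * l).
Hypotheses (G0 : 0 <= G) (GammaE : Gamma = expR G).
Hypothesis imbalance_deep : forall w : node, (L2 <= size w < L)%N ->
  3 * imbalance w + 330 * l <= C1 * l.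
Hypothesis prior_deep : forall i, (L2 <= i)%N ->
  Gamma ^- i <= expR (- ((C1 + 4) * l)).
Hypothesis l_large : 8 <= expR l.

Let expR_large : 8 * expR (- (4 * l)) <= expR (- (2 * l)).
Proof.
have -> : - (4 * l) = - (2 * l) + - l + - l by ring.
rewrite !expRD mulrC -mulrA -mulrA -[leRHS]mulr1 ler_wpM2l ?expR_ge0//.
have h : expR (- l) <= 8^-1 by rewrite expRN lef_pV2 ?posrE ?expR_gt0.
have : expR (- l) * (expR (- l) * 8) <= 8^-1 * (8^-1 * 8).
  by apply: ler_pM; rewrite ?mulr_ge0 ?expR_ge0// ler_pM2r.
lra.
Qed.

Let mset_ge0 w : 0 <= m w. Proof. exact: split_evidence_ge0. Qed.

Lemma deep_split w : (L2 <= size w < L)%N -> p w * m w <= expR (- (4 * l)).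
Proof.
move=> /andP[w2 wL].
have -> : - (4 * l) = - ((C1 + 4) * l) + C1 * l by ring.
rewrite expRD; apply: ler_pM => //; first by case/andP: (split_prob01 w).
  exact: prior_deep.
apply: (le_trans (typical_evidence_le wL)).
by rewrite ler_expR imbalance_deep// w2.
Qed.

Lemma deep_small w : (L2 <= size w < L)%N -> p w * m w <= 8^-1.
Proof.
move=> /deep_split h; apply: (le_trans h).
have e1 : expR (- (2 * l)) <= 1 by rewrite -[leRHS]expR0 ler_expR oppr_le0 mulr_ge0// ltW.
have := expR_large; lra.
Qed.

(** The subtrees of the children have marginals at most 2, and [u] itself may
    remain a leaf with probability at least [1 / 2]. *)
Lemma deep_event (u : node) : (L2 <= size u < L)%N -> (0 < size u)%N ->
  p u * m u * (Z (L - (size u).+1) (rcons u false) *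
               Z (L - (size u).+1) (rcons u true)) <=
  expR (- (2 * l)) * Z (L - size u) u.
Proof.
move=> /andP[u2 uL] u0.
have zb b : Z (L - (size u).+1) (rcons u b) <= 2.
  apply: (marginal_le2 split_prob01 mset_ge0 (L := L) (l := L2)) => //.
  - by move=> w; exact: deep_small.
  - by rewrite size_rcons ltnW.
  - by rewrite size_rcons subnKC.
have zu : 2^-1 <= Z (L - size u) u.
  exact/(marginal_ge_half split_prob01 mset_ge0)/split_prob_half.
have zz : Z (L - (size u).+1) (rcons u false) *
    Z (L - (size u).+1) (rcons u true) <= 2 * 2.
  by apply: ler_pM => //; apply: (marginal_pos split_prob01 mset_ge0).
have pm : 0 <= p u * m u by rewrite mulr_ge0//; case/andP: (split_prob01 u).
have ds : p u * m u <= expR (- (4 * l)) by apply: deep_split; rewrite u2.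
have e1 : p u * m u * (Z (L - (size u).+1) (rcons u false) *
    Z (L - (size u).+1) (rcons u true)) <= expR (- (4 * l)) * (2 * 2).
  by apply: ler_pM => //; rewrite mulr_ge0// (marginal_pos split_prob01 mset_ge0).
have e2 : expR (- (2 * l)) * 2^-1 <= expR (- (2 * l)) * Z (L - size u) u.
  by rewrite ler_wpM2l ?expR_ge0.
have := expR_large; lra.
Qed.

(** The marginals of the children cancel. *)
Lemma far_event (u : node) : (size u < L)%N ->
  p u * split_evidence Y x u (far u) *
    (Z (L - (size u).+1) (rcons u false) * Z (L - (size u).+1) (rcons u true)) <=
  expR (- (2 * l)) * Z (L - size u) u.
Proof.
move=> uL; have p0 : 0 <= p u by case/andP: (split_prob01 u).
have z0 b : 0 <= Z (L - (size u).+1) (rcons u b).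
  exact: (marginal_pos split_prob01 mset_ge0).
apply: (@le_trans _ _ (expR (- (2 * l)) * (p u * m u *
   (Z (L - (size u).+1) (rcons u false) * Z (L - (size u).+1) (rcons u true))))).
  rewrite !mulrA ler_wpM2r// ler_wpM2r// [expR _ * p u]mulrC -mulrA ler_wpM2l//.
  exact: typical_evidence_far.
rewrite ler_wpM2l ?expR_ge0// -[(L - size u)%N](subnSK uL).
exact: (@marginal_ge_split R p m split_prob01 _ u).
Qed.

Hypothesis A_large : 3 * (2 * G + 2) + 2 <= A ^+ 2 / 36.
Hypothesis A_l : 576 <= A ^+ 2 * l.

(** The threshold is of the order of the cost, in log-likelihood, of splitting
    the [O (l)] nodes on a path, each of which costs [O (l)]. *)
Definition significant (w : node) : Prop := A ^+ 2 * l ^+ 2 <= imbalance w.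

Let prior_ge (w : node) : (size w < L1)%N -> expR (- (2 * G * l)) <= p w.
Proof.
move=> wL; rewrite GammaE -expRM_natl -expRN ler_expR lerN2.
have : (size w)%:R <= 2 * l :> R by apply: le_trans L1l; rewrite ler_nat ltnW.
move=> h; have := ler_wpM2r G0 h; lra.
Qed.

Let quarter : expR (- l) <= k / 4.
Proof.
by rewrite expRN -[_^-1]mul1r ler_pdivrMr ?expR_gt0//; have := k_large; lra.
Qed.

Let path_cost (w : node) : (size w < L1)%N ->
  expR (- ((2 * G + 2) * l)) <= p w * m w / 4.
Proof.
move=> wL; have pw := prior_ge wL.
have mw := typical_evidence_ge (leq_trans wL L1L).
have -> : - ((2 * G + 2) * l) = - (2 * G * l) + (- l + - l) by ring.
rewrite !expRD -[leRHS]mulrA; apply: ler_pM => //; rewrite ?mulr_ge0 ?expR_ge0//.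
apply: (@le_trans _ _ (k / 4 * expR (- l))).
  by rewrite ler_wpM2r ?expR_ge0.
by rewrite mulrAC ler_pM2r.
Qed.

(** The trees that split all nodes from [u] to [u ++ v] have a large marginal,
    whereas a leaf at [u] has likelihood one. *)
Lemma significant_event (u v : node) : (size (u ++ v) < L1)%N ->
  significant (u ++ v) -> 1 - p u <= expR (- (2 * l)) * Z (L - size u) u.
Proof.
move=> uvL sig; have uvL' := leq_trans uvL L1L.
pose r := expR (- ((2 * G + 2) * l)).
have r0 : 0 <= r by exact: expR_ge0.
have r4 w : (size w < L1)%N -> r <= p w * m w / 2.
  move=> wL; apply: (le_trans (path_cost wL)).
  have : 0 <= p w * m w by rewrite mulr_ge0//; case/andP: (split_prob01 w).
  lra.
have vL : (size v <= L - size u)%N.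
  have uL : (size u <= L)%N.
    by rewrite (leq_trans _ (ltnW uvL'))// size_cat leq_addr.
  by rewrite leq_subRL// -size_cat; exact: ltnW.
have hpath i : (i < size v)%N -> r <= p (u ++ take i v) * m (u ++ take i v) / 2.
  move=> iv; apply: r4; rewrite size_cat size_takel ?(ltnW iv)//.
  by apply: leq_trans uvL; rewrite size_cat ltnS leq_add2l ltnW.
have path := @marginal_path R p m split_prob01 mset_ge0 r (L - size u) u v r0 vL
  split_prob_half hpath.
apply: (@le_trans _ _ 1); first by rewrite gerBl; case/andP: (split_prob01 u).
rewrite expRN mulrC ler_pdivlMr ?expR_gt0// mul1r; apply: le_trans path.
have uvS : (L - size u - size v = (L - (size (u ++ v)).+1).+1)%N.
  by rewrite subnSK// size_cat subnDA.
have half b : 2^-1 <= Z (L - (size (u ++ v)).+1) (rcons (u ++ v) b).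
  by apply: (marginal_ge_half split_prob01 mset_ge0); apply: split_prob_half; rewrite size_rcons.
have zz : 2^-1 * 2^-1 <= Z (L - (size (u ++ v)).+1) (rcons (u ++ v) false) *
    Z (L - (size (u ++ v)).+1) (rcons (u ++ v) true).
  by apply: ler_pM.
have sig' : 576 * l <= imbalance (u ++ v).
  apply: le_trans sig; rewrite expr2 mulrA ler_wpM2r// ltW//.
have mw := typical_evidence_significant uvL' sig'.
have zuv : r * expR (A ^+ 2 * l ^+ 2 / 36) <= Z (L - size u - size v) (u ++ v).
  rewrite uvS; apply: (le_trans _ (@marginal_ge_split R p m split_prob01 _ (u ++ v))).
  apply: (@le_trans _ _ (p (u ++ v) * m (u ++ v) * (2^-1 * 2^-1))); last first.
    by rewrite ler_wpM2l ?mulr_ge0//; case/andP: (split_prob01 (u ++ v)).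
  apply: (@le_trans _ _ (p (u ++ v) * (k * expR (- l) * expR (imbalance (u ++ v) / 36)) / 4)).
    have q1 : expR (- (2 * G * l)) <= p (u ++ v) by exact: prior_ge.
    have q2 : expR (- l) * expR (- l) <= k / 4 * expR (- l).
      by rewrite ler_wpM2r ?expR_ge0.
    have q3 : expR (A ^+ 2 * l ^+ 2 / 36) <= expR (imbalance (u ++ v) / 36).
      by rewrite ler_expR ler_pM2r.
    rewrite /r (_ : - ((2 * G + 2) * l) = - (2 * G * l) + (- l + - l)); last by ring.
    rewrite !expRD (_ : _ / 4 = p (u ++ v) * (k / 4 * expR (- l)) *
      expR (imbalance (u ++ v) / 36)); last by move: (Gamma ^- _) => pw; field.
    apply: ler_pM; [by rewrite !mulr_ge0 ?expR_ge0|exact: expR_ge0| |exact: q3].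
    by apply: ler_pM => //; rewrite ?mulr_ge0 ?expR_ge0.
  have pu : 0 <= p (u ++ v) by case/andP: (split_prob01 (u ++ v)).
  have := ler_wpM2l pu mw; lra.
apply: (@le_trans _ _ (r ^+ size v * (r * expR (A ^+ 2 * l ^+ 2 / 36)))); last first.
  by rewrite ler_wpM2l// exprn_ge0.
rewrite mulrA -exprSr /r -expRM_natl -expRD ler_expR.
have sv : (size v).+1%:R <= 2 * l.
  apply: le_trans L1l; rewrite ler_nat; apply: leq_trans uvL.
  by rewrite size_cat ltnS leq_addl.
have g0 : 0 <= (2 * G + 2) * l by rewrite mulr_ge0 ?(ltW l0)//; have := G0; lra.
have h1 := ler_wpM2r g0 sv.
have l2 : l <= l ^+ 2 by rewrite expr2 ler_peMl ?(ltW l0).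
have h2 : (3 * (2 * G + 2) + 2) * l ^+ 2 <= A ^+ 2 / 36 * l ^+ 2.
  by rewrite ler_wpM2r ?exprn_even_ge0.
have h3 : 0 <= (2 * G + 2) * l ^+ 2 by rewrite mulr_ge0 ?exprn_even_ge0//; have := G0; lra.
have e1 : (size v).+1%:R * - ((2 * G + 2) * l) = - ((size v).+1%:R * ((2 * G + 2) * l)).
  by rewrite mulrN.
have e2 : 2 * l * ((2 * G + 2) * l) = 2 * ((2 * G + 2) * l ^+ 2) by ring.
have e3 : (3 * (2 * G + 2) + 2) * l ^+ 2 = 3 * ((2 * G + 2) * l ^+ 2) + 2 * l ^+ 2 by ring.
have e4 : A ^+ 2 / 36 * l ^+ 2 = A ^+ 2 * l ^+ 2 / 36 by field.
rewrite e1; rewrite e2 in h1; rewrite e3 e4 in h2; lra.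
Qed.

(** * Approximation of the density by the histogram *)

Variable eps : R.
Hypotheses (eps0 : 0 < eps) (A0 : 0 <= A).
Hypothesis bias_scale : ((2 ^+ L1)^-1) `^ alpha <= eps.
Hypothesis signal_scale : l ^+ 2 * 2 ^+ L1 / n%:R <= 2 * eps ^+ 2.
Hypothesis noise_scale : l * 2 ^+ L2 / n%:R <= 2 * eps ^+ 2.

(* Here 108 is 36, the constant of the deviations, times 3, that of the
   geometric sum. *)
Definition noise_constant : R := 108 * Num.sqrt (2 / mu) / c.
Definition bias_constant : R := 3 * A * Num.sqrt (2 * (1 + K)) + K.
Definition total_constant : R := 2 * (1 + K) * noise_constant + bias_constant.

Hypothesis eps_small : noise_constant * eps <= 2^-1.

Let K1 : 0 < 1 + K. Proof. by rewrite ltr_pwDl. Qed.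

Definition height (z : R) (j : nat) : R := 2 ^+ j * pi (address z j).

Definition share (z : R) (j : nat) : R := pi (address z j.+1) / pi (address z j).

Lemma heightE (z : R) j : height z j = \prod_(i < j) (2 * share z i).
Proof.
elim: j => [|j IH].
  by rewrite big_ord0 /height /= expr0 mul1r (node_mass_nil hf0 hP0).
rewrite big_ord_recr -IH /height /share /= exprS; field.
by rewrite gt_eqF// node_mass_gt0.
Qed.

Lemma height_bounds (z : R) j : mu <= height z j <= 1 + K.
Proof.
have := node_mass_bounds alpha0 K0 mu0 hf0 hP0 (address z j).
by rewrite size_address.
Qed.

Lemma share_ge (z : R) j : c <= share z j.
Proof. by rewrite ler_pdivlMr ?node_mass_gt0//=; exact: node_mass_child. Qed.

Lemma deviation_le (z : R) i : deviation (address z i) <=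
  36 * Num.sqrt (l / (n%:R * mu)) * Num.sqrt 2 ^+ i.
Proof.
rewrite /deviation -mulrA ler_wpM2l// -sqrt2X -sqrtrM; last first.
  by rewrite divr_ge0 ?(ltW l0)// mulr_ge0// ltW.
have /andP[h _] := height_bounds z i.
have p0 := node_mass_gt0 (address z i).
rewrite ler_wsqrtr// ler_pdivrMr ?mulr_gt0//.
have -> : l / (n%:R * mu) * 2 ^+ i * (n%:R * pi (address z i)) =
    l * (height z i / mu) by rewrite /height; field; rewrite !gt_eqF.
by rewrite ler_peMr ?(ltW l0)// ler_pdivlMr// mul1r.
Qed.

(** A geometric sum, of the order of its last term. *)
Lemma noise_sum (z : R) j : (j <= L2)%N ->
  \sum_(i < j) deviation (address z i) / c <= noise_constant * eps.
Proof.
move=> jL; rewrite -mulr_suml /noise_constant mulrAC.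
rewrite ler_pM2r ?invr_gt0 ?balance_gt0//.
apply: (@le_trans _ _ (\sum_(i < j) 36 * Num.sqrt (l / (n%:R * mu)) * Num.sqrt 2 ^+ i)).
  by apply: ler_sum => i _; exact: deviation_le.
rewrite -mulr_sumr.
apply: (@le_trans _ _ (36 * Num.sqrt (l / (n%:R * mu)) * (3 * Num.sqrt 2 ^+ L2))).
  rewrite ler_wpM2l// ?mulr_ge0 ?sqrtr_ge0//; apply: (le_trans (sum_sqrt2 _)).
  by rewrite ler_pM2l// ler_weXn2l// sqrt2_ge1.
have -> : 36 * Num.sqrt (l / (n%:R * mu)) * (3 * Num.sqrt 2 ^+ L2) =
  108 * (Num.sqrt (l / (n%:R * mu)) * Num.sqrt 2 ^+ L2) by ring.
rewrite -mulrA ler_pM2l// -sqrt2X -sqrtrM; last first.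
  by rewrite divr_ge0 ?(ltW l0)// mulr_ge0// ltW.
rewrite -[eps in leRHS]gtr0_norm// -sqrtr_sqr -sqrtrM ?divr_ge0 ?(ltW mu0)//.
rewrite ler_wsqrtr//.
have -> : l / (n%:R * mu) * 2 ^+ L2 = l * 2 ^+ L2 / n%:R / mu.
  by field; rewrite !gt_eqF.
by rewrite [leRHS]mulrAC ler_pM2r ?invr_gt0.
Qed.

Lemma histogram_height (y : nat -> R) (z : R) j : (j <= L2)%N ->
  (forall i, (i < j)%N -> 0 <= y i /\ `|y i - share z i| <= deviation (address z i)) ->
  `|\prod_(i < j) (2 * y i) - height z j| <= 2 * (1 + K) * noise_constant * eps.
Proof.
move=> jL hy; have c0 := balance_gt0.
have dev0 i : 0 <= deviation (address z i).
  by rewrite /deviation mulr_ge0 ?sqrtr_ge0.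
have h : `|\prod_(i < j) (2 * y i) - \prod_(i < j) (2 * share z i)| <=
    \prod_(i < j) (2 * share z i) *
      (expR (\sum_(i < j) deviation (address z i) / c) - 1).
  apply: prod_perturbation => i.
  - by rewrite mulr_ge0//; have [] := hy i (ltn_ord i).
  - by rewrite mulr_ge0// (le_trans (ltW c0))// share_ge.
  - by rewrite divr_ge0 ?(ltW c0).
  - have [_ hi] := hy i (ltn_ord i).
    rewrite -mulrBr normrM ger0_norm// mulrCA ler_pM2l//.
    apply: (le_trans hi); rewrite mulrAC -mulrA ler_peMr//.
    by rewrite ler_pdivlMr// mul1r share_ge.
rewrite heightE; apply: (le_trans h); rewrite -heightE.
have /andP[hm hM] := height_bounds z j.
have sn := noise_sum z jL.
have s0 : 0 <= \sum_(i < j) deviation (address z i) / c.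
  by apply: sumr_ge0 => i _; rewrite divr_ge0 ?(ltW c0).
have e2 : expR (\sum_(i < j) deviation (address z i) / c) - 1 <=
    2 * (noise_constant * eps).
  move: s0 sn; move: (\sum_(i < j) _) => s s0 sn.
  have s2 : s <= 2^-1 by exact: le_trans eps_small.
  have := @expR_le_quadratic R s; rewrite ger0_norm// => /(_ s2).
  have : s ^+ 2 <= s * 2^-1 by rewrite expr2 ler_wpM2l.
  lra.
have -> : 2 * (1 + K) * noise_constant * eps = (1 + K) * (2 * (noise_constant * eps)) by ring.
apply: ler_pM => //; first by apply: le_trans hm; exact: ltW.
by rewrite subr_ge0 -expR0 ler_expR.
Qed.

(** The squared increment is the imbalance times [2 ^ j * height z j / n]. *)
Lemma insignificant_step (z : R) j : ~ significant (address z j) ->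
  `|height z j.+1 - height z j| <=
  A * l * Num.sqrt ((1 + K) / n%:R) * Num.sqrt 2 ^+ j.
Proof.
move=> /negP; rewrite -ltNge /imbalance => ns.
have p0 := node_mass_gt0 (address z j).
have /andP[_ hM] := height_bounds z j.
set p0' := pi (rcons (address z j) false) in ns *.
set p1' := pi (rcons (address z j) true) in ns *.
have e : `|height z j.+1 - height z j| = `|2 ^+ j * (p0' - p1')|.
  rewrite /height /= (node_mass_rcons P0 (address z j)) -/p0' -/p1' exprS.
  case: (_ <= z).
    by rewrite -/p1' -normrN; congr `|_|; ring.
  by rewrite -/p0'; congr `|_|; ring.
rewrite e.
have r0 : 0 <= A * l * Num.sqrt ((1 + K) / n%:R) * Num.sqrt 2 ^+ j.
  by rewrite !mulr_ge0 ?exprn_ge0 ?sqrtr_ge0// ltW.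
rewrite -(@ler_pXn2r _ 2)// ?nnegrE// real_normK ?num_real//.
have -> : (A * l * Num.sqrt ((1 + K) / n%:R) * Num.sqrt 2 ^+ j) ^+ 2 =
    (A * l) ^+ 2 * ((1 + K) / n%:R) * 2 ^+ j.
  rewrite [LHS]exprMn [X in X * _ = _]exprMn sqr_sqrtr; last first.
    by rewrite divr_ge0// ltW.
  by congr (_ * _); rewrite -exprM mulnC exprM sqr_sqrtr.
have t00 : 0 < n%:R * pi (address z j) by rewrite mulr_gt0.
move: ns; rewrite ltr_pdivrMr// -mulrBr exprMn => ns.
have h2 : (n%:R * 2 ^+ j) ^+ 2 * (p0' - p1') ^+ 2 <=
    n%:R ^+ 2 * ((A * l) ^+ 2 * ((1 + K) / n%:R) * 2 ^+ j).
  have -> : n%:R ^+ 2 * ((A * l) ^+ 2 * ((1 + K) / n%:R) * 2 ^+ j) =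
     A ^+ 2 * l ^+ 2 * (1 + K) * n%:R * 2 ^+ j by field; rewrite gt_eqF.
  have -> : (n%:R * 2 ^+ j) ^+ 2 * (p0' - p1') ^+ 2 =
     2 ^+ j ^+ 2 * (n%:R ^+ 2 * (p0' - p1') ^+ 2) by ring.
  apply: (@le_trans _ _ (2 ^+ j ^+ 2 * (A ^+ 2 * l ^+ 2 * (n%:R * pi (address z j))))).
    by rewrite ler_wpM2l ?exprn_even_ge0// ltW.
  have -> : 2 ^+ j ^+ 2 * (A ^+ 2 * l ^+ 2 * (n%:R * pi (address z j))) =
    A ^+ 2 * l ^+ 2 * n%:R * 2 ^+ j * height z j by rewrite /height; ring.
  have -> : A ^+ 2 * l ^+ 2 * (1 + K) * n%:R * 2 ^+ j =
    A ^+ 2 * l ^+ 2 * n%:R * 2 ^+ j * (1 + K) by ring.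
  by rewrite ler_wpM2l// !mulr_ge0 ?exprn_ge0 ?(ltW l0).
rewrite -(@ler_pM2l _ (n%:R ^+ 2)) ?exprn_gt0//; apply: le_trans h2.
by rewrite le_eqVlt; apply/orP; left; apply/eqP; ring.
Qed.

(** The heights are compared along the digits of [z], down to the level [L1] at
    which the Hoelder condition suffices. *)
Lemma height_bias (z : R) j : z \in `[0, 1[ ->
  (forall i, (j <= i < L1)%N -> ~ significant (address z i)) ->
  `|height z j - f0 z| <= bias_constant * eps.
Proof.
move=> z01 ns; pose M := maxn j L1.
have hM : `|height z M - f0 z| <= K * eps.
  have := node_mass_dev alpha0 K0 mu0 hf0 hP0 (address_interval M z01).
  rewrite size_address => h; apply: (le_trans h); rewrite ler_wpM2l//.
  apply: le_trans bias_scale.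
  apply: ge0_ler_powR; rewrite ?nnegrE ?(ltW alpha0) ?invr_ge0 ?exprn_ge0//.
  by rewrite lef_pV2 ?posrE ?exprn_gt0// ler_weXn2l ?ler1n// leq_maxr.
have tel : `|height z M - height z j| <=
    \sum_(j <= i < M) A * l * Num.sqrt ((1 + K) / n%:R) * Num.sqrt 2 ^+ i.
  rewrite -telescope_sumr ?leq_maxl//.
  apply: (le_trans (ler_norm_sum _ _ _)).
  rewrite big_nat_cond [leRHS]big_nat_cond; apply: ler_sum => i /andP[/andP[ji iM] _].
  apply: insignificant_step; apply: ns; rewrite ji.
  by move: iM; rewrite /M leq_max ltnNge ji.
have tot : \sum_(j <= i < M) A * l * Num.sqrt ((1 + K) / n%:R) * Num.sqrt 2 ^+ i <=
    3 * A * Num.sqrt (2 * (1 + K)) * eps.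
  have pos i : 0 <= A * l * Num.sqrt ((1 + K) / n%:R) * Num.sqrt 2 ^+ i.
    by rewrite !mulr_ge0 ?exprn_ge0 ?sqrtr_ge0// ltW.
  have [jL1|L1j] := leqP j L1; last first.
    rewrite /M (maxn_idPl (ltnW L1j)) big_geq// !mulr_ge0 ?sqrtr_ge0// ltW//.
  rewrite /M (maxn_idPr jL1).
  apply: (@le_trans _ _ (\sum_(i < L1) A * l * Num.sqrt ((1 + K) / n%:R) * Num.sqrt 2 ^+ i)).
    rewrite -(big_mkord xpredT (fun i => A * l * Num.sqrt ((1 + K) / n%:R) * Num.sqrt 2 ^+ i)).
    by rewrite (big_cat_nat (leq0n j) jL1)/= lerDr sumr_ge0.
  rewrite -mulr_sumr.
  apply: (@le_trans _ _ (A * l * Num.sqrt ((1 + K) / n%:R) * (3 * Num.sqrt 2 ^+ L1))).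
    by rewrite ler_wpM2l ?sum_sqrt2// !mulr_ge0 ?sqrtr_ge0// ltW.
  have -> : A * l * Num.sqrt ((1 + K) / n%:R) * (3 * Num.sqrt 2 ^+ L1) =
    3 * A * (l * (Num.sqrt ((1 + K) / n%:R) * Num.sqrt 2 ^+ L1)) by ring.
  rewrite -[leRHS]mulrA ler_wpM2l ?mulr_ge0//.
  rewrite -sqrt2X -sqrtrM ?divr_ge0 ?(ltW K1)//.
  rewrite -[X in X * Num.sqrt _ <= _]gtr0_norm// -sqrtr_sqr -sqrtrM ?exprn_even_ge0//.
  rewrite -[eps in leRHS]gtr0_norm// -sqrtr_sqr -sqrtrM ?mulr_ge0 ?(ltW K1)//.
  rewrite ler_wsqrtr//.
  have -> : l ^+ 2 * ((1 + K) / n%:R * 2 ^+ L1) = (1 + K) * (l ^+ 2 * 2 ^+ L1 / n%:R).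
    by field; rewrite gt_eqF.
  have -> : 2 * (1 + K) * eps ^+ 2 = (1 + K) * (2 * eps ^+ 2) by ring.
  by rewrite ler_pM2l.
have : `|height z j - f0 z| <= `|height z M - height z j| + `|height z M - f0 z|.
  have -> : height z j - f0 z = - (height z M - height z j) + (height z M - f0 z) by ring.
  by rewrite -[X in _ <= X + _]normrN; exact: ler_normD.
rewrite /bias_constant mulrDl; lra.
Qed.

(** * The posterior on typical data *)

Hypotheses (L2_gt0 : (0 < L2)%N) (L1n : (2 ^ L1 <= n)%N) (L2n : (2 ^ L2 <= n)%N).

Definition deep_events : seq (node_event (R := R)) :=
  [seq (u, true, setT) | u <- words L2 & (size u < L)%N].
Definition significant_events : seq (node_event (R := R)) :=
  [seq (u, false, setT) | u <- words_below L1 &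
     `[< exists v : node, (size (u ++ v) < L1)%N /\ significant (u ++ v) >]].
Definition far_events : seq (node_event (R := R)) :=
  [seq (u, true, far u) | u <- words_below L2 & (size u < L)%N].
Definition exceptional_events := deep_events ++ significant_events ++ far_events.

Lemma size_exceptional_events : (size exceptional_events <= 3 * n)%N.
Proof.
rewrite !size_cat !size_map; have h1 := size_words_below L1.
have h2 := size_words_below L2; have h3 := size_words L2.
have hf T (q : pred T) (r : seq T) : (size (seq.filter q r) <= size r)%N.
  by rewrite size_filter count_size.
have f1 := hf _ (fun u : node => (size u < L)%N) (words L2).
have f2 := hf _ (fun u : node => `[< exists v : node,
  (size (u ++ v) < L1)%N /\ significant (u ++ v) >]) (words_below L1).
have f3 := hf _ (fun u : node => (size u < L)%N) (words_below L2).
rewrite h3 in f1.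
apply: (@leq_trans (n + (n + n)))%N; last by rewrite !mulSn mul0n addn0.
apply: leq_add; first exact: leq_trans f1 L2n.
apply: leq_add; first exact: leq_trans f2 (leq_trans h1 L1n).
exact: leq_trans f3 (leq_trans h2 L2n).
Qed.

Lemma exceptional_events_evidence e : e \in exceptional_events ->
  [/\ (size e.1.1 < L)%N, measurable e.2 &
    event_evidence p Y L x e <= expR (- (2 * l)) * Z (L - size e.1.1) e.1.1].
Proof.
rewrite !mem_cat => /or3P[] /mapP[u]; rewrite mem_filter.
- move=> /andP[uL]; rewrite mem_words => /eqP uL2 -> /=; split=> //.
  by apply: deep_event; [rewrite uL andbT uL2|rewrite uL2].
- move=> /andP[/asboolP[v [uv sig]] uL1] -> /=.
  rewrite mem_words_below in uL1.
  split=> //; first exact: leq_trans uL1 L1L.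
  exact: significant_event uv sig.
- move=> /andP[uL _] -> /=; split=> //; first exact: measurable_far.
  exact: far_event.
Qed.

(** If no exceptional event holds, the leaf of each point has level at most
    [L2], the proportions on the path to it are close to the true shares, and
    there is no significant node below it. *)
Lemma exceptional_events_cover (r : R) om : total_constant * eps <= r ->
  (forall w, 0 <= Y (rcons w false) om <= 1) ->
  (r%:E < sup_dist (opt_density L S Y om) f0)%E ->
  exists2 e, e \in exceptional_events & event_holds S Y e om.
Proof.
move=> hr U01 hd; apply: contrapT => none.
have {}none e : e \in exceptional_events -> ~ event_holds S Y e om.
  by move=> he h; apply: none; exists e.
move: hd; apply/negP; rewrite -leNgt; apply: ge_ereal_sup => _ [z z01 <-].
have {}z01 : z \in `[0, 1[ by [].
rewrite lee_fin; apply: le_trans hr.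
rewrite /opt_density.
have [j lj] := leaf_level_exists (fun w => S w om) L z.
rewrite (tree_densityE _ z01 lj); have [jL sj lastj] := lj.
have reach i : (i <= j)%N -> reached (fun w => S w om) [::] (address z i).
  move=> ij i'; rewrite size_address => ii' /=.
  by rewrite take_address ?(ltnW ii')//; apply: sj; exact: leq_trans ii' ij.
have jL2 : (j <= L2)%N.
  rewrite leqNgt; apply/negP => hj.
  apply: (none (address z L2, true, setT)).
    rewrite !mem_cat; apply/or3P; constructor 1; apply/mapP; exists (address z L2) => //.
    by rewrite mem_filter mem_words size_address eqxx (leq_trans hj jL).
  by split=> //; [exact/reach/ltnW|exact: sj].
have hy i : (i < j)%N -> 0 <= Y (address z i.+1) om /\
    `|Y (address z i.+1) om - share z i| <= deviation (address z i).
  move=> ij; have /andP[u0 u1] := U01 (address z i).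
  have nfar : ~ far (address z i) (Y (rcons (address z i) false) om).
    move=> hfar; apply: (none (address z i, true, far (address z i))).
      rewrite !mem_cat; apply/or3P; constructor 3; apply/mapP; exists (address z i) => //.
      rewrite mem_filter mem_words_below size_address.
      by rewrite (leq_trans ij jL) (leq_trans ij jL2).
    by split=> //; [exact/reach/ltnW|exact: sj].
  have nd : `|Y (rcons (address z i) false) om - left_share (address z i)| <=
      deviation (address z i).
    rewrite leNgt; apply/negP => hdev; apply: nfar; split=> //.
  rewrite /share /=; case: (_ <= z) => //.
  rewrite (opt_sibling optSY) subr_ge0; split=> //.
  have -> : pi (rcons (address z i) true) / pi (address z i) =
      1 - left_share (address z i).
    rewrite /left_share (node_mass_rcons P0 (address z i)); field.
    by rewrite -node_mass_rcons// gt_eqF// node_mass_gt0.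
  by rewrite opprB addrC subrKA distrC.
have h1 := @histogram_height (fun i => Y (address z i.+1) om) z j jL2 hy.
have ns i : (j <= i < L1)%N -> ~ significant (address z i).
  move=> /andP[ji iL1] sig.
  have jL1 : (j < L1)%N by exact: leq_ltn_trans iL1.
  apply: (none (address z j, false, setT)).
    rewrite !mem_cat; apply/or3P; constructor 2; apply/mapP; exists (address z j) => //.
    rewrite mem_filter mem_words_below size_address jL1 andbT; apply/asboolP.
    exists (drop j (address z i)).
    have -> : address z j ++ drop j (address z i) = address z i.
      by rewrite -(take_address z ji) cat_take_drop.
    by rewrite size_address.
  split=> //; first exact: reach.
  move: lastj; rewrite (ltn_eqF (leq_trans jL1 L1L)) /= => /negbTE.
  by [].
have h2 := height_bias z01 ns.
have := ler_normD (\prod_(i < j) (2 * Y (address z i.+1) om) - height z j)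
  (height z j - f0 z).
rewrite addrA subrK /total_constant mulrDl; lra.
Qed.

(** There are at most [3 n] exceptional events, each of posterior probability at
    most [n ^ (- 2)]. *)
Lemma posterior_typical (r : R) : total_constant * eps <= r ->
  (posterior P (opt_density L S Y) x
     [set f | (r%:E < sup_dist f f0)%E] <= (3 * expR (- l))%:E)%E.
Proof.
move=> hr; have [hx01 _] := hx.
have := posterior_node_events optSY split_prob01 hx01 (expR_ge0 (- (2 * l)))
  exceptional_events_evidence (B := [set f | (r%:E < sup_dist f f0)%E])
  (fun om U01 hB => exceptional_events_cover hr U01 hB).
move/le_trans; apply; rewrite lee_fin.
have h : (size exceptional_events)%:R <= 3 * n%:R :> R.
  by rewrite -natrM ler_nat size_exceptional_events.
apply: (le_trans (ler_wpM2r (expR_ge0 _) h)).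
rewrite hn -mulrA -expRD ler_pM2l// ler_expR.
lra.
Qed.

End posterior_on_typical_data.

(** * Resolution levels *)

Section levels.
Context {R : realType}.

Lemma expR_half_le2 : expR 2^-1 <= 2 :> R.
Proof.
have := @expR_le_quadratic R 2^-1; rewrite ger0_norm// lexx => /(_ isT).
have -> : 1 + 2^-1 + 2 * 2^-1 ^+ 2 = 2 :> R by field.
by [].
Qed.

Lemma ln2_ge_half : 2^-1 <= ln 2 :> R.
Proof. by rewrite -[leLHS]expRK ler_ln ?posrE ?expR_gt0// expR_half_le2. Qed.

Lemma ln2_le1 : ln 2 <= 1 :> R.
Proof.
rewrite -[leRHS]expRK ler_ln ?posrE ?expR_gt0//.
by have := expR_ge1Dx (1 : R); lra.
Qed.

Lemma expr2_expR (i : nat) : 2 ^+ i = expR (i%:R * ln 2) :> R.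
Proof. by rewrite expRM_natl lnK// posrE. Qed.

Lemma dyadic_level (y : R) : 0 <= y ->
  exists2 L : nat, (0 < L)%N & y <= L%:R * ln 2 <= y + ln 2.
Proof.
move=> y0; have l2 := ln2_ge_half.
have l20 : 0 < ln 2 :> R by lra.
have q0 : 0 <= y / ln 2 by rewrite divr_ge0// ltW.
have /andP[h1 h2] := truncn_itv q0.
exists (Num.truncn (y / ln 2)).+1 => //.
rewrite -ler_pdivrMr// ltW//= -natr1 mulrDl mul1r lerD2r.
by rewrite -ler_pdivlMr.
Qed.

Lemma powR_expR (x y : R) : expR x `^ y = expR (y * x).
Proof. by rewrite /powR gt_eqF ?expR_gt0// expRK. Qed.

Lemma rateE (alpha l : R) (n : nat) : 0 < l -> n%:R = expR l ->
  rate alpha n = expR (- (alpha / (1 + 2 * alpha) * (l - 2 * ln l))).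
Proof.
move=> l0 hn; rewrite /rate hn expRK.
have -> : l ^+ 2 / expR l = expR (- (l - 2 * ln l)).
  rewrite opprB expRD expRN; congr (_ / _).
  by rewrite expRM_natl lnK// posrE.
by rewrite powR_expR mulrN.
Qed.

(** From [expR l >= (l / 3) ^ 3]. *)
Lemma ln_growth (l Lam : R) : 27 * expR Lam <= l -> 0 < l -> Lam <= l - 2 * ln l.
Proof.
move=> h l0; rewrite -ler_expR expRD expRN expRM_natl lnK ?posrE//.
rewrite ler_pdivlMr ?exprn_gt0//.
have e3 : expR l = expR (l / 3) ^+ 3.
  by rewrite -expRM_natl; congr expR; field.
have h3 : (l / 3) ^+ 3 <= expR l.
  rewrite e3; apply: lerXn2r; rewrite ?nnegrE ?expR_ge0 ?divr_ge0 ?(ltW l0)//.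
  by have := expR_ge1Dx (l / 3); lra.
apply: le_trans h3.
have -> : (l / 3) ^+ 3 = l / 27 * l ^+ 2 by field.
by rewrite ler_wpM2r ?exprn_ge0 ?(ltW l0)// ler_pdivlMr// mulrC.
Qed.

Lemma Lmax_itv (n : nat) (l : R) : 0 < l -> n%:R = expR l -> 0 <= l - 2 * ln l ->
  2 ^+ Lmax R n * l ^+ 2 <= n%:R /\ l - 2 * ln l < (Lmax R n).+1%:R * ln 2.
Proof.
move=> l0 hn lam0; have l20 : 0 < ln 2 :> R by have := ln2_ge_half; lra.
have e : ln (n%:R / ln (n%:R : R) ^+ 2) = l - 2 * ln l.
  rewrite hn expRK ln_div ?posrE ?expR_gt0 ?exprn_gt0// expRK lnXn//.
  by rewrite mulr_natl.
rewrite /Lmax e.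
have q0 : 0 <= (l - 2 * ln l) / ln 2 by rewrite divr_ge0// ltW.
have /andP[h1 h2] := truncn_itv q0; split; last by rewrite -ltr_pdivrMr.
rewrite expr2_expR hn -[X in X ^+ 2](@lnK _ l)// -expRM_natl -expRD ler_expR.
by rewrite ler_pdivlMr// in h1; lra.
Qed.

(** The first level balances the bias with the increments of order
    [l * sqrt (2 ^ j / n)] that may remain undetected, the second one with the
    noise of order [sqrt (l * 2 ^ j / n)].  In logarithms, the rate is
    [- alpha * th * (l - 2 * ln l)] with [th = 1 / (1 + 2 * alpha)], and the
    levels times [ln 2] are [th * (l - 2 * ln l)] and [th * (l - ln l)], up to
    rounding. *)
Lemma levels_exist (alpha Lam l : R) (n : nat) : 0 < alpha -> alpha <= 1 ->
  3 / alpha <= Lam -> 27 * expR Lam <= l -> n%:R = expR l ->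
  exists L1 L2 : nat,
  [/\ (L1 <= Lmax R n)%N, L1%:R <= 2 * l, (0 < L2)%N,
      (2 ^ L1 <= n)%N & (2 ^ L2 <= n)%N] /\
  [/\ ((2 ^+ L1)^-1) `^ alpha <= rate alpha n,
      l ^+ 2 * 2 ^+ L1 / n%:R <= 2 * rate alpha n ^+ 2,
      l * 2 ^+ L2 / n%:R <= 2 * rate alpha n ^+ 2,
      l <= 6 * L2%:R &
      forall i, (L2 <= i)%N ->
        n%:R * (2 ^+ i)^-1 * (((2 ^+ i)^-1) `^ alpha) ^+ 2 <= l].
Proof.
move=> a0 a1 hLam hl hn.
have Lam0 : 0 < Lam by apply: lt_le_trans hLam; rewrite divr_gt0.
have l1 : 1 <= l.
  by apply: le_trans hl; have := expR_ge1Dx Lam; lra.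
have l0 : 0 < l by lra.
have lam := ln_growth hl l0.
have q0 : 0 <= ln l by rewrite ln_ge0.
pose th := (1 + 2 * alpha)^-1.
have a2 : 0 < 1 + 2 * alpha by lra.
have th0 : 0 < th by rewrite invr_gt0.
have th3 : 3^-1 <= th by rewrite lef_pV2 ?posrE//; lra.
have th1 : th * (1 + 2 * alpha) = 1 by rewrite mulVf// gt_eqF.
have th2 : 1 - th = 2 * alpha * th by rewrite -[1 in LHS]th1; ring.
set lm := l - 2 * ln l in lam *.
have lam0 : 0 < lm by exact: lt_le_trans lam.
have big : 1 <= (1 - th) * lm.
  have alm : 3 <= alpha * lm.
    by rewrite mulrC -ler_pdivrMr//; exact: le_trans lam.
  have : 3 * th <= alpha * lm * th by rewrite ler_wpM2r// ltW.
  rewrite th2; lra.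
have [L1 L10 /andP[h1 h1']] := dyadic_level (ltW (mulr_gt0 th0 lam0)).
have lm20 : 0 < l - ln l by rewrite /lm in lam0; lra.
have [L2 L20 /andP[h2 h2']] := dyadic_level (ltW (mulr_gt0 th0 lm20)).
have big2 : (1 - th) * lm <= (1 - th) * (l - ln l).
  by rewrite ler_wpM2l ?th2 ?mulr_ge0 ?(ltW th0) ?(ltW a0)// /lm; lra.
have l21 := ln2_le1; have l22 := ln2_ge_half.
have epsE : rate alpha n = expR (- (alpha * th * lm)) by rewrite (rateE _ l0 hn).
have eps2 : 2 * rate alpha n ^+ 2 = expR (ln 2 - (1 - th) * lm).
  rewrite epsE -expRM_natl expRD lnK ?posrE//; congr (_ * expR _).
  by rewrite th2; ring.
have lE : l = expR (ln l) by rewrite lnK.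
have n1 : L1%:R * ln 2 <= l by rewrite /lm in h1' big *; lra.
have n2 : L2%:R * ln 2 <= l by rewrite /lm in h1' big big2 *; lra.
exists L1, L2; split; split=> //.
- have [_ hL] := Lmax_itv l0 hn (ltW lam0).
  rewrite leqNgt; apply/negP => hlt.
  have : (Lmax R n).+1%:R * ln 2 <= L1%:R * ln 2 :> R by rewrite ler_wpM2r ?ler_nat//; lra.
  rewrite -/lm in hL; lra.
- have : L1%:R * 2^-1 <= L1%:R * ln 2 :> R by rewrite ler_wpM2l.
  lra.
- by rewrite -(ler_nat R) natrX expr2_expR hn ler_expR.
- by rewrite -(ler_nat R) natrX expr2_expR hn ler_expR.
- rewrite epsE expr2_expR -expRN powR_expR ler_expR mulrN lerN2 -mulrA.
  by rewrite ler_wpM2l// ltW.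
- rewrite eps2 hn {1}lE expr2_expR -expRM_natl -expRN -!expRD ler_expR.
  rewrite /lm in h1' *; lra.
- rewrite eps2 hn {1}lE expr2_expR -expRN -!expRD ler_expR; lra.
- have : L2%:R * ln 2 <= L2%:R * 1 :> R by rewrite ler_wpM2l.
  have : 3^-1 * (l - ln l) <= th * (l - ln l) by rewrite ler_wpM2r// ltW.
  rewrite /lm in lam0; lra.
- move=> i iL; rewrite hn expr2_expR -expRN powR_expR -expRM_natl -!expRD {2}lE ler_expR.
  have hi : L2%:R * ln 2 <= i%:R * ln 2 :> R by rewrite ler_wpM2r ?ler_nat//; lra.
  have : th * (l - ln l) * (1 + 2 * alpha) <= i%:R * ln 2 * (1 + 2 * alpha).
    by rewrite ler_wpM2r ?(ltW a2)//; lra.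
  rewrite mulrAC th1 mul1r; lra.
Qed.

Lemma expR4_le (s : R) : 0 <= s -> expR (- (4 * s)) <= expR (- s) * expR (- s).
Proof. by move=> s0; rewrite -expRD ler_expR; lra. Qed.

Lemma inv_le_harmonic (n : nat) : (0 < n)%N -> 7 / n%:R <= 14 * harmonic n :> R.
Proof.
move=> n0; rewrite /harmonic ler_pdivrMr ?ltr0n// mulrAC ler_pdivlMr ?ltr0n//.
have : 1 <= n%:R :> R by rewrite ler1n.
rewrite -natr1; lra.
Qed.

End levels.

(** * The expected posterior probability *)

Section expected_posterior.
Context {R : realType} (P0 : probability R R).

(** The function need not be measurable, as only an upper bound is wanted. *)
Lemma integral_le_on_large_event (n : nat) (f : n.-tuple R -> \bar R)
    (A : set (n.-tuple R)) (delta eta : R) :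
  measurable A -> 0 <= delta -> (forall x, 0 <= f x <= 1)%E ->
  (forall x, ~ A x -> (f x <= delta%:E)%E) ->
  (product_prob P0 n A <= eta%:E)%E ->
  (\int[product_prob P0 n]_x f x <= (delta + eta)%:E)%E.
Proof.
move=> mA d0 f01 fd PA.
apply: (@le_trans _ _ (\int[product_prob P0 n]_x (delta%:E + (\1_A x)%:E))%E).
  apply: le_integral_ge0 => x _; first by case/andP: (f01 x).
  rewrite indicE; case: (boolP (x \in A)) => [_|xA] /=.
    have /andP[_ h] := f01 x; apply: (le_trans h).
    by rewrite -EFinD lee_fin; lra.
  by rewrite adde0; apply: fd => /mem_set; rewrite (negbTE xA).
have m1 : measurable_fun setT (fun x : n.-tuple R => (\1_A x)%:E : \bar R).
  by apply/measurable_EFinP; exact: measurable_indic.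
rewrite ge0_integralD//.
rewrite integral_cst//= integral_indic// setIT probability_setT mule1 EFinD.
by rewrite leeD2l.
Qed.

End expected_posterior.

(** * Posterior contraction for a large sample *)

Section large_sample.
Context {R : realType} (alpha K mu : R) (f0 : R -> R) (P0 : probability R R).
Hypotheses (alpha0 : 0 < alpha) (alpha1 : alpha <= 1) (K0 : 0 <= K) (mu0 : 0 < mu).
Hypotheses (hf0 : holder_density alpha K mu f0) (hP0 : has_density P0 f0).
Local Notation c := (balance K mu).
Local Notation pi := (node_mass P0).

(** The log-likelihood gained by a split below the second resolution level is
    at most this multiple of the logarithm of the sample size. *)
Definition noise_gain : R := 12 * K ^+ 2 / mu + 330.

Lemma noise_gain_ge0 : 0 <= noise_gain.
Proof.
apply: addr_ge0; last exact: ler0n.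
by rewrite divr_ge0 ?(ltW mu0)//; apply: mulr_ge0; [exact: ler0n|exact: sqr_ge0].
Qed.

Lemma imbalance_le_noise (n : nat) (l : R) (w : node) : 0 < n%:R :> R ->
  n%:R * (2 ^+ size w)^-1 * (((2 ^+ size w)^-1) `^ alpha) ^+ 2 <= l ->
  3 * imbalance P0 n w + 330 * l <= noise_gain * l.
Proof.
move=> n0; set h := (2 ^+ size w)^-1; set ha := h `^ alpha => hl.
have h0 : 0 < h by rewrite invr_gt0 exprn_gt0.
have ha0 : 0 <= ha by exact: powR_ge0.
have im := node_mass_imbalance alpha0 K0 mu0 hf0 hP0 w.
rewrite -/h -/ha in im.
have /andP[hm _] := node_mass_bounds alpha0 K0 mu0 hf0 hP0 w.
have p0 := node_mass_gt0 alpha0 K0 mu0 hf0 hP0 w.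
set dp := pi (rcons w false) - pi (rcons w true) in im.
have d2 : dp ^+ 2 <= (2 * K * ha * h) ^+ 2.
  rewrite -[dp ^+ 2]real_normK ?num_real//; apply: lerXn2r; rewrite ?nnegrE//.
    by rewrite !mulr_ge0// ltW.
  by rewrite -ler_pdivrMr// mulrC invrK.
have pm : mu * h <= pi w.
  by rewrite -ler_pdivlMr// mulrC invrK.
have iE : imbalance P0 n w = n%:R * (dp ^+ 2 / pi w).
  by rewrite /imbalance /dp; field; rewrite !gt_eqF.
have i1 : imbalance P0 n w <= 4 * K ^+ 2 / mu * l.
  rewrite iE; apply: (@le_trans _ _ (n%:R * ((2 * K * ha * h) ^+ 2 / (mu * h)))).
    rewrite ler_pM2l//; apply: ler_pM => //; first exact: sqr_ge0.
      by rewrite invr_ge0 ltW.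
    by rewrite lef_pV2 ?posrE// mulr_gt0.
  have -> : n%:R * ((2 * K * ha * h) ^+ 2 / (mu * h)) =
    4 * K ^+ 2 / mu * (n%:R * h * ha ^+ 2) by field; rewrite !gt_eqF.
  rewrite ler_wpM2l// divr_ge0 ?(ltW mu0)// mulr_ge0// sqr_ge0//.
rewrite /noise_gain.
have -> : (12 * K ^+ 2 / mu + 330) * l = 3 * (4 * K ^+ 2 / mu * l) + 330 * l by ring.
by rewrite lerD2r ler_pM2l.
Qed.

Variables (a Gamma : R) (d : measure_display) (Omega : measurableType d)
  (P : probability Omega R)
  (S : node -> {RV P >-> bool}) (Y : node -> {RV P >-> R}).
Hypothesis optSY : opt_variables (fun w => Gamma ^- size w) a S Y.
Hypothesis Gamma2 : 2 <= Gamma.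
Hypothesis Gamma_large : expR (6 * (noise_gain + 4)) <= Gamma.

(** Since [2 ^ L2] is at least a power of [n], so is [Gamma ^ L2], and with an
    exponent that is proportional to [ln Gamma]. *)
Lemma prior_cost (l : R) (L2 i : nat) : 0 < l -> l <= 6 * L2%:R -> (L2 <= i)%N ->
  Gamma ^- i <= expR (- ((noise_gain + 4) * l)).
Proof.
move=> l0 lL iL; have g0 := noise_gain_ge0.
have G0 : 0 < Gamma by rewrite (lt_le_trans _ Gamma_large) ?expR_gt0.
rewrite expRN lef_pV2 ?posrE ?expR_gt0 ?exprn_gt0//.
apply: (@le_trans _ _ (expR (6 * (noise_gain + 4)) ^+ i)); last first.
  by apply: lerXn2r; rewrite ?nnegrE ?expR_ge0// ltW.
rewrite -expRM_natl ler_expR.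
have h1 : l <= 6 * i%:R.
  by apply: (le_trans lL); rewrite ler_pM2l// ler_nat.
have g4 : 0 <= noise_gain + 4 by rewrite addr_ge0.
have := ler_wpM2l g4 h1.
have -> : (noise_gain + 4) * (6 * i%:R) = i%:R * (6 * (noise_gain + 4)) by ring.
by [].
Qed.

Variables (k A G : R).
Hypothesis k0 : 0 < k.
Hypothesis hk : forall n (x : n.-tuple R) w,
  let N0 := node_count x (rcons w false) in
  let N1 := node_count x (rcons w true) in
  (0 < N0)%N -> (0 < N1)%N -> (N0 + N1 <= n)%N ->
  c / 2 <= frequency N0 N1 -> c / 2 <= 1 - frequency N0 N1 ->
  k / n%:R * max_likelihood N0 N1 <= split_evidence Y x w setT.
Hypotheses (G0 : 0 <= G) (GammaE : Gamma = expR G) (A0 : 0 <= A).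
Hypothesis A_large : 3 * (2 * G + 2) + 2 <= A ^+ 2 / 36.
Hypothesis A_large2 : 576 <= A ^+ 2.

Variables (Lam l : R) (n : nat).
Hypothesis Lam_large : (3 + 6 * noise_constant K mu) / alpha <= Lam.
Hypothesis hn : n%:R = expR l.
Hypotheses (l_Lam : 27 * expR Lam <= l) (l8 : 8 <= l) (lk : 4 / k <= l)
  (lc : 576 <= c ^+ 2 * mu * l).

Let l0 : 0 < l. Proof. by apply: lt_le_trans l8. Qed.
Let l1 : 1 <= l. Proof. by apply: le_trans l8; rewrite ler1n. Qed.
Let n0 : 0 < n%:R :> R. Proof. by rewrite hn expR_gt0. Qed.
Let nc0 : 0 <= noise_constant K mu.
Proof.
apply: mulr_ge0; last by rewrite invr_ge0 ltW// balance_gt0.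
by apply: mulr_ge0; [exact: ler0n|exact: sqrtr_ge0].
Qed.
Let Lam3 : 3 / alpha <= Lam.
Proof.
by apply: le_trans Lam_large; rewrite ler_pM2r ?invr_gt0// lerDl mulr_ge0.
Qed.
Let lam : Lam <= l - 2 * ln l. Proof. exact: ln_growth. Qed.
Let lam0 : 0 <= l - 2 * ln l.
Proof. by apply: le_trans lam; apply: le_trans Lam3; rewrite divr_ge0// ltW. Qed.

Lemma node_mass_level (w : node) : (size w <= Lmax R n)%N ->
  mu * l ^+ 2 <= n%:R * pi w.
Proof.
move=> wL; have [hL _] := Lmax_itv l0 hn lam0.
have /andP[hm _] := node_mass_bounds alpha0 K0 mu0 hf0 hP0 w.
have w2 : 2 ^+ size w * l ^+ 2 <= n%:R.
  apply: le_trans hL; rewrite ler_wpM2r ?sqr_ge0//.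
  by rewrite ler_weXn2l// ler1n.
have m0 := ltW (node_mass_gt0 alpha0 K0 mu0 hf0 hP0 w).
apply: (@le_trans _ _ (2 ^+ size w * l ^+ 2 * pi w)); last by rewrite ler_wpM2r.
by rewrite mulrAC ler_wpM2r ?sqr_ge0.
Qed.

Lemma node_mass_large (w : node) : (size w <= Lmax R n)%N ->
  576 * l <= c ^+ 2 * (n%:R * pi w).
Proof.
move=> /node_mass_level h.
apply: (le_trans (ler_wpM2r (ltW l0) lc)).
have -> : c ^+ 2 * mu * l * l = c ^+ 2 * (mu * l ^+ 2) by ring.
by rewrite ler_wpM2l// sqr_ge0.
Qed.

Lemma node_mass_large4 (w : node) : (size w <= Lmax R n)%N ->
  4 * l <= n%:R * pi w.
Proof.
move=> wL; have m0 := node_mass_gt0 alpha0 K0 mu0 hf0 hP0 w.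
have c0 := balance_gt0 K0 mu0.
have c1 : c ^+ 2 <= 1.
  by rewrite expr_le1 ?(ltW c0)//; have := balance_le alpha0 K0 mu0 hf0 hP0; lra.
apply: (@le_trans _ _ (576 * l)); first by rewrite ler_wpM2r ?(ltW l0)// ler_nat.
apply: (le_trans (node_mass_large wL)).
by rewrite ler_piMl// mulr_ge0// ltW.
Qed.

(** The rate is at most [1 / (alpha / 3 * Lam)]. *)
Lemma rate_small : noise_constant K mu * rate alpha n <= 2^-1.
Proof.
rewrite (rateE _ l0 hn) expRN ler_pdivrMr ?expR_gt0//.
set th := alpha / (1 + 2 * alpha).
have th3 : alpha / 3 <= th.
  by rewrite ler_pM2l// lef_pV2 ?posrE//; have := alpha1; have := alpha0; lra.
have h1 : alpha * Lam <= alpha * (l - 2 * ln l) by rewrite ler_pM2l.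
have h2 : 3 + 6 * noise_constant K mu <= alpha * Lam.
  by rewrite [leRHS]mulrC -ler_pdivrMr.
have h3 : alpha / 3 * (l - 2 * ln l) <= th * (l - 2 * ln l) by rewrite ler_wpM2r.
have h4 := expR_ge1Dx (th * (l - 2 * ln l)).
move: h1 h2 h3 h4; move: (l - 2 * ln l) (expR _) (noise_constant K mu) => x E nc.
have -> : alpha / 3 * x = alpha * x / 3 by ring.
lra.
Qed.

Lemma posterior_large_sample (r : R) : total_constant K mu A <= r ->
  (\int[product_prob P0 n]_x posterior P (opt_density (Lmax R n) S Y) x
     [set f | ((r * rate alpha n)%:E < sup_dist f f0)%E] <=
   (7 / n%:R)%:E)%E.
Proof.
move=> hr; have [E [mE hE PE]] := atypical_prob l0
  (prob_unit_interval hf0 hP0) node_mass_large4.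
have [L1 [L2 [[L1L L1l L20 L1n L2n] [bias signal noise L2l deep]]]] :=
  levels_exist alpha0 alpha1 Lam3 l_Lam hn.
have le : l <= expR l by have := expR_ge1Dx l; lra.
have eps0 : 0 < rate alpha n by rewrite (rateE _ l0 hn) expR_gt0.
have typ x : ~ E x -> (posterior P (opt_density (Lmax R n) S Y) x
     [set f | ((r * rate alpha n)%:E < sup_dist f f0)%E] <=
     (3 * expR (- l))%:E)%E.
  move=> /hE hx.
  have k_large : 4 <= k * expR l.
    by rewrite -(ler_pdivrMl _ _ k0) mulrC; exact: le_trans le.
  have imb (w : node) : (L2 <= size w < Lmax R n)%N ->
      3 * imbalance P0 n w + 330 * l <= noise_gain * l.
    by move=> /andP[h _]; apply: imbalance_le_noise => //; exact: deep.
  have A_l : 576 <= A ^+ 2 * l.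
    by apply: (le_trans A_large2); rewrite ler_peMr// sqr_ge0.
  have rr : total_constant K mu A * rate alpha n <= r * rate alpha n.
    by rewrite ler_wpM2r// ltW.
  exact: (posterior_typical alpha0 K0 mu0 hf0 hP0 l1 hn node_mass_large hx optSY
    Gamma2 k0 (@hk n) k_large L1L L1l G0 GammaE imb
    (fun i => @prior_cost l L2 i l0 L2l) (le_trans l8 le) A_large A_l
    eps0 A0 bias signal noise rate_small L20 L1n L2n rr).
have e0 : 0 <= 3 * expR (- l) by rewrite mulr_ge0// expR_ge0.
apply: (le_trans (integral_le_on_large_event mE e0 _ typ PE)).
  by move=> x; exact: posterior_ge0_le1 optSY _ _ _ _.
rewrite lee_fin hn -expRN.
have nL : (2 ^ (Lmax R n))%:R <= expR l :> R.
  have [+ _] := Lmax_itv l0 hn lam0; rewrite natrX -hn; apply: le_trans.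
  by rewrite ler_peMr ?exprn_ge0// expr_ge1// ltW.
have e4 : expR (- (4 * l)) <= expR (- l) * expR (- l).
  exact/expR4_le/ltW.
have e1 : expR l * expR (- l) = 1 by rewrite -expRD subrr expR0.
have h1 : (2 ^ (Lmax R n).+1)%:R * (2 * expR (- (4 * l))) <=
    4 * (expR l * (expR (- l) * expR (- l))).
  rewrite expnS natrM; move: nL e4; have : 0 <= (2 ^ Lmax R n)%:R :> R by exact: ler0n.
  move: (_%:R : R) (expR (- (4 * l))) (expR_ge0 (- (4 * l))) => q e ee0 q0 hq he.
  have -> : 2 * q * (2 * e) = 4 * (q * e) by ring.
  by rewrite ler_pM2l//; exact: ler_pM.
have e2 : expR l * (expR (- l) * expR (- l)) = expR (- l).
  by rewrite mulrA e1 mul1r.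
rewrite e2 in h1.
have -> : 7 * expR (- l) = 3 * expR (- l) + 4 * expR (- l) by ring.
by rewrite lerD2l.
Qed.

End large_sample.

Theorem theorem3p1 (R : realType) (alpha K mu a : R) (f0 : R -> R)
    (P0 : probability R R)
    (halpha0 : 0 < alpha) (halpha1 : alpha <= 1) (hK : 0 <= K) (hmu : 0 < mu)
    (ha : 0 < a)
    (hf0 : holder_density alpha K mu f0) (hP0 : has_density P0 f0) :
  exists Gamma0 : R, forall Gamma : R, 0 < Gamma -> Gamma0 <= Gamma ->
  forall (d : measure_display) (Omega : measurableType d)
    (P : probability Omega R)
    (S : node -> {RV P >-> bool}) (Y : node -> {RV P >-> R}),
  opt_variables (fun w => Gamma ^- size w) a S Y ->
  forall M : nat -> R, M n @[n --> \oo] --> +oo ->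
  (\int[product_prob P0 n]_x
     posterior P (opt_density (Lmax R n) S Y) x
       [set f | ((M n * rate alpha n)%:E < sup_dist f f0)%E])%E
    @[n --> \oo] --> 0%E.
Proof.
pose C := noise_gain K mu.
exists (Num.max 2 (expR (6 * (C + 4)))) => Gamma _.
rewrite ge_max => /andP[Gamma2 GammaC] d Omega P S Y optSY M Minf.
pose c := balance K mu.
have c0 : 0 < c := balance_gt0 hK hmu.
have c20 : 0 < c / 2 by rewrite divr_gt0.
have [k k0 hk] := split_evidence_ge optSY c20.
pose G := ln Gamma.
have Gamma1 : 1 <= Gamma by apply: le_trans Gamma2; rewrite ler1n.
have G0 : 0 <= G by rewrite ln_ge0.
have GammaE : Gamma = expR G by rewrite lnK// posrE; exact: lt_le_trans Gamma1.
have [A [A0 AG A2]] : exists A : R,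
    [/\ 0 <= A, 3 * (2 * G + 2) + 2 <= A ^+ 2 / 36 & 576 <= A ^+ 2].
  exists (36 * (3 * (2 * G + 2) + 2)).
  have h8 : 8 <= 3 * (2 * G + 2) + 2 by lra.
  move: (3 * (2 * G + 2) + 2) h8 => x h8.
  have hx : 8 * x <= x ^+ 2 by rewrite expr2 ler_wpM2r//; lra.
  by split; rewrite ?exprMn; lra.
pose Lam := (3 + 6 * noise_constant K mu) / alpha.
have [B [B1 B2 B3 B4]] : exists B : R,
    [/\ 27 * expR Lam <= B, 8 <= B, 4 / k <= B & 576 / (c ^+ 2 * mu) <= B].
  exists (Num.max (Num.max (27 * expR Lam) 8) (Num.max (4 / k) (576 / (c ^+ 2 * mu)))).
  by split; rewrite !le_max lexx ?orbT.
have near1 : \forall n \near \oo, expR B <= n%:R.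
  exact: nbhs_infty_ger.
have near2 : \forall n \near \oo, total_constant K mu A <= M n.
  by move/cvgryPge : Minf; exact.
have key : \forall n \near \oo, (0 <=
  (\int[product_prob P0 n]_x posterior P (opt_density (Lmax R n) S Y) x
     [set f | ((M n * rate alpha n)%:E < sup_dist f f0)%E]) <=
   (14 * harmonic n)%:E)%E.
  near=> n.
  have nB : expR B <= n%:R by near: n.
  have Mn : total_constant K mu A <= M n by near: n.
  have n0 : 0 < n%:R :> R by apply: lt_le_trans nB; exact: expR_gt0.
  pose l : R := ln n%:R.
  have hn : n%:R = expR l by rewrite lnK.
  have lB : B <= l by rewrite -[B]expRK ler_ln ?posrE ?expR_gt0.
  have cm : 0 < c ^+ 2 * mu by rewrite mulr_gt0// exprn_gt0.
  have lc : 576 <= c ^+ 2 * mu * l.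
    by rewrite -(ler_pdivrMl _ _ cm) mulrC; exact: le_trans lB.
  apply/andP; split.
    apply: integral_ge0 => x _.
    by have /andP[] := posterior_ge0_le1 optSY (Lmax R n) x
      [set f | ((M n * rate alpha n)%:E < sup_dist f f0)%E].
  apply: (le_trans (posterior_large_sample halpha0 halpha1 hK hmu hf0 hP0 optSY
    Gamma2 GammaC k0 hk G0 GammaE A0 AG A2 (lexx Lam) hn (le_trans B1 lB)
    (le_trans B2 lB) (le_trans B3 lB) lc Mn)).
  by rewrite lee_fin; apply: inv_le_harmonic; rewrite -(ltr_nat R).
apply: (squeeze_cvge key); first exact: cvg_cst.
rewrite -[0%E]/(0%:E); apply: cvg_EFin; first by near=> n.
have -> : 0 = 14 * 0 :> R by rewrite mulr0.
by apply: cvgM; [exact: cvg_cst|exact: cvg_harmonic].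
Unshelve. all: by end_near.
Qed.
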